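(* Let $H$ be a real Hilbert space and let $A$ be a self-adjoint nonnegative linear operator on $H$ with dense domain $D(A)$. Let $m:[0,+\infty)\to(0,+\infty)$ be a function of class $C^{1}$ with $\inf_{\sigma\geq 0}m(\sigma)>0$, and let $(u_{0},u_{1})\in D(A)\times D(A^{1/2})$. For $\varepsilon>0$ consider the Cauchy problem $$\varepsilon u_{\varepsilon}''(t)+\frac{1}{1+t}\,u_{\varepsilon}'(t)+m\bigl(|A^{1/2}u_{\varepsilon}(t)|^{2}\bigr)Au_{\varepsilon}(t)=0\quad\forall t\geq 0,\qquad u_{\varepsilon}(0)=u_{0},\quad u_{\varepsilon}'(0)=u_{1}. \quad ( * )$$ Then there exists $\varepsilon_{0}>0$ such that for every $\varepsilon\in(0,\varepsilon_{0})$ problem $( * )$ has a unique global solution $$u_{\varepsilon}\in C^{2}([0,+\infty);H)\cap C^{1}([0,+\infty);D(A^{1/2}))\cap C^{0}([0,+\infty);D(A)).$$ Moreover there exists a constant $C$, independent of $\varepsilon\in(0,\varepsilon_0)$ and of $t$, such that $$|u_{\varepsilon}(t)|^{2}\leq C\quad\forall t\geq 0;$$ $$|A^{1/2}u_{\varepsilon}(t)|^{2}\leq\frac{C}{(1+t)^{2}}\quad\forall t\geq 0;$$ $$|u_{\varepsilon}'(t)|^{2}\leq\frac{C}{(1+t)^{2}}\quad\forall t\geq 0;$$ $$\int_{0}^{+\infty}(1+s)\left(|u_{\varepsilon}'(s)|^{2}+|A^{1/2}u_{\varepsilon}(s)|^{2}\right)ds\leq C;$$ $$\varepsilon|A^{1/2}u_{\varepsilon}'(t)|^{2}+|Au_{\varepsilon}(t)|^{2}\leq\frac{C}{(1+t)^{4}}\quad\forall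 t\geq 0;$$ $$\int_{0}^{+\infty}(1+s)^{3}\left(|A^{1/2}u_{\varepsilon}'(s)|^{2}+|Au_{\varepsilon}(s)|^{2}\right)ds\leq C.$$
   Context: $|x|$ and $\langle x,y\rangle$ denote the norm and the scalar product in $H$. The operator $A$ is nonnegative in the sense that $\langle Ax,x\rangle\geq 0$ for all $x\in D(A)$; it is not assumed to be coercive. For $\alpha\geq 0$ the power $A^{\alpha}$, with domain $D(A^{\alpha})$, is defined by the spectral theorem, and $D(A^{\alpha})$ carries the graph norm. *)

(* Defs.v *)
From HB Require Import structures.
From mathcomp Require Import all_boot all_order all_algebra.
From mathcomp Require Import all_classical all_reals all_analysis.

Set Implicit Arguments.
Unset Strict Implicit.
Unset Printing Implicit Defensive.

Import Order.TTheory GRing.Theory Num.Theory.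
Import numFieldNormedType.Exports.

Local Open Scope classical_set_scope.
Local Open Scope ring_scope.

Section Hilbert.
Context {R : realType} {H : completeNormedModType R}.

(* Together with the completeness of [H], this makes [H] a real Hilbert space
   with scalar product [ip]. *)
Definition induces_norm (ip : {dot H for idfun}) : Prop :=
  forall x : H, `|x| ^+ 2 = ip x x.

(* A partially defined operator; the values of [op_fun] outside [dom] carry no
   meaning. *)
Record operator := Operator { dom : set H ; op_fun :> H -> H }.

Definition graph (A : operator) (x y : H) : Prop := dom A x /\ A x = y.

Definition linear_operator (A : operator) : Prop :=
  dom A 0 /\
  forall (a : R) (x y : H), dom A x -> dom A y ->
    dom A (a *: x + y) /\ A (a *: x + y) = a *: A x + A y.

Section ScalarProduct.
Variable ip : {dot H for idfun}.

Definition adjoint_graph (A : operator) (y z : H) : Prop :=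
  forall x, dom A x -> ip (A x) y = ip x z.

Definition self_adjoint (A : operator) : Prop :=
  [/\ linear_operator A, dense (dom A) &
      forall y z, adjoint_graph A y z <-> graph A y z].

Definition nonnegative (A : operator) : Prop :=
  forall x, dom A x -> 0 <= ip (A x) x.

(* Projection-valued measures on the Borel sets of the real line.  Since
   [proj S] is an orthogonal projection, [`|proj S x| ^+ 2] is the usual
   [ip (proj S x) x]; the norm form is nonnegative for every set [S], as the
   library requires of a measure. *)
Record spectral_measure := SpectralMeasure {
  proj : set R -> H -> H ;
  proj_linear : forall S, measurable S -> linear (proj S) ;
  proj_sym : forall S, measurable S ->
    forall x y, ip (proj S x) y = ip x (proj S y) ;
  projI : forall S T, measurable S -> measurable T ->
    forall x, proj (S `&` T) x = proj S (proj T x) ;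
  proj0 : forall x, proj set0 x = 0 ;
  projT : forall x, proj setT x = x ;
  proj_sigma_additive : forall x,
    semi_sigma_additive (fun S : set R => (`|proj S x| ^+ 2)%:E) }.

Definition scalar_measure (E : spectral_measure) (x : H) :
    set (measurableTypeR R) -> \bar R :=
  fun S => (`|proj E S x| ^+ 2)%:E.

Section ScalarMeasure.
Variables (E : spectral_measure) (x : H).

Let mu0 : scalar_measure E x set0 = 0%E.
Proof. by rewrite /scalar_measure proj0 normr0 expr0n. Qed.

Let mu_ge0 S : (0 <= scalar_measure E x S)%E.
Proof. by rewrite /scalar_measure lee_fin exprn_ge0. Qed.

Let mu_additive : semi_sigma_additive (scalar_measure E x).
Proof. exact: proj_sigma_additive. Qed.

HB.instance Definition _ := isMeasure.Build _ (measurableTypeR R) R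
  (scalar_measure E x) mu0 mu_ge0 mu_additive.

End ScalarMeasure.

Definition spec_dom (E : spectral_measure) (f : R -> R) : set H :=
  [set x | (\int[scalar_measure E x]_l (f l ^+ 2)%:E < +oo)%E].

(* Graph of the operator [\int f dE]: its domain is [spec_dom E f], and there
   [ip y z] is the integral of [f] against the signed measure
   [S |-> ip (proj E S x) z], written by polarization. As [spec_dom E f] is
   dense for [f] measurable, [y] is determined by [x]. *)
Definition spec_graph (E : spectral_measure) (f : R -> R) (x y : H) : Prop :=
  spec_dom E f x /\
  forall z, spec_dom E f z ->
    ip y z = (\int[scalar_measure E (x + z)]_l f l
              - \int[scalar_measure E (x - z)]_l f l) / 4.

(* [A = \int l dE(l)]; such an [E] exists and is unique for a self-adjoint [A],
   by the spectral theorem. *)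
Definition spectral_resolution (A : operator) (E : spectral_measure) : Prop :=
  forall x y, graph A x y <-> spec_graph E id x y.

(* [A^a = \int l^a dE(l)] for [A] self-adjoint and nonnegative. The spectral
   measure then vanishes on the negative half-line, so the values of [powR]
   there play no role. *)
Definition pow_graph (A : operator) (a : R) (x y : H) : Prop :=
  exists E : spectral_measure,
    spectral_resolution A E /\ spec_graph E (fun l => l `^ a) x y.

Definition op_pow (A : operator) (a : R) : operator :=
  Operator [set x | exists y, pow_graph A a x y]
           (fun x => xget 0 [set y | pow_graph A a x y]).

End ScalarProduct.

Definition graph_norm (A : operator) (x : H) : R :=
  Num.sqrt (`|x| ^+ 2 + `|A x| ^+ 2).

End Hilbert.

Section HalfLine.
Context {R : realType}.

Definition half_line : set R := `[0, +oo[%classic.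

(* Functions on [0, +oo[ are represented by functions on the real line whose
   values at negative arguments are never used; limits are taken within
   [0, +oo[, so that derivatives at 0 are one-sided. *)
Definition diff_quotient {V : normedModType R} (f : R -> V) (t s : R) : V :=
  (s - t)^-1 *: (f s - f t).

Definition derivable_hl {V : normedModType R} (f : R -> V) (t : R) : Prop :=
  cvg (diff_quotient f t s @[s --> within half_line (dnbhs t)]).

Definition derive_hl {V : normedModType R} (f : R -> V) (t : R) : V :=
  lim (diff_quotient f t s @[s --> within half_line (dnbhs t)]).

Definition C1_hl {V : normedModType R} (f : R -> V) : Prop :=
  (forall t, 0 <= t -> derivable_hl f t) /\
  {within half_line, continuous (derive_hl f)}.

Definition C2_hl {V : normedModType R} (f : R -> V) : Prop :=
  C1_hl f /\ C1_hl (derive_hl f).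

Context {H : completeNormedModType R}.

(* Continuity and continuous differentiability of maps from [0, +oo[ to
   [dom B] endowed with the graph norm of [B]. *)
Definition C0_dom (B : @operator R H) (u : R -> H) : Prop :=
  forall t, 0 <= t -> dom B (u t) /\
    graph_norm B (u s - u t) @[s --> within half_line (nbhs t)] --> (0 : R).

Definition C1_dom (B : @operator R H) (u : R -> H) : Prop :=
  C0_dom B u /\
  exists v : R -> H, C0_dom B v /\
    forall t, 0 <= t ->
      graph_norm B (diff_quotient u t s - v t)
        @[s --> within half_line (dnbhs t)] --> (0 : R).

Definition kirchhoff_solution (ip : {dot H for idfun}) (A : @operator R H)
    (m : R -> R) (u0 u1 : H) (eps : R) (u : R -> H) : Prop :=
  let B := op_pow ip A 2^-1 in
  [/\ C2_hl u, C1_dom B u & C0_dom A u] /\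
  [/\ forall t, 0 <= t ->
        eps *: derive_hl (derive_hl u) t + (1 + t)^-1 *: derive_hl u t
          + m (`|B (u t)| ^+ 2) *: A (u t) = 0,
      u 0 = u0 & derive_hl u 0 = u1].

End HalfLine.

(* Main.v *)
(** With [w = 1 + t] and [c = m(|A^(1/2) u|^2)], the solution is controlled by a
    linear Lyapunov function: the weighted energies
    [w^2 (eps |u'|^2 / c + |A^(1/2) u|^2)] and
    [w^4 (eps |A^(1/2) u'|^2 / c + |A u|^2)], corrected by multiples of
    [<u', u>] and [<u', A u>], have a nonincreasing combination whose
    dissipation bounds both integrals, provided that [eps w |c'| <= c / 2].
    Since [|c'|] is itself bounded by [|A u| |u'|], which these estimates make
    of order [w^-3], that proviso is never violated when [eps] is small
    (continuity argument). Solutions are limits of the Galerkin approximations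
    [P_n u] given by spectral projections, with a coefficient truncated at a
    level that the energy never reaches. The limit is strong because the
    equation satisfied by [(1 - P_j) u_n] is linear with the same coefficient:
    the Lyapunov estimate bounds these tails by the tails of the initial data,
    uniformly in [n]. *)
Require Import Defs.
From mathcomp Require Import all_boot all_order all_algebra.
From mathcomp Require Import all_classical all_reals all_analysis.
From mathcomp Require Import measurable_realfun ring lra.
Import Order.TTheory GRing.Theory Num.Theory.
Import numFieldNormedType.Exports HBNNSimple.
Local Open Scope classical_set_scope.
Local Open Scope ring_scope.

Set Implicit Arguments.
Unset Strict Implicit.
Unset Printing Implicit Defensive.

(** * Scalar products *)

(** The friction dissipates only |u'|^2, so nothing in the plain energies offsets the growth of a
    weight on |A^(1/2) u|^2 or |A u|^2. Differentiating <u', u> and <u', A u> produces -c times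
    these two quantities. The mixed terms enter with factors 3/nu and 5/nu because the derivatives
    of w^2 and w^4 consume 2 and 4, and one unit must be left for the integral bounds. All constants
    must be uniform in eps, whereas the energies control only eps |u'|^2. The bound of |u'| comes
    separately, from reading the equation as a first order equation for u' with friction 1/w. Strong
    limits are needed because the solution has to be continuous into D(A). [op_pow] quantifies
    existentially over spectral measures, so A^(1/2) is only meaningful once any two resolutions of
    A are known to have the same scalar measures. This is obtained by comparing the growth of |A^k
    x| as seen by the two resolutions. *)

Lemma cvgn_unique {R : realType} {V : normedModType R} (u : nat -> V) (x y : V) :
  u n @[n --> \oo] --> x -> u n @[n --> \oo] --> y -> x = y.
Proof.
move=> /(cvg_lim (@norm_hausdorff _ _)) ux /(cvg_lim (@norm_hausdorff _ _)).
by rewrite ux.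
Qed.

(** Fatou's lemma in the form used twice: to show that a vector lies in a spectral domain, and to
    carry the dissipation integral from the approximations to the limit. *)
Lemma fatou_le_cst d (T : measurableType d) {R : realType}
    (mu : {measure set T -> \bar R}) (D : set T) (f_ : nat -> T -> \bar R) (f : T -> \bar R) C :
  measurable D -> (forall n, measurable_fun D (f_ n)) ->
  (forall n l, D l -> (0 <= f_ n l)%E) ->
  (forall l, D l -> f_ n l @[n --> \oo] --> f l) ->
  (forall n, (\int[mu]_(l in D) f_ n l <= C)%E) ->
  (\int[mu]_(l in D) f l <= C)%E.
Proof.
move=> mD mf_ f_0 ff hC; have := fatou mu mD mf_ f_0.
rewrite (eq_integral f) => [/le_trans|l /set_mem Dl]; last first.
  by have [] := cvg_limn_einf_sup (ff _ Dl).
apply; rewrite limn_einf_lim; apply: lime_le; first exact: is_cvg_einfs.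
near=> n; apply: le_trans (hC n); apply: ereal_inf_lbound.
by exists n => //=.
Unshelve. all: by end_near. Qed.

Lemma cvgn_le {R : realType} (u : nat -> R) (x a : R) :
  u n @[n --> \oo] --> x -> (forall n, u n <= a) -> x <= a.
Proof.
move=> ux ua; rewrite -(cvg_lim (@Rhausdorff R) ux).
by apply: limr_le; [apply/cvg_ex; exists x|exact: nearW].
Qed.

Lemma cvgn_ge {R : realType} (u : nat -> R) (x a : R) :
  u n @[n --> \oo] --> x -> (forall n, a <= u n) -> a <= x.
Proof.
move=> ux ua; rewrite -(cvg_lim (@Rhausdorff R) ux).
by apply: limr_ge; [apply/cvg_ex; exists x|exact: nearW].
Qed.

Lemma cvgn_norm_le {R : realType} {V : normedModType R} (u : nat -> V) (x : V) (a : R) :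
  u n @[n --> \oo] --> x -> (forall n, `|u n| <= a) -> `|x| <= a.
Proof. by move=> /cvg_norm ux; exact: cvgn_le ux. Qed.

Lemma cauchy_cvgn {R : realType} {H : completeNormedModType R} (u : nat -> H) :
  (forall e : R, 0 < e -> exists N, forall n, (N <= n)%N -> `|u N - u n| < e) ->
  cvgn u.
Proof.
move=> h; apply/cauchy_cvgP; apply: cauchy_exP => e e0.
have [N hN] := h _ e0; exists (u N); exists N => // n /= Nn.
by rewrite -ball_normE; exact: hN.
Qed.

Section ScalarProductTheory.
Context {R : realType} {H : completeNormedModType R} {ip : {dot H for idfun}}.

Lemma ipC x y : ip x y = ip y x.
Proof. by rewrite hermC mul1r. Qed.

Lemma ipDl x y z : ip (x + y) z = ip x z + ip y z.
Proof. exact: linearDl. Qed.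
Lemma ipDr x y z : ip x (y + z) = ip x y + ip x z.
Proof. exact: linearDr. Qed.
Lemma ipBl x y z : ip (x - y) z = ip x z - ip y z.
Proof. exact: linearBl. Qed.
Lemma ipBr x y z : ip x (y - z) = ip x y - ip x z.
Proof. exact: linearBr. Qed.
Lemma ipNl x y : ip (- x) y = - ip x y.
Proof. exact: linearNl. Qed.
Lemma ipNr x y : ip x (- y) = - ip x y.
Proof. exact: linearNr. Qed.
Lemma ip0l x : ip 0 x = 0.
Proof. exact: linear0l. Qed.
Lemma ip0r x : ip x 0 = 0.
Proof. exact: linear0r. Qed.
Lemma ipZl a x y : ip (a *: x) y = a * ip x y.
Proof. exact: linearZl_LR. Qed.
Lemma ipZr a x y : ip x (a *: y) = a * ip x y.
Proof. exact: linearZr_LR. Qed.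

Hypothesis hip : induces_norm ip.

Lemma normrDsq x y : `|x + y| ^+ 2 = `|x| ^+ 2 + 2 * ip x y + `|y| ^+ 2.
Proof. by rewrite !hip !ipDl !ipDr (ipC y x); ring. Qed.

Lemma normrBsq x y : `|x - y| ^+ 2 = `|x| ^+ 2 - 2 * ip x y + `|y| ^+ 2.
Proof. by rewrite !hip !ipBl !ipBr (ipC y x); ring. Qed.

Lemma ip_polar x y : ip x y = (`|x + y| ^+ 2 - `|x - y| ^+ 2) / 4.
Proof. by rewrite normrDsq normrBsq; field. Qed.

Lemma ler_ip x y : `|ip x y| <= `|x| * `|y|.
Proof.
have h a : 0 <= a ^+ 2 * `|x| ^+ 2 - 2 * a * ip x y + `|y| ^+ 2.
  have := sqr_ge0 `|a *: x - y|; rewrite normrBsq ipZl normrZ exprMn.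
  by rewrite real_normK ?num_real// !mulrA.
have [->|x0] := eqVneq x 0; first by rewrite ip0l !normr0 mul0r.
have x2 : 0 < `|x| ^+ 2 by rewrite exprn_gt0// normr_gt0.
suff h2 : ip x y ^+ 2 <= `|x| ^+ 2 * `|y| ^+ 2.
  rewrite -(@ler_pXn2r _ 2%N)// ?nnegrE ?mulr_ge0//.
  by rewrite exprMn real_normK ?num_real.
(* This value of [a] minimizes the quadratic polynomial in [h]. *)
have := h (ip x y / `|x| ^+ 2).
have -> : (ip x y / `|x| ^+ 2) ^+ 2 * `|x| ^+ 2 -
   2 * (ip x y / `|x| ^+ 2) * ip x y + `|y| ^+ 2 =
  (`|x| ^+ 2 * `|y| ^+ 2 - ip x y ^+ 2) / `|x| ^+ 2.
  by field; rewrite normr_eq0.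
by rewrite pmulr_lge0 ?invr_gt0// subr_ge0.
Qed.

Lemma cvg_normsq {T} {F : set_system T} {FF : Filter F} (f : T -> H) x :
  f @ F --> x -> (fun t => `|f t| ^+ 2) @ F --> `|x| ^+ 2.
Proof.
move=> fx; apply: (@cvg_comp _ _ _ (fun t => `|f t|) (fun r => r ^+ 2)).
  exact: (cvg_norm fx).
exact: exprn_continuous.
Qed.

(** Polarization reduces joint continuity of the scalar product to continuity of the norm. *)
Lemma ip_cvg {T} {F : set_system T} {FF : Filter F} (f g : T -> H) x y :
  f @ F --> x -> g @ F --> y -> (fun t => ip (f t) (g t)) @ F --> ip x y.
Proof.
move=> fx gy.
have -> : (fun t => ip (f t) (g t)) =
  (fun t => (`|f t + g t| ^+ 2 - `|f t - g t| ^+ 2) / 4).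
  by apply/funext => t; rewrite ip_polar.
rewrite ip_polar; apply: cvgMl; apply: cvgB.
  by apply: cvg_normsq; exact: cvgD.
by apply: cvg_normsq; exact: cvgB.
Qed.

Lemma ip_injl x y : (forall z, ip x z = ip y z) -> x = y.
Proof.
move=> h; apply/eqP; rewrite -subr_eq0 -normr_eq0 -sqrf_eq0 hip.
by rewrite ipBl h subrr.
Qed.

Lemma ip_dense_inj (D : set H) x y : dense D ->
  (forall z, D z -> ip x z = ip y z) -> x = y.
Proof.
move=> dD h; set w := x - y.
have hw z : D z -> ip w z = 0 by move=> /h; rewrite ipBl => ->; rewrite subrr.
apply/eqP; rewrite -subr_eq0 -/w; apply/negP => /negP w0.
have w_gt0 : 0 < `|w| by rewrite normr_gt0.
(* Density gives a point of [D] closer to [w] than 0 is; being orthogonal to [w], it is at least as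
   far by Pythagoras. *)
have [z [Bz /hw wz]] : (ball w `|w| `&` D) !=set0.
  apply: dD; first by exists w; exact: ballxx.
  exact: ball_open.
have : `|w - z| ^+ 2 < `|w| ^+ 2.
  by rewrite ltr_pXn2r// ?nnegrE//; move: Bz; rewrite -ball_normE.
rewrite normrBsq wz mulr0 subr0 -ltrBrDl subrr.
by rewrite ltNge sqr_ge0.
Qed.

End ScalarProductTheory.

(** * Spectral calculus *)

Section SpectralMeasureTheory.
Context {R : realType} {H : completeNormedModType R} {ip : {dot H for idfun}}.
Hypothesis hip : induces_norm ip.
Variable E : spectral_measure ip.
Local Notation P := (Defs.proj E).
Local Notation mu := (scalar_measure E).
Implicit Types (S T : set R) (x y z : H) (f g h : R -> R).

Lemma projD S x y : measurable S -> P S (x + y) = P S x + P S y.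
Proof. by move=> mS; have := proj_linear E mS 1 x y; rewrite !scale1r. Qed.

Lemma proj_0 S : measurable S -> P S 0 = 0.
Proof.
move=> mS; have := projD 0 0 mS; rewrite addr0 => /eqP.
by rewrite -subr_eq0 opprD addNKr oppr_eq0 => /eqP.
Qed.

Lemma projZ S a x : measurable S -> P S (a *: x) = a *: P S x.
Proof.
by move=> mS; have := proj_linear E mS a x 0; rewrite proj_0// !addr0.
Qed.

Lemma proj_idem S x : measurable S -> P S (P S x) = P S x.
Proof. by move=> mS; rewrite -projI// setIid. Qed.

Lemma projCA S T x : measurable S -> measurable T -> P S (P T x) = P T (P S x).
Proof. by move=> mS mT; rewrite -!projI// setIC. Qed.

Lemma proj_ip S x : measurable S -> ip (P S x) x = `|P S x| ^+ 2.
Proof. by move=> mS; rewrite hip [RHS](proj_sym E mS) proj_idem// ipC. Qed.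

Lemma proj_contr S x : measurable S -> `|P S x| <= `|x|.
Proof.
move=> mS; have [->|n0] := eqVneq (P S x) 0; first by rewrite normr0.
have : `|P S x| * `|P S x| <= `|P S x| * `|x|.
  rewrite -expr2 -proj_ip//.
  by apply: le_trans (ler_norm _) _; exact: ler_ip.
by rewrite ler_pM2l// normr_gt0.
Qed.

(** The record postulates additivity of squared norms only. Additivity of the vectors follows by
    expanding the squared norm of the difference, whose cross term vanishes by [projI] and
    [proj0]. *)
Lemma proj_compl S x : measurable S -> P (~` S) x = x - P S x.
Proof.
move=> mS; have mC : measurable (~` S) by exact: measurableC.
have h : `|x| ^+ 2 = `|P S x| ^+ 2 + `|P (~` S) x| ^+ 2.
  have := @measureU _ _ _ (mu x) S (~` S) mS mC (setICr S).
  move=> h; have {h} : (mu x (S `|` ~` S) = mu x S + mu x (~` S))%E := h; rewrite setUv /scalar_measure projT => /eqP.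
  by rewrite eqe => /eqP.
apply/eqP; rewrite eq_sym -subr_eq0 -normr_eq0 -sqrf_eq0 !(normrBsq hip) h !ipBl.
rewrite (ipC x) proj_ip// (ipC x) proj_ip//.
by rewrite (proj_sym E mS) -projI// setICr proj0 ip0r; apply/eqP; ring.
Qed.

Lemma scalar_measure_lty x (S : set R) : measurable S -> (mu x S < +oo)%E.
Proof. by move=> _; rewrite /scalar_measure ltry. Qed.

(* [simple_op g F] relates a step function [g] to the operator [\int g dE]. *)
Inductive simple_op : (R -> R) -> (H -> H) -> Prop :=
| simple_op0 : simple_op (fun=> 0) (fun=> 0)
| simple_op_step a S g F : measurable S -> simple_op g F ->
    simple_op (fun l => a * \1_S l + g l) (fun x => a *: P S x + F x).

Lemma simple_op_ext f g F G : f =1 g -> F =1 G -> simple_op f F -> simple_op g G.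
Proof. by move=> /funext -> /funext ->. Qed.

Lemma simple_opD f g F G : simple_op f F -> simple_op g G ->
  simple_op (fun l => f l + g l) (fun x => F x + G x).
Proof.
move=> sf sg; elim: sf => [|a S f' F' mS _ IH].
  by apply: simple_op_ext sg => l; rewrite add0r.
by apply: simple_op_ext (simple_op_step a mS IH) => l; rewrite addrA.
Qed.

Lemma simple_opZ a f F : simple_op f F ->
  simple_op (fun l => a * f l) (fun x => a *: F x).
Proof.
elim=> [|b S f' F' mS _ IH].
  by apply: simple_op_ext simple_op0 => l; rewrite ?mulr0 ?scaler0.
by apply: simple_op_ext (simple_op_step (a * b) mS IH) => l;
  rewrite ?mulrDr ?scalerDr ?mulrA ?scalerA.
Qed.

Lemma simple_op_indic S : measurable S -> simple_op \1_S (P S).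
Proof.
move=> mS; apply: simple_op_ext (simple_op_step 1 mS simple_op0) => l.
  by rewrite mul1r addr0.
by rewrite scale1r addr0.
Qed.

Lemma simple_opMind S f F : measurable S -> simple_op f F ->
  simple_op (fun l => \1_S l * f l) (fun x => P S (F x)).
Proof.
move=> mS; elim=> [|b T f' F' mT _ IH].
  by apply: simple_op_ext simple_op0 => l; rewrite ?mulr0 ?proj_0.
apply: simple_op_ext (simple_op_step b (measurableI _ _ mS mT) IH) => l.
  by rewrite mulrDr indicI /= mulrCA.
by rewrite projD// projZ// projI.
Qed.

Lemma simple_op_proj S f F x : measurable S -> simple_op f F ->
  F (P S x) = P S (F x).
Proof.
move=> mS; elim=> [|b T f' F' mT _ IH]; first by rewrite proj_0.
by rewrite projD// projZ// IH projCA.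
Qed.

Lemma simple_opM f g F G : simple_op f F -> simple_op g G ->
  simple_op (fun l => f l * g l) (fun x => F (G x)).
Proof.
move=> sf sg; elim: sf => [|a S f' F' mS _ IH].
  by apply: simple_op_ext simple_op0 => l; rewrite ?mul0r.
apply: simple_op_ext (simple_opD (simple_opZ a (simple_opMind mS sg)) IH) => l //.
by rewrite mulrDl mulrA.
Qed.

Lemma simple_op_sym f F x y : simple_op f F -> ip (F x) y = ip x (F y).
Proof.
elim=> [|b T f' F' mT _ IH]; first by rewrite ip0l ip0r.
by rewrite ipDl ipDr IH ipZl ipZr (proj_sym E mT).
Qed.

Lemma simple_opP f F a x y : simple_op f F -> F (a *: x + y) = a *: F x + F y.
Proof.
elim=> [|b T f' F' mT _ IH]; first by rewrite addr0 scaler0.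
rewrite IH projD// projZ// !scalerDr !scalerA (mulrC a b).
by rewrite -!addrA; congr (_ + _); rewrite addrCA.
Qed.

Lemma simple_op_measurable f F : simple_op f F -> measurable_fun [set: measurableTypeR R] f.
Proof.
elim=> [|b T f' F' mT _ IH]; first exact: measurable_cst.
apply: measurable_funD => //; apply: measurable_funM; first exact: measurable_cst.
exact: measurable_indic.
Qed.

Lemma integrable_indic_mu S x : measurable S ->
  (mu x).-integrable [set: measurableTypeR R] (EFin \o (\1_S : R -> R)).
Proof.
move=> mS; apply: measurable_bounded_integrable => //.
- exact: scalar_measure_lty.
- exists 1; split; rewrite ?num_real// => M M1 l _ /=.
  by rewrite indicE; case: (_ \in _); rewrite ?normr1 ?normr0 ltW// (lt_trans _ M1).
Qed.

Lemma simple_op_integrable f F x : simple_op f F ->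
  (mu x).-integrable [set: measurableTypeR R] (EFin \o f).
Proof.
elim=> [|b T f' F' mT _ IH]; first exact: integrable0.
rewrite (_ : _ \o _ = ((fun l => b%:E * (EFin \o \1_T) l) \+ (EFin \o f'))%E).
  by apply: integrableD => //; apply: integrableZl => //; exact: integrable_indic_mu.
by apply/funext => l /=.
Qed.

Lemma simple_op_int f F x : simple_op f F -> \int[mu x]_l f l = ip (F x) x.
Proof.
elim=> [|b T f' F' mT sf IH].
  by rewrite ip0l /Rintegral integral0.
rewrite RintegralD//; last first.
- exact: simple_op_integrable sf.
- rewrite (_ : _ \o _ = ((fun l => b%:E * (EFin \o \1_T) l))%E)//.
  by apply: integrableZl => //; exact: integrable_indic_mu.
rewrite IH ipDl RintegralZl//; last exact: integrable_indic_mu.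
congr (_ + _); rewrite ipZl proj_ip//; congr (_ * _).
by rewrite /Rintegral integral_indic// setIT.
Qed.

Lemma simple_op_normsq f F x : simple_op f F ->
  `|F x| ^+ 2 = \int[mu x]_l (f l ^+ 2).
Proof.
move=> sf; rewrite hip; under eq_Rintegral do rewrite expr2.
by rewrite (simple_op_int x (simple_opM sf sf)) (simple_op_sym _ _ sf) ipC.
Qed.


Lemma cvg_int_dominated x (g_ : nat -> R -> R) f h :
  (forall n, measurable_fun [set: measurableTypeR R] (g_ n)) -> measurable_fun [set: measurableTypeR R] f ->
  (mu x).-integrable [set: measurableTypeR R] (EFin \o h) ->
  (forall n l, `|g_ n l| <= h l) ->
  (forall l, g_ n l @[n --> \oo] --> f l) ->
  \int[mu x]_l g_ n l @[n --> \oo] --> \int[mu x]_l f l.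
Proof.
move=> mg mf ih gh gf; pose f_ n := EFin \o g_ n.
have mf_ n : measurable_fun [set: measurableTypeR R] (f_ n) by exact/measurable_EFinP.
have mf' : measurable_fun [set: measurableTypeR R] (EFin \o f) by exact/measurable_EFinP.
have [] := dominated_convergence measurableT mf_ mf' _ ih.
- by apply: aeW => l _; apply: cvg_EFin; [exact: nearW|exact: gf].
- by apply: aeW => l n _; rewrite lee_fin.
move=> iF _ h3; apply: fine_cvg.
rewrite fineK; first exact: h3.
exact: integrable_fin_num.
Qed.

Definition approximates f (s : nat -> R -> R) (F : nat -> H -> H) :=
  [/\ forall n, simple_op (s n) (F n), forall n l, `|s n l| <= `|f l| &
      forall l, s n l @[n --> \oo] --> f l].

Lemma simple_op_nnsfun (g : {nnsfun measurableTypeR R >-> R}) :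
  exists F, simple_op (g : measurableTypeR R -> R) F.
Proof.
suff [F sF] : exists F, simple_op
    (fun l => \sum_(y <- finmap.enum_fset (fset_set (range g))) y * \1_(g @^-1` [set y]) l) F.
  exists F; apply: simple_op_ext sF => // l.
  by rewrite [RHS]fimfunE fsbig_finite.
elim: (finmap.enum_fset (fset_set (range g))) => [|y s [F sF]].
  by eexists; apply: simple_op_ext simple_op0 => // l; rewrite big_nil.
exists (fun x => y *: P (g @^-1` [set y]) x + F x).
have my : measurable ((g : measurableTypeR R -> R) @^-1` [set y]).
  exact: measurable_funPTI.
by apply: simple_op_ext (simple_op_step y my sF) => // l; rewrite big_cons.
Qed.

Lemma nonneg_approximates f : measurable_fun [set: measurableTypeR R] f -> (forall l, 0 <= f l) ->
  exists s F, approximates f s F.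
Proof.
move=> mf f0.
have mf' : measurable_fun [set: measurableTypeR R] (EFin \o f).
  exact/measurable_EFinP.
pose s := nnsfun_approx measurableT mf'.
have /choice [F sF] : forall n, exists F, simple_op (s n : measurableTypeR R -> R) F.
  by move=> n; exact: simple_op_nnsfun.
have f0' l : [set: measurableTypeR R] l -> (0 <= (EFin \o f) l)%E.
  by move=> _; rewrite lee_fin.
exists (fun n => s n : measurableTypeR R -> R), F; split => // [n l|l].
  rewrite ger0_norm// ger0_norm// /s nnsfun_approxE -lee_fin.
  exact: (le_approx n f0').
exact: (fine_cvg (cvg_nnsfun_approx measurableT mf' f0' I)).
Qed.

Lemma approximates_exists f : measurable_fun [set: measurableTypeR R] f ->
  exists s F, approximates f s F.
Proof.
move=> mf.
have [s [F [sF sf slim]]] := nonneg_approximates (measurable_funrpos mf) (funrpos_ge0 f).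
have [t [G [tG tf tlim]]] := nonneg_approximates (measurable_funrneg mf) (funrneg_ge0 f).
exists (fun n l => s n l + -1 * t n l), (fun n x => F n x + -1 *: G n x).
split => [n|n l|l].
(* Wherever one of the two parts of [f] vanishes, so does its approximation; hence the difference is
   still dominated by [|f|]. *)
- by apply: simple_opD => //; exact: simple_opZ.
- have := sf n l; have := tf n l; rewrite /funrpos /funrneg => h1 h2.
  have [fl|fl] := leP 0 (f l).
    rewrite max_r ?oppr_le0// normr0 in h1.
    rewrite max_l// in h2.
    have -> : t n l = 0 by apply/eqP; rewrite -normr_le0.
    by rewrite mulr0 addr0.
  rewrite (max_r (ltW fl)) normr0 in h2.
  rewrite max_l ?oppr_ge0 ?(ltW fl)// normrN in h1.
  have -> : s n l = 0 by apply/eqP; rewrite -normr_le0.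
  by rewrite mulN1r add0r normrN.
- have -> : f l = f^\+ l + -1 * f^\- l.
    rewrite /funrpos /funrneg; have [fl|/ltW fl] := leP 0 (f l).
      by rewrite (max_r (_ : - f l <= 0)) ?oppr_le0// mulr0 addr0.
    by rewrite (max_l (_ : 0 <= - f l)) ?oppr_ge0// mulN1r opprK add0r.
  by apply: cvgD => //; apply: cvgM => //; exact: cvg_cst.
Qed.

Lemma spec_dom_integrable f x : measurable_fun [set: measurableTypeR R] f -> spec_dom E f x ->
  (mu x).-integrable [set: measurableTypeR R] (EFin \o (fun l => f l ^+ 2)).
Proof.
move=> mf fx; apply/integrableP; split.
  by apply/measurable_EFinP; exact: measurable_funX.
apply: le_lt_trans fx; rewrite le_eqVlt; apply/orP; left; apply/eqP.
by apply: eq_integral => l _ /=; rewrite ger0_norm// sqr_ge0.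
Qed.

Lemma le_spec_dom f g x : measurable_fun [set: measurableTypeR R] f -> measurable_fun [set: measurableTypeR R] g ->
  (mu x).-integrable [set: measurableTypeR R] (EFin \o g) -> (forall l, f l ^+ 2 <= g l) ->
  spec_dom E f x.
Proof.
move=> mf mg ig fg; rewrite /spec_dom /=.
have /integrableP[_] : (mu x).-integrable [set: measurableTypeR R] (EFin \o (fun l => f l ^+ 2)).
  apply: le_integrable ig => //.
    by apply/measurable_EFinP; exact: measurable_funX.
  move=> l _ /=; rewrite lee_fin ger0_norm ?sqr_ge0// (le_trans (fg l))//.
  exact: ler_norm.
apply: le_lt_trans; rewrite le_eqVlt; apply/orP; left; apply/eqP.
by apply: eq_integral => l _ /=; rewrite ger0_norm// sqr_ge0.
Qed.

Lemma integrable_cst_mu x (a : R) : (mu x).-integrable [set: measurableTypeR R] (EFin \o cst a).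
Proof.
apply: measurable_bounded_integrable => //; first exact: scalar_measure_lty.
exists `|a|; split; rewrite ?num_real// => M M1 l _ /=; exact: ltW.
Qed.

Lemma spec_dom_integrable1 f x : measurable_fun [set: measurableTypeR R] f -> spec_dom E f x ->
  (mu x).-integrable [set: measurableTypeR R] (EFin \o (fun l => `|f l|)).
Proof.
move=> mf fx.
have h : (mu x).-integrable [set: measurableTypeR R] (EFin \o (fun l => 1 + f l ^+ 2)).
  rewrite (_ : _ \o _ = ((EFin \o cst 1%R) \+ (EFin \o (fun l => f l ^+ 2)%R))%E)//.
  apply: integrableD => //; first exact: integrable_cst_mu.
  exact: spec_dom_integrable.
apply: le_integrable h => //.
  by apply/measurable_EFinP; exact: measurableT_comp.
move=> l _ /=; rewrite lee_fin normr_id [X in _ <= X]ger0_norm ?addr_ge0 ?sqr_ge0//.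
by rewrite -(real_normK (num_real (f l))); nra.
Qed.

Lemma approximates_int f s F x : measurable_fun [set: measurableTypeR R] f -> approximates f s F ->
  spec_dom E f x ->
  ip (F n x) x @[n --> \oo] --> \int[mu x]_l f l.
Proof.
move=> mf [sF sf slim] fx.
rewrite (_ : (fun n => _) = fun n => \int[mu x]_l s n l); last first.
  by apply/funext => n; rewrite (simple_op_int x (sF n)).
apply: (cvg_int_dominated _ mf (spec_dom_integrable1 mf fx)) => //.
by move=> n; exact: simple_op_measurable (sF n).
Qed.

Lemma approximates_normsq f s F x : measurable_fun [set: measurableTypeR R] f -> approximates f s F ->
  spec_dom E f x ->
  `|F n x| ^+ 2 @[n --> \oo] --> \int[mu x]_l (f l ^+ 2).
Proof.
move=> mf [sF sf slim] fx.
rewrite (_ : (fun n => _) = fun n => \int[mu x]_l (s n l ^+ 2)); last first.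
  by apply/funext => n; rewrite (simple_op_normsq x (sF n)).
apply: (cvg_int_dominated _ (measurable_funX _ mf) (spec_dom_integrable mf fx)).
- by move=> n; apply: measurable_funX; exact: simple_op_measurable (sF n).
- move=> n l; rewrite ger0_norm ?sqr_ge0// -real_normK ?num_real//.
  by rewrite -(real_normK (num_real (f l))) lerXn2r ?nnegrE.
- by move=> l; apply: (@cvg_comp _ _ _ _ (fun r => r ^+ 2)); [exact: slim|exact: exprn_continuous].
Qed.

(** By the isometry [simple_op_normsq], being Cauchy in [H] amounts to being Cauchy in the L^2 space
    of the scalar measure of [x]. *)
Lemma approximates_cvg f s F x : measurable_fun [set: measurableTypeR R] f -> approximates f s F ->
  spec_dom E f x -> cvgn (fun n => F n x).
Proof.
move=> mf [sF sf slim] fx.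
have ms n : measurable_fun [set: measurableTypeR R] (s n) by exact: simple_op_measurable (sF n).
have sf2 n l : s n l ^+ 2 <= f l ^+ 2.
  rewrite -real_normK ?num_real// -(real_normK (num_real (f l))).
  by rewrite lerXn2r ?nnegrE.
pose e n := \int[mu x]_l ((s n l - f l) ^+ 2).
have ie n : (mu x).-integrable [set: measurableTypeR R] (EFin \o (fun l => (s n l - f l) ^+ 2)).
  have := integrableZl measurableT 4 (spec_dom_integrable mf fx).
  apply: le_integrable => //.
    by apply/measurable_EFinP; apply: measurable_funX; exact: measurable_funB.
  move=> l _ /=; rewrite lee_fin [X in X <= _]ger0_norm ?sqr_ge0//.
  rewrite [X in _ <= X]ger0_norm; last by rewrite mulr_ge0// sqr_ge0.
  by have := sf2 n l; have := sqr_ge0 (s n l + f l); nra.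
have e0 : e n @[n --> \oo] --> 0.
  have -> : 0 = \int[mu x]_l (cst 0 l : R) by rewrite /Rintegral integral0.
  have h := integrableZl measurableT 4 (spec_dom_integrable mf fx).
  have h' : (mu x).-integrable [set: measurableTypeR R] (EFin \o (fun l => 4 * f l ^+ 2)) by [].
  apply: (cvg_int_dominated _ _ h') => //.
  - by move=> n; apply: measurable_funX; exact: measurable_funB.
  - move=> n l; rewrite ger0_norm ?sqr_ge0//.
    by have := sf2 n l; have := sqr_ge0 (s n l + f l); nra.
  - move=> l; rewrite (_ : cst 0 l = (f l - f l) ^+ 2); last by rewrite subrr expr0n.
    apply: (@cvg_comp _ _ _ (fun n => s n l - f l) (fun r => r ^+ 2)).
      by apply: cvgB => //; exact: cvg_cst.
    exact: exprn_continuous.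
have bd n m : `|F n x - F m x| ^+ 2 <= 2 * (e n + e m).
  have sd := simple_opD (sF n) (simple_opZ (-1) (sF m)).
  have := simple_op_normsq x sd; rewrite scaleN1r => ->.
  have i1 := ie n; have i2 := ie m.
  have i12 : (mu x).-integrable [set: measurableTypeR R]
      (EFin \o (fun l => (s n l - f l) ^+ 2 + (s m l - f l) ^+ 2)).
    exact: (integrableD measurableT i1 i2).
  rewrite /e -RintegralD// -RintegralZl//; apply: le_Rintegral => //.
  - rewrite (_ : (fun l => _ ^+ 2) = fun l => (s n l + -1 * s m l) * (s n l + -1 * s m l)).
      exact: simple_op_integrable (simple_opM sd sd).
    by apply/funext => l.
  - exact: (integrableZl measurableT 2 i12).
  - by move=> l _; have := sqr_ge0 (s n l - f l + (s m l - f l)); nra.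
apply: cauchy_cvgn => d d0.
have d4 : 0 < d ^+ 2 / 4 by rewrite divr_gt0// exprn_gt0.
have /cvgrPdist_lt/(_ _ d4) := e0; move=> [N _ hN].
exists N => n Nn.
have := hN _ Nn; have := hN _ (leqnn N); rewrite /= !sub0r !normrN => h1 h2.
rewrite -(@ltr_pXn2r _ 2%N)// ?nnegrE ?(ltW d0)//.
have := bd N n; have := ler_norm (e n); have := ler_norm (e N).
by move: h1 h2; lra.
Qed.

Lemma simple_op_bounded f F : simple_op f F -> exists a, forall x, `|F x| <= a * `|x|.
Proof.
elim=> [|b T f' F' mT _ [a IH]]; first by exists 0 => x; rewrite mul0r normr0.
exists (`|b| + a) => x; rewrite mulrDl (le_trans (ler_normD _ _))// lerD//.
by rewrite normrZ ler_wpM2l// proj_contr.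
Qed.

Lemma simple_op_cvg f F (u : nat -> H) x : simple_op f F ->
  u n @[n --> \oo] --> x -> F (u n) @[n --> \oo] --> F x.
Proof.
move=> sF ux; have [a ha] := simple_op_bounded sF.
apply/cvgrPdist_le => e e0.
have a1 : 0 < `|a| + 1 by rewrite ltr_wpDl.
have ea : 0 < e / (`|a| + 1) by rewrite divr_gt0.
have /cvgrPdist_le/(_ _ ea) [N _ hN] := ux.
exists N => // n /hN /=; rewrite ler_pdivlMr// => h.
have -> : F x - F (u n) = F (x - u n).
  by rewrite addrC -scaleN1r -(simple_opP _ _ _ sF) scaleN1r addrC.
apply: le_trans (ha _) (le_trans _ h); rewrite mulrC ler_wpM2l//.
by rewrite (le_trans (ler_norm _))// lerDl.
Qed.

Lemma simple_op_le_norm f F a x : simple_op f F -> (forall l, `|f l| <= a) ->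
  `|F x| <= a * `|x|.
Proof.
move=> sF fa; have a0 : 0 <= a by exact: le_trans (fa 0).
rewrite -(@ler_pXn2r _ 2%N)// ?nnegrE ?mulr_ge0// (simple_op_normsq _ sF) exprMn.
have -> : a ^+ 2 * `|x| ^+ 2 = \int[mu x]_l (cst (a ^+ 2) l).
  rewrite Rintegral_cst//; congr (_ * _).
  by transitivity (fine (scalar_measure E x setT)); rewrite // /scalar_measure projT.
apply: le_Rintegral => //; first last.
- move=> l _; rewrite -real_normK ?num_real//= lerXn2r ?nnegrE//.
- exact: integrable_cst_mu.
rewrite (_ : (fun l => _) = fun l => f l * f l).
  exact: simple_op_integrable (simple_opM sF sF).
by apply/funext => l; rewrite expr2.
Qed.

(** The squared norm of the complementary projection is the integral of an indicator that tends to 0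
    pointwise and is dominated by 1. *)
Lemma proj_cvg (S : nat -> set R) x : (forall n, measurable (S n)) ->
  (forall l, \forall n \near \oo, S n l) -> P (S n) x @[n --> \oo] --> x.
Proof.
move=> mS hS.
have sC n : simple_op (\1_(~` (S n))) (P (~` (S n))).
  by apply: simple_op_indic; exact: measurableC.
have h : `|P (~` S n) x| ^+ 2 @[n --> \oo] --> 0.
  rewrite (_ : (fun n => _) = fun n => \int[mu x]_l (\1_(~` (S n)) l ^+ 2)); last first.
    by apply/funext => n; rewrite (simple_op_normsq x (sC n)).
  have h0 : \int[mu x]_l (cst 0 l : R) = 0 by rewrite /Rintegral integral0.
  rewrite -[X in _ --> X]h0.
  apply: (cvg_int_dominated (h := cst 1)) => //.
  - by move=> n; apply: measurable_funX; exact: simple_op_measurable (sC n).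
  - exact: integrable_cst_mu.
  - by move=> n l; rewrite indicE; case: (_ \in _); rewrite ?expr1n ?normr1// expr0n normr0.
  - move=> l; apply: cvg_near_cst; apply: filterS (hS l) => n Sn.
    by rewrite indicE memNset ?expr0n//= => h; exact: h.
apply/cvgrPdist_le => e e0.
have e2 : 0 < e ^+ 2 by rewrite exprn_gt0.
have /cvgrPdist_le/(_ _ e2) [N _ hN] := h.
exists N => // n /hN /=; rewrite sub0r normrN -proj_compl//.
by rewrite ger0_norm ?sqr_ge0// ler_pXn2r ?nnegrE ?(ltW e0).
Qed.

(** Converse direction to [approximates_cvg]: by Fatou, bounded norms already force [x] into the
    domain. *)
Lemma approximates_spec_dom f s F x C : measurable_fun [set: measurableTypeR R] f ->
  approximates f s F -> (forall n, `|F n x| ^+ 2 <= C) -> spec_dom E f x.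
Proof.
move=> mf [sF sf slim] hC; rewrite /spec_dom /=.
have ms n : measurable_fun [set: measurableTypeR R] (s n).
  exact: simple_op_measurable (sF n).
pose f_ n (l : measurableTypeR R) := ((s n l ^+ 2)%:E : \bar R).
have mf_ n : measurable_fun [set: measurableTypeR R] (f_ n).
  by apply/measurable_EFinP; exact: measurable_funX.
have f_0 n l : [set: measurableTypeR R] l -> (0 <= f_ n l)%E.
  by move=> _; rewrite lee_fin sqr_ge0.
apply: le_lt_trans (ltry C).
apply: (fatou_le_cst measurableT mf_ f_0) => [l _|n].
  apply: cvg_EFin; first exact: nearW.
  by apply: (@cvg_comp _ _ _ _ (fun r => r ^+ 2)); [exact: slim|exact: exprn_continuous].
have ifn : (mu x).-integrable [set: measurableTypeR R] (f_ n).
  rewrite (_ : f_ n = EFin \o (fun l => s n l * s n l)).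
    exact: simple_op_integrable (simple_opM (sF n) (sF n)).
  by apply/funext => l; rewrite /f_ expr2.
rewrite -[X in (X <= _)%E]fineK; last exact: integrable_fin_num.
by rewrite lee_fin; have := hC n; rewrite (simple_op_normsq x (sF n)).
Qed.

Lemma approximates_spec_domP f s F x y : measurable_fun [set: measurableTypeR R] f ->
  approximates f s F -> F n x @[n --> \oo] --> y -> spec_dom E f x.
Proof.
move=> mf af Fy.
have cF : cvgn (fun n => `|F n x| ^+ 2).
  by apply/cvg_ex; exists (`|y| ^+ 2); exact: cvg_normsq.
have [M [_ hM]] := cvg_seq_bounded cF.
apply: (approximates_spec_dom (C := M + 1) mf af) => n.
by apply: le_trans (ler_norm _) _; apply: hM => //; rewrite ltrDl.
Qed.

Lemma approximates_op_lin f s F a x x' y y' : approximates f s F ->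
  F n x @[n --> \oo] --> y -> F n x' @[n --> \oo] --> y' ->
  F n (a *: x + x') @[n --> \oo] --> a *: y + y'.
Proof.
move=> [sF _ _] Fx Fx'.
rewrite (_ : (fun n => _) = fun n => a *: F n x + F n x'); last first.
  by apply/funext => n; rewrite (simple_opP _ _ _ (sF n)).
by apply: cvgD => //; exact: cvgZr.
Qed.

(** For the symmetric operators [F n] the polarized expression in [spec_graph] equals
    [ip (F n x) z]; both sides then pass to the limit. *)
Lemma approximates_spec_graph f s F x y : measurable_fun [set: measurableTypeR R] f ->
  approximates f s F -> F n x @[n --> \oo] --> y -> spec_graph E f x y.
Proof.
move=> mf af Fx; split; first exact: approximates_spec_domP mf af Fx.
move=> z zf; have /cvg_ex[w Fz] := (approximates_cvg mf af zf).
have Fp : F n (x + z) @[n --> \oo] --> y + w.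
  by have := approximates_op_lin (a := 1) af Fx Fz; rewrite !scale1r.
have Fm : F n (x - z) @[n --> \oo] --> y - w.
  by have := approximates_op_lin (a := -1) af Fz Fx; rewrite !scaleN1r ![- _ + _]addrC.
have dp := approximates_spec_domP mf af Fp.
have dm := approximates_spec_domP mf af Fm.
apply: (@cvgn_unique _ _ (fun n => ip (F n x) z)).
  by apply: (ip_cvg hip) => //; exact: cvg_cst.
rewrite (_ : (fun n => _) =
  fun n => (ip (F n (x + z)) (x + z) - ip (F n (x - z)) (x - z)) / 4).
  by apply: cvgMl; apply: cvgB; [exact: (approximates_int mf af dp)|exact: (approximates_int mf af dm)].
apply/funext => n; have [sF _ _] := af.
have h1 := simple_opP 1 x z (sF n); have h2 := simple_opP (-1) z x (sF n).
rewrite !scale1r in h1; rewrite !scaleN1r ![- _ + _]addrC in h2.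
rewrite h1 h2 !ipDl !ipDr !ipNl !ipNr (simple_op_sym z x (sF n)) (ipC z).
by field.
Qed.

Lemma proj_spec_dom f S a x : measurable_fun [set: measurableTypeR R] f ->
  measurable S -> (forall l, S l -> `|f l| <= a) -> spec_dom E f (P S x).
Proof.
move=> mf mS fa; have [s [F af]] := approximates_exists mf; have [sF sf _] := af.
apply: (approximates_spec_dom (C := (`|a| * `|x|) ^+ 2) mf af) => n.
rewrite (simple_op_proj _ mS (sF n)).
rewrite ler_pXn2r ?nnegrE ?mulr_ge0//.
apply: (simple_op_le_norm _ (simple_opMind mS (sF n))) => l.
rewrite indicE; have [|] := boolP (l \in S); last by rewrite mul0r normr0.
move=> /set_mem Sl; rewrite mul1r (le_trans (sf n l))// (le_trans (fa _ Sl))//.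
exact: ler_norm.
Qed.

Definition cutoff f n := [set l | `|f l| <= n%:R].

Lemma measurable_cutoff f n : measurable_fun [set: measurableTypeR R] f ->
  measurable (cutoff f n).
Proof.
move=> mf; rewrite (_ : cutoff f n = (fun l => `|f l|) @^-1` `]-oo, n%:R]).
  rewrite -[X in measurable X]setTI.
  have mnf : measurable_fun [set: measurableTypeR R] (fun l => `|f l|).
    exact: measurableT_comp.
  by apply: mnf => //; exact: measurable_itv.
by apply/seteqP; split => l; rewrite /cutoff /= in_itv.
Qed.

Lemma cutoff_near f l : \forall n \near \oo, cutoff f n l.
Proof. exact: nbhs_infty_ger. Qed.

Lemma dense_spec_dom f : measurable_fun [set: measurableTypeR R] f ->
  dense (spec_dom E f).
Proof.
move=> mf O [x Ox] oO.
have mS n := measurable_cutoff n mf.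
have h : P (cutoff f n) x @[n --> \oo] --> x by exact: proj_cvg mS (cutoff_near f).
have /h [N _ hN] : nbhs x O by exact: open_nbhs_nbhs.
exists (P (cutoff f N) x); split; first exact: hN (leqnn N).
by apply: (@proj_spec_dom _ _ N%:R).
Qed.

Lemma spec_graph_uniq f x y y' : measurable_fun [set: measurableTypeR R] f ->
  spec_graph E f x y -> spec_graph E f x y' -> y = y'.
Proof.
move=> mf [_ h1] [_ h2]; apply: (ip_dense_inj hip (dense_spec_dom mf)) => z zf.
by rewrite h1// h2.
Qed.

Lemma spec_graph_cvg f s F x y : measurable_fun [set: measurableTypeR R] f ->
  approximates f s F -> spec_graph E f x y -> F n x @[n --> \oo] --> y.
Proof.
move=> mf af fxy; have [xf _] := fxy.
have /cvg_ex[w Fx] := (approximates_cvg mf af xf).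
by rewrite (spec_graph_uniq mf fxy (approximates_spec_graph mf af Fx)).
Qed.

Lemma spec_graph_exists f x : measurable_fun [set: measurableTypeR R] f ->
  spec_dom E f x -> exists y, spec_graph E f x y.
Proof.
move=> mf xf; have [s [F af]] := approximates_exists mf.
have /cvg_ex[w Fx] := (approximates_cvg mf af xf).
by exists w; exact: approximates_spec_graph mf af Fx.
Qed.

Lemma spec_graphP f a x x' y y' : measurable_fun [set: measurableTypeR R] f ->
  spec_graph E f x y -> spec_graph E f x' y' ->
  spec_graph E f (a *: x + x') (a *: y + y').
Proof.
move=> mf h h'; have [s [F af]] := approximates_exists mf.
apply: (approximates_spec_graph mf af); apply: (approximates_op_lin af).
  exact: spec_graph_cvg mf af h.
exact: spec_graph_cvg mf af h'.
Qed.

Lemma proj_continuous S (u : nat -> H) x : measurable S ->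
  u n @[n --> \oo] --> x -> P S (u n) @[n --> \oo] --> P S x.
Proof. by move=> mS; exact: simple_op_cvg (simple_op_indic mS). Qed.

Lemma spec_graph_proj f S x y : measurable_fun [set: measurableTypeR R] f ->
  measurable S -> spec_graph E f x y -> spec_graph E f (P S x) (P S y).
Proof.
move=> mf mS h; have [s [F af]] := approximates_exists mf; have [sF _ _] := af.
apply: (approximates_spec_graph mf af).
rewrite (_ : (fun n => _) = fun n => P S (F n x)); last first.
  by apply/funext => n; rewrite (simple_op_proj _ mS (sF n)).
by apply: proj_continuous => //; exact: spec_graph_cvg mf af h.
Qed.

Lemma spec_graph_proj_bounded f S a x : measurable_fun [set: measurableTypeR R] f ->
  measurable S -> 0 <= a -> (forall l, S l -> `|f l| <= a) ->
  exists2 y, spec_graph E f (P S x) y & `|y| <= a * `|x|.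
Proof.
move=> mf mS a0 fa; have [s [F af]] := approximates_exists mf; have [sF sf _] := af.
have [y hy] := spec_graph_exists mf (proj_spec_dom x mf mS fa).
exists y => //; have Fy := spec_graph_cvg mf af hy.
apply: (cvgn_norm_le Fy) => n; rewrite (simple_op_proj _ mS (sF n)).
apply: (simple_op_le_norm _ (simple_opMind mS (sF n))) => l.
rewrite indicE; have [|] := boolP (l \in S); last by rewrite mul0r normr0.
by move=> /set_mem Sl; rewrite mul1r (le_trans (sf n l))// (le_trans (fa _ Sl)).
Qed.

Lemma spec_graph_normsq f x y : measurable_fun [set: measurableTypeR R] f ->
  spec_graph E f x y -> `|y| ^+ 2 = \int[mu x]_l (f l ^+ 2).
Proof.
move=> mf h; have [s [F af]] := approximates_exists mf.
have [xf _] := h; apply: cvgn_unique (approximates_normsq mf af xf).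
by apply: cvg_normsq; exact: spec_graph_cvg mf af h.
Qed.

Lemma spec_graph_sym f x y x' y' : measurable_fun [set: measurableTypeR R] f ->
  spec_graph E f x y -> spec_graph E f x' y' -> ip y x' = ip x y'.
Proof.
move=> mf h h'; have [s [F af]] := approximates_exists mf; have [sF _ _] := af.
apply: (@cvgn_unique _ _ (fun n => ip (F n x) x')).
  by apply: (ip_cvg hip); [exact: spec_graph_cvg mf af h|exact: cvg_cst].
rewrite (_ : (fun n => _) = fun n => ip x (F n x')); last first.
  by apply/funext => n; rewrite (simple_op_sym _ _ (sF n)).
by apply: (ip_cvg hip); [exact: cvg_cst|exact: spec_graph_cvg mf af h'].
Qed.

(** The step operators are bounded, so they commute with the limit of [u]; this places [x] in the
    domain. Its image is then identified with [y] by symmetry, tested against the dense domain. *)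
Lemma spec_graph_closed f (u v : nat -> H) x y :
  measurable_fun [set: measurableTypeR R] f ->
  (forall n, spec_graph E f (u n) (v n)) ->
  u n @[n --> \oo] --> x -> v n @[n --> \oo] --> y -> spec_graph E f x y.
Proof.
move=> mf h ux vy; have [s [F af]] := approximates_exists mf; have [sF sf _] := af.
have cv : cvgn (fun n => `|v n|).
  by apply/cvg_ex; exists `|y|; exact: cvg_norm vy.
have [M [_ hM]] := cvg_seq_bounded cv.
(* For fixed [m], [|F m (u n)|] is at most [|v n|]; letting [n] grow gives a bound independent of
   [m]. *)
have bd m : `|F m x| <= M + 1.
  apply: (cvgn_norm_le (simple_op_cvg (sF m) ux)) => n.
  apply: (@le_trans _ _ `|v n|); last first.
    by apply: le_trans (ler_norm _) _; apply: hM => //; rewrite ltrDl.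
  rewrite -(@ler_pXn2r _ 2%N)// ?nnegrE// (spec_graph_normsq mf (h n)).
  rewrite (simple_op_normsq _ (sF m)); have [uf _] := h n.
  apply: le_Rintegral => //.
  - rewrite (_ : (fun l => _) = fun l => s m l * s m l).
      exact: simple_op_integrable (simple_opM (sF m) (sF m)).
    by apply/funext => l; rewrite expr2.
  - exact: spec_dom_integrable.
  - move=> l _; rewrite -real_normK ?num_real// -(real_normK (num_real (f l))).
    by rewrite lerXn2r ?nnegrE.
have xf : spec_dom E f x.
  apply: (approximates_spec_dom (C := (M + 1) ^+ 2) mf af) => n.
  by rewrite lerXn2r ?nnegrE// (le_trans _ (bd n)).
have [y' hy'] := spec_graph_exists mf xf.
suff -> : y = y' by [].
apply: (ip_dense_inj hip (dense_spec_dom mf)) => z zf.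
have [w hw] := spec_graph_exists mf zf.
rewrite (spec_graph_sym mf hy' hw).
apply: (@cvgn_unique _ _ (fun n => ip (v n) z)).
  by apply: (ip_cvg hip) => //; exact: cvg_cst.
rewrite (_ : (fun n => _) = fun n => ip (u n) w).
  by apply: (ip_cvg hip) => //; exact: cvg_cst.
by apply/funext => n; exact: spec_graph_sym mf (h n) hw.
Qed.

(** Source of the identity <A^(1/2) x, A^(1/2) z> = <A x, z>. If [s] approximates [g], its squares
    approximate the square of [g], so both sides are limits of the same numbers. *)
Lemma spec_graph_sqr g x y b z c : measurable_fun [set: measurableTypeR R] g ->
  spec_graph E (fun l => g l ^+ 2) x y -> spec_graph E g x b ->
  spec_graph E g z c -> ip b c = ip y z.
Proof.
move=> mg h hx hz; have [s [F ag]] := approximates_exists mg; have [sF sg slim] := ag.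
have mg2 : measurable_fun [set: measurableTypeR R] (fun l => g l ^+ 2).
  exact: measurable_funX.
have ag2 : approximates (fun l => g l ^+ 2) (fun n l => s n l * s n l)
    (fun n x => F n (F n x)).
  split=> [n|n l|l]; first exact: simple_opM.
    by rewrite -expr2 !normrX lerXn2r ?nnegrE.
  by rewrite expr2; apply: cvgM; exact: slim.
apply: (@cvgn_unique _ _ (fun n => ip (F n x) (F n z))).
  by apply: (ip_cvg hip); [exact: spec_graph_cvg mg ag hx|exact: spec_graph_cvg mg ag hz].
rewrite (_ : (fun n => _) = fun n => ip (F n (F n x)) z); last first.
  by apply/funext => n; rewrite [RHS](simple_op_sym _ _ (sF n)).
by apply: (ip_cvg hip); [exact: spec_graph_cvg mg2 ag2 h|exact: cvg_cst].
Qed.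

(** Gives geometric growth from below of the iterates of [A] on the spectral subspace above [b], for
    use in [resolution_proj_gap]. *)
Lemma spec_graph_lower f S b x y : measurable_fun [set: measurableTypeR R] f ->
  measurable S -> 0 <= b -> (forall l, S l -> b <= `|f l|) -> P S x = x ->
  spec_graph E f x y -> b * `|x| <= `|y|.
Proof.
move=> mf mS b0 bf Sx h; rewrite -(@ler_pXn2r _ 2%N)// ?nnegrE ?mulr_ge0//.
rewrite (spec_graph_normsq mf h) exprMn -{1}Sx.
have sS := simple_opZ b (simple_op_indic mS).
rewrite -exprMn -[b]ger0_norm// -normrZ (simple_op_normsq _ sS).
have [xf _] := h; apply: le_Rintegral => //.
- rewrite (_ : (fun l => _) = fun l => (b * \1_S l) * (b * \1_S l)).
    exact: simple_op_integrable (simple_opM sS sS).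
  by apply/funext => l; rewrite expr2.
- exact: spec_dom_integrable.
- move=> l _; rewrite -(real_normK (num_real (f l))) indicE.
  have [/set_mem/bf bfl|_] := boolP (l \in S).
    by rewrite mulr1 lerXn2r ?nnegrE.
  by rewrite mulr0 expr0n sqr_ge0.
Qed.

(** Lets the square of [powR l 2^-1] be replaced by [l], the two functions agreeing off the negative
    half-line. *)
Lemma spec_graph_ae f g S x y : measurable_fun [set: measurableTypeR R] f ->
  measurable_fun [set: measurableTypeR R] g -> measurable S ->
  (forall x, P S x = 0) -> (forall l, ~ S l -> f l = g l) ->
  spec_graph E f x y -> spec_graph E g x y.
Proof.
move=> mf mg mS S0 fg.
have mu0 w : (mu w).-negligible S.
  exists S; split => //.
  by transitivity (scalar_measure E w S); rewrite // /scalar_measure S0 normr0 expr0n.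
have ieq (p q : R -> R) w : measurable_fun [set: measurableTypeR R] p ->
    measurable_fun [set: measurableTypeR R] q ->
    (forall l, ~ S l -> p l = q l) ->
    (\int[mu w]_l (p l)%:E = \int[mu w]_l (q l)%:E)%E.
  move=> mp mq pq; apply: ae_eq_integral => //; [exact/measurable_EFinP|exact/measurable_EFinP|].
  apply: negligibleS (mu0 w) => l /=; apply: contra_notP => Sl _.
  by rewrite pq.
have dfg w : spec_dom E f w <-> spec_dom E g w.
  rewrite /spec_dom /= (ieq (fun l => f l ^+ 2) (fun l => g l ^+ 2))//.
  - exact: measurable_funX.
  - exact: measurable_funX.
  - by move=> l /fg ->.
move=> [xf h]; split; first exact/dfg.
by move=> z /dfg/h ->; rewrite /Rintegral !(ieq f g).
Qed.

Section Resolution.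
Variable A : @operator R H.
Hypothesis hA0 : nonnegative ip A.
Hypothesis hE : spectral_resolution A E.

Lemma measurable_id_R : measurable_fun [set: measurableTypeR R] (@id R).
Proof. exact: measurable_id. Qed.
Let mid := measurable_id_R.

(** The strip is bounded, so the projected vector is in the domain of [A], and it stays away from 0,
    so the quadratic form there is at most [- n.+1%:R^-1] times the squared norm. Nonnegativity
    leaves only the zero vector. *)
Lemma proj_neg_strip n x : P `[- n%:R, - n.+1%:R^-1] x = 0.
Proof.
set S := `[_, _]%classic; have mS : measurable S by exact: measurable_itv.
have bS l : S l -> `|l| <= n%:R.
  rewrite /S /= in_itv /= => /andP[h1 h2]; rewrite ler_norml h1/=.
  by rewrite (le_trans h2)// (@le_trans _ _ 0) ?oppr_le0.
have [y hy _] := spec_graph_proj_bounded x mid mS (ler0n R n) bS.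
have /hE [dPx AE] := hy.
have := hA0 dPx; rewrite AE => yPx.
have [s [F af]] := approximates_exists mid; have [sF sf slim] := af.
have h1 : ip (F m (P S x)) (P S x) @[m --> \oo] --> \int[mu x]_l (l * \1_S l).
  rewrite (_ : (fun m => _) = fun m => \int[mu x]_l (\1_S l * s m l)); last first.
    apply/funext => m; rewrite (simple_op_int x (simple_opMind mS (sF m))).
    by rewrite (simple_op_proj _ mS (sF m)) -(proj_sym E mS) proj_idem.
  apply: (cvg_int_dominated (h := cst n%:R)) => //.
  - by move=> m; exact: simple_op_measurable (simple_opMind mS (sF m)).
  - by apply: measurable_funM => //; exact: measurable_indic.
  - exact: integrable_cst_mu.
  - move=> m l /=; rewrite indicE; have [/set_mem/bS Sl|_] := boolP (l \in S).
      by rewrite mul1r (le_trans (sf m l)).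
    by rewrite mul0r normr0.
  - by move=> l; rewrite mulrC; apply: cvgM; [exact: cvg_cst|exact: slim].
have h2 : ip (F m (P S x)) (P S x) @[m --> \oo] --> ip y (P S x).
  by apply: (ip_cvg hip); [exact: spec_graph_cvg mid af hy|exact: cvg_cst].
rewrite (cvgn_unique h2 h1) in yPx.
have ii : (mu x).-integrable [set: measurableTypeR R]
    (EFin \o (fun l => - n.+1%:R^-1 * (\1_S l : R))).
  exact: simple_op_integrable (simple_opZ _ (simple_op_indic mS)).
have : \int[mu x]_l (l * \1_S l) <= - n.+1%:R^-1 * `|P S x| ^+ 2.
  rewrite -proj_ip// -(simple_op_int x (simple_op_indic mS)).
  rewrite -RintegralZl//; last exact: integrable_indic_mu.
  apply: le_Rintegral => //.
  - apply: (@le_integrable _ _ _ _ _ measurableT _ (EFin \o cst n%:R)).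
    + by apply/measurable_EFinP; apply: measurable_funM => //; exact: measurable_indic.
    + move=> l _ /=; rewrite lee_fin indicE [X in _ <= X]ger0_norm//.
      have [/set_mem/bS Sl|_] := boolP (l \in S); first by rewrite mulr1.
      by rewrite mulr0 normr0.
    + exact: integrable_cst_mu.
  - move=> l _; rewrite indicE; have [/set_mem Sl|_] := boolP (l \in S).
      by rewrite !mulr1; move: Sl; rewrite /S /= in_itv /= => /andP[].
    by rewrite !mulr0.
move=> /(le_trans yPx); rewrite mulNr oppr_ge0 pmulr_rle0// => h.
apply/eqP; rewrite -normr_eq0 -sqrf_eq0 eq_le h sqr_ge0//.
Qed.

Lemma proj_neg x : P `]-oo, 0[ x = 0.
Proof.
set S := `]-oo, 0[%classic; have mS : measurable S by exact: measurable_itv.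
pose T n := `[- n%:R, - n.+1%:R^-1]%classic : set R.
(* Adding the nonnegative half-line makes every point lie in [U n] eventually, as [proj_cvg]
   demands; intersecting with the negative half-line leaves the strip. *)
pose U n := T n `|` `[0, +oo[%classic.
have mT n : measurable (T n) by exact: measurable_itv.
have mU n : measurable (U n).
  by apply: measurableU => //; exact: measurable_itv.
have hU l : \forall n \near \oo, U n l.
  have [l0|l0] := leP 0 l.
    by apply: nearW => n; right; rewrite /= in_itv /= l0.
  near=> n; left; rewrite /T /= in_itv /=; apply/andP; split.
    by rewrite lerNl; near: n; exact: nbhs_infty_ger.
  rewrite lerNr -[X in _ <= X]invrK lef_pV2 ?posrE ?invr_gt0 ?oppr_gt0//.
  rewrite (@le_trans _ _ n%:R)// ?ler_nat//.
  by near: n; exact: nbhs_infty_ger.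
have h : P (U n) (P S x) @[n --> \oo] --> P S x by exact: proj_cvg mU hU.
apply: (cvgn_unique h); rewrite (_ : (fun n => _) = fun=> 0); first exact: cvg_cst.
apply/funext => n; rewrite -projI// (_ : U n `&` S = S `&` T n).
  by rewrite projI// proj_neg_strip proj_0.
rewrite /U /S /T; apply/seteqP; split => l /=; rewrite !in_itv /= ?andbT.
  by move=> [[//|l0] l1]; move: l1; rewrite ltNge l0.
move=> [l0 l1]; split => //; by left.
Unshelve. all: by end_near. Qed.

Lemma resolution_dom_proj S x : measurable S -> dom A x ->
  dom A (P S x) /\ A (P S x) = P S (A x).
Proof.
move=> mS Ax; have /hE h : graph A x (A x) by split.
by have /hE [] := spec_graph_proj mid mS h.
Qed.

Lemma resolution_dom_bounded S a x : measurable S -> 0 <= a ->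
  (forall l, S l -> `|l| <= a) -> dom A (P S x) /\ `|A (P S x)| <= a * `|x|.
Proof.
move=> mS a0 bS; have [y hy ya] := spec_graph_proj_bounded x mid mS a0 bS.
by have /hE [? ->] := hy.
Qed.

End Resolution.

End SpectralMeasureTheory.

(** * Uniqueness of the scalar measures of a nonnegative operator *)

Section ResolutionUnique.
Context {R : realType} {H : completeNormedModType R} {ip : {dot H for idfun}}.
Hypothesis hip : induces_norm ip.
Variable A : @operator R H.
Hypothesis hA0 : nonnegative ip A.
Implicit Types (E : spectral_measure ip) (x : H) (a b : R).
Local Notation proj := Defs.proj.

Lemma expr_ratio_le0 a b (p q : R) : 0 <= a -> a < b -> 0 <= p ->
  (forall k, b ^+ k * p <= a ^+ k * q) -> p <= 0.
Proof.
move=> a0 ab p0 h; have b0 : 0 < b by exact: le_lt_trans ab.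
have r1 : `|a / b| < 1.
  by rewrite ger0_norm ?divr_ge0 ?(ltW b0)// ltr_pdivrMr// mul1r.
have c : q * (a / b) ^+ k @[k --> \oo] --> q * 0.
  by apply: cvgM; [exact: cvg_cst|exact: cvg_expr].
rewrite mulr0 in c; apply: (cvgn_ge c) => k.
by rewrite expr_div_n mulrA ler_pdivlMr ?exprn_gt0// mulrC [q * _]mulrC.
Qed.

(** On the range of the first projection |A^k v| is at most a^k |v|, while the component of A^k v
    above [b] for [E2] is at least b^k times that of [v]. As a < b, this component vanishes. *)
Lemma resolution_proj_gap E1 E2 a b x : spectral_resolution A E1 ->
  spectral_resolution A E2 -> 0 <= a -> a < b ->
  proj E2 `]b, +oo[ (proj E1 `]-oo, a] x) = 0.
Proof.
move=> h1 h2 a0 ab; have b0 : 0 < b by exact: le_lt_trans ab.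
have mS : measurable `[0, a]%classic by exact: measurable_itv.
have mT : measurable `]b, +oo[%classic by exact: measurable_itv.
have mN : measurable `]-oo, (0:R)[%classic by exact: measurable_itv.
have mI : measurable `]-oo, a]%classic by exact: measurable_itv.
set v := proj E1 _ x.
(* The negative half-line carries no mass, so [v] is already in the range for the bounded interval,
   where [A] can be iterated. *)
have Sv : proj E1 `[0, a] v = v.
  rewrite -[RHS]subr0 -(proj_neg hip hA0 h1 v) -proj_compl// /v -!projI//; last exact: measurableC.
  congr (proj E1 _ x); apply/seteqP; split => l /=; rewrite !in_itv /=.
    by move=> [/andP[l0 la] _]; split => //; apply/negP; rewrite -leNgt.
  by move=> [/negP]; rewrite -leNgt => -> ->.
have bS l : `[0, a]%classic l -> `|l| <= a.
  by rewrite /= in_itv /= => /andP[l0 la]; rewrite ger0_norm.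
pose w k := iter k A v.
have hw k : proj E1 `[0, a] (w k) = w k /\ `|w k| <= a ^+ k * `|v|.
  elim: k => [|k [IH1 IH2]]; first by rewrite expr0 mul1r.
  have [d1 n1] := resolution_dom_bounded hip h1 (w k) mS a0 bS.
  rewrite IH1 in d1 n1; have [_] := resolution_dom_proj hip h1 mS d1.
  rewrite IH1 => <-; split => //.
  by rewrite (le_trans n1)// exprS -mulrA ler_wpM2l.
have domw k : dom A (w k).
  have [e _] := hw k; have [d1 _] := resolution_dom_bounded hip h1 (w k) mS a0 bS.
  by rewrite e in d1.
have low k : b ^+ k * `|proj E2 `]b, +oo[ v| <= `|proj E2 `]b, +oo[ (w k)|.
  elim: k => [|k IH]; first by rewrite expr0 mul1r.
  have [d2 e2] := resolution_dom_proj hip h2 mT (domw k).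
  rewrite exprS -mulrA (le_trans (ler_wpM2l (ltW b0) IH))// -[w k.+1]/(A (w k)) -e2.
  apply: (spec_graph_lower hip (@measurable_id_R R) mT (ltW b0) (S := `]b, +oo[%classic)).
  - move=> l; rewrite /= in_itv /= andbT => /ltW bl.
    by rewrite (le_trans bl)// ler_norm.
  - exact: proj_idem.
  - by apply/h2; split.
apply/eqP; rewrite -normr_eq0 eq_le normr_ge0 andbT.
apply: (@expr_ratio_le0 a b _ `|v|) => // k.
apply: le_trans (low k) _; apply: le_trans (proj_contr hip _ _ mT) _.
by have [_] := hw k.
Qed.

Lemma resolution_proj_disj E1 E2 a x : spectral_resolution A E1 ->
  spectral_resolution A E2 -> 0 <= a ->
  proj E2 `]a, +oo[ (proj E1 `]-oo, a] x) = 0.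
Proof.
move=> h1 h2 a0.
have mT : measurable `]a, +oo[%classic by exact: measurable_itv.
set v := proj E1 _ x.
pose T n := `]a + n.+1%:R^-1, +oo[%classic : set R.
pose U n := T n `|` `]-oo, a]%classic.
have mTn n : measurable (T n) by exact: measurable_itv.
have mU n : measurable (U n).
  by apply: measurableU => //; exact: measurable_itv.
have hU l : \forall n \near \oo, U n l.
  have [l0|l0] := leP l a.
    by apply: nearW => n; right; rewrite /= in_itv /= l0.
  near=> n; left; rewrite /T /= in_itv /= andbT -ltrBrDl.
  rewrite -[X in _ < X]invrK ltf_pV2 ?posrE ?invr_gt0 ?subr_gt0//.
  rewrite (@le_lt_trans _ _ n%:R)// ?ltr_nat//.
  by near: n; exact: nbhs_infty_ger.
have h : proj E2 (U n) (proj E2 `]a, +oo[ v) @[n --> \oo] --> proj E2 `]a, +oo[ v.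
  exact: (proj_cvg hip E2 mU hU).
apply: (cvgn_unique h); rewrite (_ : (fun n => _) = fun=> 0); first exact: cvg_cst.
apply/funext => n; rewrite -projI// (_ : U n `&` _ = T n).
  by rewrite resolution_proj_gap// ltrDl invr_gt0.
rewrite /U /T; apply/seteqP; split => l /=; rewrite !in_itv /= ?andbT.
  by move=> [[//|l0] l1]; move: l1; rewrite ltNge l0.
move=> l0; split; first by left.
by apply: le_lt_trans l0; rewrite lerDl.
Unshelve. all: by end_near. Qed.

Lemma resolution_proj_ray E1 E2 a x : spectral_resolution A E1 ->
  spectral_resolution A E2 -> proj E1 `]a, +oo[ x = proj E2 `]a, +oo[ x.
Proof.
move=> h1 h2.
have mI : measurable `]-oo, a]%classic by exact: measurable_itv.
rewrite -setCitvl !(proj_compl hip)//; congr (x - _).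
have [a0|a0] := leP 0 a; last first.
  have neg E : spectral_resolution A E -> proj E `]-oo, a] x = 0.
    move=> h; have mN : measurable `]-oo, (0:R)[%classic by exact: measurable_itv.
    rewrite (_ : `]-oo, a]%classic = `]-oo, 0[%classic `&` `]-oo, a]%classic).
      by rewrite projI// (proj_neg hip hA0 h).
    apply/seteqP; split => l /=; rewrite !in_itv /=.
      by move=> la; split => //; exact: le_lt_trans a0.
    by move=> [].
  by rewrite !neg.
(* Each of the two projections absorbs the other; since both are symmetric, they coincide. *)
have key E E' : spectral_resolution A E -> spectral_resolution A E' ->
    forall z, proj E' `]-oo, a] (proj E `]-oo, a] z) = proj E `]-oo, a] z.
  move=> h h' z; apply/eqP; rewrite eq_sym -subr_eq0 -proj_compl// setCitvl.
  by rewrite resolution_proj_disj.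
rewrite -(key E1 E2 h1 h2); apply: (ip_injl hip) => z.
rewrite (proj_sym E2 mI) (proj_sym E1 mI) (key E2 E1 h2 h1).
by rewrite (proj_sym E2 mI).
Qed.

Lemma resolution_scalar_measure E1 E2 x (S : set (measurableTypeR R)) :
  spectral_resolution A E1 -> spectral_resolution A E2 -> measurable S ->
  scalar_measure E1 x S = scalar_measure E2 x S.
Proof.
move=> h1 h2 mS.
pose m1 : {measure set (measurableTypeR R) -> \bar R} := scalar_measure E1 x.
pose m2 : {measure set (measurableTypeR R) -> \bar R} := scalar_measure E2 x.
rewrite -[LHS]/(m1 S) -[RHS]/(m2 S).
apply: (@measure_unique _ R (measurableTypeR R) (@RGenOInfty.G R) (fun n => `](- n%:R), +oo[%classic)) => //.
- exact: RGenOInfty.measurableE.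
- move=> _ _ [y ->] [z ->]; exists (Num.max y z).
  apply/seteqP; split => l /=; rewrite !in_itv /= !andbT gt_max.
    by move=> [-> ->].
  by move=> /andP.
- by move=> n; exists (- n%:R).
- apply/seteqP; split => // l _; exists (Num.truncn `|l|).+1 => //=.
  rewrite in_itv /= andbT ltrNl (le_lt_trans (ler_norm _))// normrN.
  by rewrite truncnS_gt.
- by move=> _ [a ->]; rewrite /m1 /m2 /= /scalar_measure (resolution_proj_ray _ _ h1 h2).
- by move=> n; rewrite /m1 /= /scalar_measure ltry.
Qed.

(** Makes [op_pow] single-valued: the spectral measure that [pow_graph] picks for each pair may be
    exchanged for a fixed one. *)
Lemma resolution_spec_graph E1 E2 f x y : spectral_resolution A E1 ->
  spectral_resolution A E2 -> spec_graph E1 f x y -> spec_graph E2 f x y.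
Proof.
move=> h1 h2.
have ieq (g : R -> \bar R) w :
    (\int[scalar_measure E1 w]_l g l = \int[scalar_measure E2 w]_l g l)%E.
  apply: eq_measure_integral => S mS _.
  exact: resolution_scalar_measure.
have dom12 w : spec_dom E1 f w <-> spec_dom E2 f w by rewrite /spec_dom /= ieq.
case=> xf h; split; first exact: (iffLR (dom12 x) xf).
by move=> z zf; rewrite (h z (iffRL (dom12 z) zf)) /Rintegral !ieq.
Qed.

End ResolutionUnique.

(** * Spectral cutoffs of the operator and of its square root *)

Section Cutoffs.
Context {R : realType} {H : completeNormedModType R}.

Definition op_linear (A : @operator R H) := forall (a : R) x y,
  dom A x -> dom A y -> dom A (a *: x + y) /\ A (a *: x + y) = a *: A x + A y.

Definition op_closed (A : @operator R H) := forall (u : nat -> H) x y,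
  (forall n, dom A (u n)) -> u n @[n --> \oo] --> x ->
  A (u n) @[n --> \oo] --> y -> dom A x /\ A x = y.

(* What the construction of solutions needs from the spectral theorem: [B]
   plays the role of [A^(1/2)] and [P n] of the spectral projection of [A] on
   [[-n, n]]. *)
Record cutoffs (ip : {dot H for idfun}) (A B : operator) (P : nat -> H -> H) :
    Prop := Cutoffs {
  cut_lin : forall n (a : R) x y, P n (a *: x + y) = a *: P n x + P n y ;
  cut_sym : forall n x y, ip (P n x) y = ip x (P n y) ;
  cut_comm : forall n m x, P n (P m x) = P m (P n x) ;
  cut_idem : forall n x, P n (P n x) = P n x ;
  cut_contr : forall n x, `|P n x| <= `|x| ;
  cut_cvg : forall x, P n x @[n --> \oo] --> x ;
  cut_domA : forall n x, dom A (P n x) ;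
  cut_bdA : forall n x, `|A (P n x)| <= n%:R * `|x| ;
  cut_A : forall n x, dom A x -> A (P n x) = P n (A x) ;
  cut_B : forall n x, dom B x -> B (P n x) = P n (B x) ;
  cut_linA : op_linear A ;
  cut_linB : op_linear B ;
  cut_closedA : op_closed A ;
  cut_closedB : op_closed B ;
  cut_domAB : forall x, dom A x -> dom B x ;
  cut_ipAB : forall x z, dom A x -> dom B z -> ip (B x) (B z) = ip (A x) z }.

Lemma cutoffs_exist (ip : {dot H for idfun}) (A : operator) (E : spectral_measure ip) :
  induces_norm ip -> nonnegative ip A -> spectral_resolution A E ->
  exists P, cutoffs ip A (op_pow ip A 2^-1) P.
Proof.
move=> hip hA0 hE; set B := op_pow _ _ _.
pose r (l : R) := l `^ 2^-1.
have mr : measurable_fun [set: measurableTypeR R] r by exact: measurable_powR.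
have mid := @measurable_id_R R.
have powE x y : pow_graph ip A 2^-1 x y <-> spec_graph E r x y.
  split=> [[E' [hE' h]]|h]; last by exists E.
  exact: (resolution_spec_graph hip hA0 hE' hE).
have hB x y : graph B x y <-> spec_graph E r x y.
  split=> [[[w pw] Bx]|h].
    have Bw : B x = w.
      rewrite /B /=; apply: xget_unique; first exact: pw.
      by move=> w' /powE h; exact: (spec_graph_uniq hip mr h (iffLR (powE _ _) pw)).
    by rewrite -Bx Bw; exact/powE.
  split; first by exists y; exact/powE.
  rewrite /B /=; apply: xget_unique; first exact/powE.
  by move=> w' /powE h'; exact: (spec_graph_uniq hip mr h' h).
pose S n := `[- n%:R, n%:R]%classic : set R.
have mS n : measurable (S n) by exact: measurable_itv.
have bS n l : S n l -> `|l| <= n%:R by rewrite /S /= in_itv /= ler_norml.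
have hS l : \forall n \near \oo, S n l.
  near=> n; rewrite /S /= in_itv /= -ler_norml.
  by near: n; exact: nbhs_infty_ger.
have gA x : dom A x -> spec_graph E id x (A x) by move=> dx; apply/hE.
have gB x : dom B x -> spec_graph E r x (B x) by move=> dx; apply/hB.
have lin (O : operator) (f : R -> R) : measurable_fun [set: measurableTypeR R] f ->
    (forall x y, graph O x y <-> spec_graph E f x y) -> op_linear O.
  move=> mf hO a x y dx dy.
  by have /hO [] := spec_graphP hip a mf (iffLR (hO _ _) (conj dx erefl))
    (iffLR (hO _ _) (conj dy erefl)).
have clo (O : operator) (f : R -> R) : measurable_fun [set: measurableTypeR R] f ->
    (forall x y, graph O x y <-> spec_graph E f x y) -> op_closed O.
  move=> mf hO u x y du ux Ou; apply/hO.
  by apply: (spec_graph_closed hip mf _ ux Ou) => n; apply/hO; split.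
have domAB x : dom A x -> dom B x.
  move=> dx; have [xid _] := gA _ dx.
  (* The square of [r] is at most 1 + l^2, integrable because [x] is in the domain of [A] and scalar
     measures are finite. *)
  suff xr : spec_dom E r x.
    by have [y /hB []] := spec_graph_exists hip mr xr.
  have i1 : (scalar_measure E x).-integrable [set: measurableTypeR R]
      (EFin \o (fun l : R => 1 + l ^+ 2)).
    rewrite (_ : _ \o _ = ((EFin \o cst 1%R) \+ (EFin \o (fun l => l ^+ 2)%R))%E)//.
    apply: integrableD => //; first exact: integrable_cst_mu.
    exact: (spec_dom_integrable mid).
  apply: (le_spec_dom mr _ i1).
    by apply: measurable_funD => //; exact: measurable_funX.
  move=> l; rewrite /r; have [l0|l0] := leP 0 l.
    by rewrite powR12_sqrt// sqr_sqrtr//; have := sqr_ge0 (l - 1); nra.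
  (* At a negative argument [ln] returns 0, so [powR] has the value 1. *)
  rewrite /powR lt_eqF// ln0 ?(ltW l0)// mulr0 expR0 expr1n lerDl sqr_ge0//.
exists (fun n => Defs.proj E (S n)); split => //.
- by move=> n; exact: proj_linear.
- by move=> n x y; exact: proj_sym.
- by move=> n m x; exact: projCA.
- by move=> n x; exact: proj_idem.
- by move=> n x; exact: proj_contr.
- by move=> x; exact: (proj_cvg hip E mS hS).
- by move=> n x; have [] := resolution_dom_bounded hip hE x (mS n) (ler0n R n) (@bS n).
- by move=> n x; have [] := resolution_dom_bounded hip hE x (mS n) (ler0n R n) (@bS n).
- by move=> n x dx; have [] := resolution_dom_proj hip hE (mS n) dx.
- by move=> n x dx; have /hB [] := spec_graph_proj hip mr (mS n) (gB _ dx).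
- exact: (lin A id).
- exact: (lin B r).
- exact: (clo A id).
- exact: (clo B r).
- move=> x z dx dz; apply: (spec_graph_sqr hip mr _ (gB _ (domAB _ dx)) (gB _ dz)).
  have mN : measurable `]-oo, (0:R)[%classic by exact: measurable_itv.
  apply: (spec_graph_ae mid _ mN (proj_neg hip hA0 hE) _ (gA _ dx)).
    exact: measurable_funX.
  move=> l /=; rewrite in_itv /= => /negP; rewrite -leNgt => l0.
  by rewrite /r powR12_sqrt// sqr_sqrtr.
Unshelve. all: by end_near. Qed.

End Cutoffs.

(** * Calculus for vector-valued functions *)

Section RealCalculus.
Context {R : realType}.

Lemma is_deriveP {V : normedModType R} (f : R -> V) (t : R) (d : V) :
  is_derive t 1 f d <->
  (fun h : R => h^-1 *: (f (h + t) - f t)) @ 0^' --> d.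
Proof.
have e : (fun h : R => h^-1 *: ((f \o shift t) (h *: (1 : R)) - f t)) =
         (fun h : R => h^-1 *: (f (h + t) - f t)).
  by apply/funext => h /=; rewrite /GRing.scale/= mulr1.
split=> [[ex dv]|h].
  by rewrite -e -dv; exact: ex.
rewrite -e in h; split; first by apply/cvg_ex; exists d.
exact: (cvg_lim (@norm_hausdorff _ _) h).
Qed.

(** Free of division, hence stable under bounded linear maps and uniform limits. *)
Lemma is_derive_epsP {V : normedModType R} (f : R -> V) (t : R) (d : V) :
  is_derive t 1 f d <->
  forall e, 0 < e -> exists2 dl, 0 < dl & forall s, `|s - t| < dl ->
    `|f s - f t - (s - t) *: d| <= e * `|s - t|.
Proof.
rewrite is_deriveP; split=> h.
  move=> e e0; have /cvgrPdist_le/(_ _ e0) := h.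
  move=> /nbhs_ballP[dl /= dl0 hdl].
  exists dl => // s sdl; have [->|st] := eqVneq s t.
    by rewrite !subrr scale0r subr0 !normr0 mulr0.
  have st0 : s - t != 0 by rewrite subr_eq0.
  have := hdl (s - t); rewrite -ball_normE /= sub0r normrN subrK => /(_ sdl st0).
  move=> hh; rewrite -[f s - f t](scalerKV st0) -scalerBr normrZ mulrC.
  by rewrite ler_pM2r ?normr_gt0// distrC.
apply/cvgrPdist_le => e e0; have [dl dl0 hdl] := h _ e0.
apply/nbhs_ballP; exists dl => //= s.
rewrite -ball_normE /= sub0r normrN => sdl s0.
have := hdl (s + t); rewrite addrK => /(_ sdl) hh.
rewrite -(@ler_pM2l _ `|s|) ?normr_gt0// -normrZ scalerBr scalerKV// distrC.
by rewrite mulrC [X in _ <= X]mulrC mulrC; move: hh; rewrite mulrC.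
Qed.

Lemma is_derive_cvg {V : normedModType R} (f : R -> V) (t : R) (d : V) :
  is_derive t 1 f d -> f s @[s --> t] --> f t.
Proof.
move=> [ex _]; apply: differentiable_continuous.
exact/derivable1_diffP.
Qed.

Lemma is_derive_linear {V W : normedModType R} (L : V -> W) (a : R) (f : R -> V) (t : R) (d : V) :
  (forall b x y, L (b *: x + y) = b *: L x + L y) ->
  (forall x, `|L x| <= a * `|x|) ->
  is_derive t 1 f d -> is_derive t 1 (fun s => L (f s)) (L d).
Proof.
move=> lL bL /is_derive_epsP h; apply/is_derive_epsP => e e0.
have a1 : 0 < `|a| + 1 by rewrite ltr_wpDl.
have ea : 0 < e / (`|a| + 1) by rewrite divr_gt0.
have [dl dl0 hdl] := h _ ea; exists dl => // s /hdl hs.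
have LN x : L (- x) = - L x.
  have L0 : L 0 = 0.
    have := lL 1 0 0; rewrite !scale1r addr0 => /eqP.
    by rewrite -subr_eq0 opprD addNKr oppr_eq0 => /eqP.
  by have := lL (-1) x 0; rewrite !scaleN1r !addr0 L0 addr0.
have -> : L (f s) - L (f t) - (s - t) *: L d = L (f s - f t - (s - t) *: d).
  have LB x y : L (x - y) = L x - L y.
    by rewrite addrC -scaleN1r lL scaleN1r addrC.
  rewrite !LB; congr (_ - _).
  have := lL (s - t) d 0; rewrite !addr0 => ->.
  by have := LB d d; rewrite subrr => ->; rewrite subrr addr0.
apply: (le_trans (bL _)).
apply: (@le_trans _ _ ((`|a| + 1) * `|f s - f t - (s - t) *: d|)).
  by rewrite ler_wpM2r// (le_trans (ler_norm _))// lerDl.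
by rewrite -ler_pdivlMl// mulrA [_^-1 * e]mulrC.
Qed.

Lemma near_is_derive {V : normedModType R} (f g : R -> V) (t : R) (d : V) :
  (\forall s \near t, f s = g s) -> is_derive t 1 f d -> is_derive t 1 g d.
Proof.
move=> fg /is_derive_epsP h; apply/is_derive_epsP => e /h[dl dl0 hdl].
have /nbhs_ballP[r /= r0 hr] := fg.
exists (Num.min dl r); first by rewrite lt_min dl0.
move=> s; rewrite lt_min => /andP[/hdl hs sr].
have <- : f t = g t by apply: hr; exact: ballxx.
have <- : f s = g s by apply: hr; rewrite -ball_normE /= distrC.
exact: hs.
Qed.

Lemma is_derive_ip {H : completeNormedModType R} {ip : {dot H for idfun}}
    (f g : R -> H) (t : R) (df dg : H) : induces_norm ip ->
  is_derive t 1 f df -> is_derive t 1 g dg ->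
  is_derive t 1 (fun s => ip (f s) (g s)) (ip df (g t) + ip (f t) dg).
Proof.
move=> hip hf hg; apply/is_deriveP.
have hgc : g (h + t) @[h --> 0^'] --> g t.
  have /is_derive_cvg gc := hg.
  have sh : (h : R) + t @[h --> 0^'] --> t.
    rewrite -[X in _ --> X]add0r; apply: cvgD; last exact: cvg_cst.
    exact: cvg_within.
  exact: (cvg_comp _ _ sh gc).
have -> : (fun h : R => h^-1 *: (ip (f (h + t)) (g (h + t)) - ip (f t) (g t))) =
   (fun h : R => ip (h^-1 *: (f (h + t) - f t)) (g (h + t)) +
                 ip (f t) (h^-1 *: (g (h + t) - g t))).
  apply/funext => h; rewrite ipZl ipZr ipBl ipBr /GRing.scale/=; ring.
by apply: cvgD; apply: (ip_cvg hip) => //;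
  try exact: cvg_cst; exact/is_deriveP.
Qed.

Lemma nonincreasing_of_derive (f f' : R -> R) (a T : R) : continuous f ->
  (forall t, a < t < T -> is_derive t 1 f (f' t)) ->
  (forall t, a < t < T -> f' t <= 0) ->
  forall s t, a <= s -> s <= t -> t <= T -> f t <= f s.
Proof.
move=> cf df f'0 s t s0; rewrite le_eqVlt => /predU1P[->//|st] tT.
have [||c + e] := @MVT R f f' s t st.
- move=> x; rewrite in_itv /= => /andP[sx xt]; apply: df.
  by rewrite (le_lt_trans s0 sx) (lt_le_trans xt tT).
- exact: continuous_subspaceT.
rewrite in_itv /= => /andP[sc ct]; rewrite -subr_le0 e.
rewrite mulr_le0_ge0 ?subr_ge0 ?(ltW st)// f'0//.
by rewrite (le_lt_trans s0 sc) (lt_le_trans ct tT).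
Qed.

(** Mean value inequality for vectors: with [z] the increment itself, the scalar function
    [ip z f - |z| g] is nonincreasing. *)
Lemma norm_increment_le {H : completeNormedModType R} {ip : {dot H for idfun}}
    (f f' : R -> H) (g g' : R -> R) (a T : R) : induces_norm ip ->
  continuous f -> continuous g ->
  (forall t, a < t < T -> is_derive t 1 f (f' t)) ->
  (forall t, a < t < T -> is_derive t 1 g (g' t)) ->
  (forall t, a < t < T -> `|f' t| <= g' t) ->
  forall s t, a <= s -> s <= t -> t <= T -> `|f t - f s| <= g t - g s.
Proof.
move=> hip cf cg df dg fg s t s0 st tT; set z := f t - f s.
have cst0 : continuous (fun _ : R => z) by move=> ?; exact: cvg_cst.
have ch : continuous (fun r => ip z (f r) - `|z| * g r).
  move=> r; apply: cvgB; first by apply: (ip_cvg hip); [exact: cst0|exact: cf].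
  by apply: cvgM; [exact: cvg_cst|exact: cg].
have := @nonincreasing_of_derive _ (fun r => ip z (f' r) - `|z| * g' r) a T ch _ _ s t s0 st tT.
have dh r : a < r < T ->
    is_derive r 1 (fun r => ip z (f r) - `|z| * g r) (ip z (f' r) - `|z| * g' r).
  move=> rT; have h1 := is_derive_ip hip (is_derive_cst z r 1) (df _ rT).
  rewrite ip0l add0r in h1.
  exact: (is_deriveB h1 (is_deriveZ `|z| (dg _ rT))).
move=> /(_ dh); have dh0 r : a < r < T -> ip z (f' r) - `|z| * g' r <= 0.
  move=> rT; rewrite subr_le0; apply: le_trans (ler_norm _) _.
  by apply: le_trans (ler_ip hip _ _) _; rewrite ler_wpM2l// fg.
move=> /(_ dh0); rewrite -subr_ge0 => h.
have {h} : `|z| * `|z| <= `|z| * (g t - g s).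
  rewrite -expr2 hip {2}/z ipBr; move: h; lra.
(* If [z] is zero the factor cannot be cancelled; the claim is then the monotonicity of [g]. *)
have [->|z0] := eqVneq z 0; last by rewrite ler_pM2l// normr_gt0.
rewrite normr0 => _.
have hg : - g t <= - g s.
  apply: (@nonincreasing_of_derive (fun r => - g r) (fun r => - g' r) a T) => //.
  - by move=> r; apply: cvgN; exact: cg.
  - by move=> r rT; exact: (is_deriveN (dg _ rT)).
  - by move=> r rT; rewrite oppr_le0 (le_trans _ (fg _ rT)).
by rewrite subr_ge0 -lerN2.
Qed.

End RealCalculus.

Section HalfLineCalculus.
Context {R : realType}.
Implicit Types (s t T e : R).

Definition rho (t : R) : R := Num.max t 0.

Lemma rho_ge0 t : 0 <= rho t.
Proof. by rewrite /rho le_max lexx orbT. Qed.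

Lemma rho_id t : 0 <= t -> rho t = t.
Proof. by move=> t0; rewrite /rho max_l. Qed.

Lemma rho_continuous : continuous rho.
Proof. by move=> t; apply: continuous_max; [exact: cvg_id|exact: cvg_cst]. Qed.

Lemma rho_near t : 0 < t -> \forall s \near t, rho s = s.
Proof.
move=> t0; near=> s; apply: rho_id; apply: ltW; near: s.
exact: lt_nbhsr.
Unshelve. all: by end_near. Qed.

(* Functions on the half-line are represented by functions that are continuous
   on the whole line, typically of the form [f \o rho]; only the values at
   nonnegative arguments matter. *)
Definition C1on {V : normedModType R} (f g : R -> V) :=
  [/\ continuous f, continuous g & forall t, 0 < t -> is_derive t 1 f (g t)].

Definition ucvg {V : normedModType R} (h : nat -> R -> V) (k : R -> V) :=
  forall T e, 0 < e -> exists N, forall n, (N <= n)%N ->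
    forall t, 0 <= t <= T -> `|h n t - k t| <= e.

Definition ucauchy {V : normedModType R} (h : nat -> R -> V) :=
  forall T e, 0 < e -> exists N, forall n, (N <= n)%N ->
    forall t, 0 <= t <= T -> `|h N t - h n t| <= e.

Lemma continuous_rho {V : normedModType R} (f : R -> V) :
  (forall t, 0 <= t -> {for t, continuous f}) -> continuous (fun t => f (rho t)).
Proof.
move=> cf t; apply: (@continuous_comp _ _ _ rho f).
  exact: rho_continuous.
by apply: cf; exact: rho_ge0.
Qed.

Lemma ucvg_cvg {V : normedModType R} (h : nat -> R -> V) (k : R -> V) t :
  ucvg h k -> 0 <= t -> h n t @[n --> \oo] --> k t.
Proof.
move=> hk t0; apply/cvgrPdist_le => e e0.
have [N hN] := hk t e e0; exists N => // n /= Nn.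
by rewrite distrC hN// t0 lexx.
Qed.

Lemma ucauchy_ucvg {V : completeNormedModType R} (h : nat -> R -> V) :
  (forall n, continuous (h n)) -> ucauchy h ->
  exists k, [/\ continuous k, ucvg h k & forall t, k t = k (rho t)].
Proof.
move=> ch hh.
have cv t : cvgn (fun n => h n (rho t)).
  apply: cauchy_cvgn => e e0; have e2 : 0 < e / 2 by rewrite divr_gt0.
  have [N hN] := hh (rho t) _ e2; exists N => n Nn.
  apply: le_lt_trans (hN n Nn (rho t) _) _; first by rewrite rho_ge0 lexx.
  by rewrite ltr_pdivrMr// ltr_pMr// ltr1n.
(* The sequence is controlled on the half-line only; composing with [rho] gives a limit that is
   defined and continuous everywhere. *)
pose k t := limn (fun n => h n (rho t)).
have kE t : h n (rho t) @[n --> \oo] --> k t by exact: cv.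
have uk : ucvg h k.
  move=> T e e0; have e2 : 0 < e / 2 by rewrite divr_gt0.
  have [N hN] := hh T _ e2; exists N => n Nn t tT; have /andP[t0 _] := tT.
  have h1 : `|h N t - k t| <= e / 2.
    have c : (fun m => h N t - h m t) @ \oo --> h N t - k t.
      by apply: cvgB; [exact: cvg_cst|have := kE t; rewrite rho_id].
    have h2 n' : (N <= n')%N -> `|h N t - h n' t| <= e / 2 by move=> ?; exact: hN.
    have c' : h N t - h (n' + N)%N t @[n' --> \oo] --> h N t - k t.
      by exact: (cvg_comp (addn^~ N) (fun m => h N t - h m t) (cvg_addnr N) c).
    by apply: (cvgn_norm_le c') => n'; apply: h2; exact: leq_addl.
  have := hN _ Nn _ tT; rewrite distrC => h3.
  have -> : h n t - k t = (h n t - h N t) + (h N t - k t) by rewrite addrA subrK.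
  by apply: le_trans (ler_normD _ _) _; lra.
have kr t : k t = k (rho t) by rewrite /k (rho_id (rho_ge0 t)).
exists k; split => // t; apply/cvgrPdist_le => e e0.
have e3 : 0 < e / 3 by rewrite divr_gt0.
have [N hN] := uk (rho t + 1) _ e3.
have hr : continuous (fun s => h N (rho s)).
  by apply: continuous_rho => s _; exact: ch.
have /cvgrPdist_le/(_ _ e3) c1 := hr t.
have /cvgrPdist_lt/(_ _ ltr01) c2 := @rho_continuous t.
near=> s; rewrite kr (kr s).
have n1 : `|h N (rho t) - k (rho t)| <= e / 3.
  by apply: (hN _ (leqnn N)); rewrite rho_ge0 lerDl ler01.
have n2 : `|h N (rho s) - k (rho s)| <= e / 3.
  apply: (hN _ (leqnn N)); rewrite rho_ge0/=.
  have : `|rho t - rho s| < 1 by near: s.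
  by rewrite ltr_norml => /andP[h1 _]; lra.
have n3 : `|h N (rho t) - h N (rho s)| <= e / 3 by near: s.
have -> : k (rho t) - k (rho s) = - (h N (rho t) - k (rho t)) +
  (h N (rho t) - h N (rho s)) + (h N (rho s) - k (rho s)).
  by rewrite opprB !addrA !subrK.
apply: le_trans (ler_normD _ _) _.
have := ler_normD (- (h N (rho t) - k (rho t))) (h N (rho t) - h N (rho s)).
by rewrite normrN; lra.
Unshelve. all: by end_near. Qed.

(** Only [t] is confined to the segment: in [primitive_exists] the grid points compared with [t] may
    lie just beyond [T]. *)
Lemma unif_continuous_segment {V : normedModType R} (g : R -> V) T e :
  continuous g -> 0 < e -> exists2 dl, 0 < dl &
    forall s t, 0 <= t <= T -> `|s - t| < dl -> `|g s - g t| <= e.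
Proof.
move=> cg e0.
have /compact_near_coveringP cov := @segment_compact R 0 T.
have := cov R 0^'+ (fun dl x => forall s, `|s - x| < dl -> `|g s - g x| <= e) _.
have hx x : `[0, T]%classic x -> \forall x' \near x & i \near 0^'+,
    (forall s, `|s - x'| < i -> `|g s - g x'| <= e).
  move=> _; have e2 : 0 < e / 2 by rewrite divr_gt0.
  have /cvgrPdist_le/(_ _ e2) := cg x; move=> /nbhs_ballP[r /= r0 hr].
  have r2 : 0 < r / 2 by rewrite divr_gt0.
  exists (ball x (r / 2), [set i | i < r / 2]).
    split; first exact: nbhsx_ballx.
    exact: nbhs_right_lt.
  move=> [x' i] [/=]; rewrite -ball_normE /= => xx' ir s sx.
  have h1 : `|g x - g x'| <= e / 2 by apply: hr; rewrite -ball_normE /=; lra.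
  have h2 : `|g x - g s| <= e / 2.
    apply: hr; rewrite -ball_normE /=; apply: le_lt_trans (ler_distD x' _ _) _.
    by rewrite (distrC x'); lra.
  have -> : g s - g x' = (g x - g x') - (g x - g s).
    by rewrite opprB [RHS]addrC addrA subrK.
  by apply: le_trans (ler_normB _ _) _; lra.
move=> /(_ _ hx) [d /= d0 hd]; exists (d / 2); first by rewrite divr_gt0.
move=> s t tT st; apply: (hd (d / 2)).
- by rewrite /ball_ /= sub0r normrN gtr0_norm ?divr_gt0// ltr_pdivrMr// ltr_pMr// ltr1n.
- by rewrite divr_gt0.
- by rewrite /= in_itv.
- exact: st.
Qed.

Lemma C1onD {V : normedModType R} (f g f' g' : R -> V) : C1on f f' -> C1on g g' ->
  C1on (fun t => f t + g t) (fun t => f' t + g' t).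
Proof.
move=> [cf cf' df] [cg cg' dg]; split.
- by move=> t; apply: cvgD; [exact: cf|exact: cg].
- by move=> t; apply: cvgD; [exact: cf'|exact: cg'].
- by move=> t t0; exact: (is_deriveD (df _ t0) (dg _ t0)).
Qed.

Lemma C1on_linear {V W : normedModType R} (L : V -> W) (a : R) (f f' : R -> V) :
  (forall b x y, L (b *: x + y) = b *: L x + L y) ->
  (forall x, `|L x| <= a * `|x|) ->
  C1on f f' -> C1on (fun t => L (f t)) (fun t => L (f' t)).
Proof.
move=> lL bL [cf cf' df].
have cL : continuous L.
  move=> x; apply/cvgrPdist_le => e e0.
  have a1 : 0 < `|a| + 1 by rewrite ltr_wpDl.
  have ea : 0 < e / (`|a| + 1) by rewrite divr_gt0.
  have hid : y @[y --> x] --> x by exact: cvg_id.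
  have /cvgrPdist_le/(_ _ ea) hid' := hid.
  near=> y; have -> : L x - L y = L (x - y).
    rewrite [RHS](_ : _ = L (-1 *: y + x)); last by rewrite scaleN1r addrC.
    by rewrite lL scaleN1r addrC.
  apply: (le_trans (bL _)); apply: (@le_trans _ _ ((`|a| + 1) * `|x - y|)).
    by rewrite ler_wpM2r// (le_trans (ler_norm _))// lerDl.
  by rewrite -ler_pdivlMl// mulrC; near: y.
split.
- by move=> t; apply: (continuous_comp (cf t)); exact: cL.
- by move=> t; apply: (continuous_comp (cf' t)); exact: cL.
- by move=> t t0; exact: (is_derive_linear lL bL (df _ t0)).
Unshelve. all: by end_near. Qed.

Lemma scalar_primitive (p : R -> R) : continuous p ->
  exists2 q, C1on q p & q 0 = 0.
Proof.
move=> cp; pose mu := @lebesgue_measure R.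
(* Integrating from -1 makes 0 an interior point, so that [F] is differentiable and hence continuous
   there. *)
pose F (x : R) : R := (\int[mu]_(t in `[-1, x]) p t).
have dF (x : R) : -1 < x -> derivable F x 1 /\ derive1 F x = p x.
  move=> x1; apply: (@continuous_FTC1_closed _ p (-1) x (x + 1)) => //.
  - by rewrite ltrDl.
  - apply: continuous_compact_integrable; first exact: segment_compact.
    exact: continuous_subspaceT.
  - exact: cp.
have dF' (x : R) : -1 < x -> is_derive x 1 F (p x).
  by move=> /dF[h <-]; rewrite derive1E; exact: DeriveDef.
exists (fun t => F (rho t) - F 0); last by rewrite rho_id// subrr.
split=> //.
- move=> t; apply: cvgB; last exact: cvg_cst.
  apply: (@continuous_rho R^o F) => s s0.
  by apply: is_derive_cvg (dF' s _); rewrite (lt_le_trans _ s0).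
- move=> t t0; rewrite -[p t]subr0; apply: is_deriveB.
  apply: (near_is_derive (f := F)); last by apply: dF'; rewrite (lt_trans _ t0).
  by apply: filterS (rho_near t0) => s ->.
Qed.

End HalfLineCalculus.

Section VectorCalculus.
Context {R : realType} {H : completeNormedModType R} {ip : {dot H for idfun}}.
Hypothesis hip : induces_norm ip.
Implicit Types (s t T e : R).

Lemma is_derive_scalel {V : normedModType R} (p : R -> R) t (dp : R) (v : V) :
  is_derive t 1 p dp -> is_derive t 1 (fun s => p s *: v) (dp *: v).
Proof.
apply: (@is_derive_linear R R^o V (fun r => r *: v) `|v| p t dp).
  by move=> b x y; rewrite scalerDl scalerA.
by move=> x; rewrite normrZ mulrC.
Qed.

Lemma is_derive_mull (M : R) (f : R -> R) t (d : R) : is_derive t 1 f d ->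
  is_derive t 1 (fun s => M * f s) (M * d).
Proof. by move=> h; exact: (@is_deriveZ _ _ R^o f M t 1 d h). Qed.

Lemma C1on_scalel {V : normedModType R} (p q : R -> R) (v : V) : C1on p q ->
  C1on (fun s => p s *: v) (fun s => q s *: v).
Proof.
move=> [cp cq dp]; split.
- by move=> t; apply: cvgZr_tmp; exact: cp.
- by move=> t; apply: cvgZr_tmp; exact: cq.
- by move=> t t0; apply: is_derive_scalel; exact: dp.
Qed.

Lemma C1on_cst {V : normedModType R} (v : V) : C1on (fun=> v) (fun=> 0).
Proof.
split; [by move=> t; exact: cvg_cst|by move=> t; exact: cvg_cst|].
by move=> t _; exact: is_derive_cst.
Qed.

Lemma C1on_id : C1on (fun t => t) (fun=> 1 : R).
Proof.
split; [by move=> t; exact: cvg_id|by move=> t; exact: cvg_cst|].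
by move=> t _; exact: is_derive_id.
Qed.

Lemma C1_increment (f g : R -> H) (v : H) (M : R) s t : C1on f g ->
  0 <= s -> s <= t -> (forall r, s < r < t -> `|g r - v| <= M) ->
  `|f t - f s - (t - s) *: v| <= M * (t - s).
Proof.
move=> [cf cg df] s0 st gM.
have [ci _ di] := C1on_scalel v C1on_id.
have := @norm_increment_le _ _ _ (fun r => f r - r *: v) (fun r => g r - 1 *: v)
  (fun r => M * r) (fun r => M * 1) s t hip _ _ _ _ _ s t (lexx s) st (lexx t).
have -> : f t - t *: v - (f s - s *: v) = f t - f s - (t - s) *: v.
  by rewrite scalerBl !opprD !opprK !addrA; congr (_ + _); rewrite addrAC.
rewrite mulrBr; apply.
- by move=> r; apply: cvgB; [exact: cf|exact: ci].
- by move=> r; apply: cvgM; [exact: cvg_cst|exact: cvg_id].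
- move=> r /andP[sr rt]; have r0 := le_lt_trans s0 sr.
  exact: (is_deriveB (df _ r0) (di _ r0)).
- by move=> r srt; rewrite scale1r mulr1 gM.
Qed.

Lemma increment_swap {V : normedModType R} (a b v : V) s t :
  `|a - b - (s - t) *: v| = `|b - a - (t - s) *: v|.
Proof.
rewrite -normrN; congr `|_|; rewrite opprB -(opprB s t) scaleNr opprK.
by rewrite opprB addrC.
Qed.

(** Includes the one-sided derivative at 0, about which [C1on] says nothing: it follows from
    continuity of [g] at 0 and the mean value inequality. *)
Lemma C1on_eps (f g : R -> H) t e : C1on f g -> 0 <= t -> 0 < e ->
  exists2 dl, 0 < dl & forall s, 0 <= s -> `|s - t| < dl ->
    `|f s - f t - (s - t) *: g t| <= e * `|s - t|.
Proof.
move=> fg t0 e0; have [cf cg df] := fg.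
have /cvgrPdist_le/(_ _ e0) := cg t; move=> /nbhs_ballP[d /= d0 hd].
exists d => // s s0 sd.
have hr r : `|r - t| < d -> `|g r - g t| <= e.
  by move=> rt; rewrite distrC; apply: hd; rewrite -ball_normE /= distrC.
have [ts|st] := leP t s.
  have := @C1_increment f g (g t) e t s fg t0 ts.
  rewrite (@ger0_norm _ (s - t)) ?subr_ge0//; apply => r /andP[tr rs].
  apply: hr; apply: le_lt_trans sd; rewrite !ger0_norm ?subr_ge0 ?(ltW tr)//.
  by rewrite lerD2r ltW.
have := @C1_increment f g (g t) e s t fg s0 (ltW st).
rewrite (@ler0_norm _ (s - t)) ?subr_le0 ?(ltW st)// opprB.
rewrite increment_swap; apply=> r /andP[sr rt]; apply: hr; apply: le_lt_trans sd.
rewrite !ler0_norm ?subr_le0 ?(ltW rt) ?(ltW st)// lerN2 lerD2r ltW//.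
Qed.

Lemma ucvg_C1on (f g : nat -> R -> H) (F G : R -> H) :
  (forall n, C1on (f n) (g n)) -> continuous F -> continuous G ->
  ucvg f F -> ucvg g G -> C1on F G.
Proof.
move=> fg cF cG fF gG; split=> // t t0; apply/is_derive_epsP => e e0.
have e2 : 0 < e / 2 by rewrite divr_gt0.
have /cvgrPdist_le/(_ _ e2) := cG t; move=> /nbhs_ballP[d /= d0 hd].
exists (Num.min d t); first by rewrite lt_min d0.
move=> s; rewrite lt_min => /andP[sd st0].
have s0 : 0 <= s by move: st0; rewrite ltr_norml => /andP[h _]; lra.
have [N hN] := gG (t + d) _ e2.
have hr n r : (N <= n)%N -> 0 <= r -> `|r - t| < d -> `|g n r - G t| <= e.
  move=> Nn r0 rt; have h1 : `|g n r - G r| <= e / 2.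
    by apply: hN => //; rewrite r0/=; move: rt; rewrite ltr_norml => /andP[_]; lra.
  have h2 : `|G t - G r| <= e / 2 by apply: hd; rewrite -ball_normE /= distrC.
  have -> : g n r - G t = (g n r - G r) - (G t - G r) by rewrite opprB addrA subrK.
  by apply: le_trans (ler_normB _ _) _; lra.
have c : f (n + N)%N s - f (n + N)%N t - (s - t) *: G t @[n --> \oo] -->
    F s - F t - (s - t) *: G t.
  have c1 := cvg_comp (addn^~ N) _ (cvg_addnr N) (ucvg_cvg fF s0).
  have c2 := cvg_comp (addn^~ N) _ (cvg_addnr N) (ucvg_cvg fF (ltW t0)).
  by apply: cvgB; [exact: cvgB c1 c2|exact: cvg_cst].
apply: (cvgn_norm_le c) => n.
have Nn : (N <= n + N)%N by exact: leq_addl.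
have [ts|/ltW st] := leP t s.
  rewrite (@ger0_norm _ (s - t)) ?subr_ge0//; apply: C1_increment => //.
    exact: ltW.
  move=> r /andP[tr rs]; apply: hr => //; first exact: ltW (lt_trans t0 tr).
  apply: le_lt_trans sd; rewrite !ger0_norm ?subr_ge0 ?(ltW tr)//.
  by rewrite lerD2r ltW.
rewrite (@ler0_norm _ (s - t)) ?subr_le0// opprB.
rewrite increment_swap; apply: C1_increment => // r /andP[sr rt]; apply: hr => //.
  exact: ltW (le_lt_trans s0 sr).
apply: le_lt_trans sd; rewrite !ler0_norm ?subr_le0 ?(ltW rt)//.
by rewrite lerN2 lerD2r ltW.
Qed.

Lemma bounded_segment {V : normedModType R} (f : R -> V) T : continuous f ->
  exists2 M, 0 <= M & forall t, 0 <= t <= T -> `|f t| <= M.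
Proof.
move=> cf; have [T0|T0] := leP 0 T; last first.
  exists 0 => // t /andP[t0 tT]; have := le_trans t0 tT.
  by rewrite leNgt T0.
have cn : {within `[0, T], continuous (fun t => `|f t|)}.
  apply: continuous_subspaceT => t.
  by apply: cvg_norm; exact: cf.
have [c _ hc] := EVT_max T0 cn.
by exists `|f c| => // t tT; apply: hc; rewrite in_itv.
Qed.

Lemma gronwall (E E' : R -> R) (G T : R) : continuous E ->
  (forall t, 0 < t < T -> is_derive t 1 E (E' t)) ->
  (forall t, 0 < t < T -> E' t <= G * E t) ->
  forall t, 0 <= t <= T -> E t <= E 0 * expR (G * t).
Proof.
move=> cE dE hE t /andP[t0 tT].
pose w s := expR (- G * s).
have dw s : is_derive s 1 w (- G * w s).
  have := is_derive1_comp (is_derive_expR (- G * s)) (is_derive_mull (- G) (is_derive_id s (1 : R))).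
  by rewrite mulr1 mulrC.
have cw : continuous w by move=> s; exact: is_derive_cvg (dw s).
have := @nonincreasing_of_derive _ (fun s => E s * w s)
  (fun s => E s * (- G * w s) + w s * E' s) 0 T _ _ _ 0 t (lexx 0) t0 tT.
have -> : w 0 = 1 by rewrite /w mulr0 expR0.
rewrite mulr1 => h.
have {}h : E t * w t <= E 0.
  apply: h.
  - by move=> s; apply: cvgM; [exact: cE|exact: cw].
  - by move=> s sT; exact: (is_deriveM (dE _ sT) (dw s)).
  - move=> s sT; have := hE _ sT; have : 0 < w s by exact: expR_gt0.
    rewrite /GRing.scale/=; move: (w s) (E s) (E' s) => a b c; nra.
move: h; rewrite /w mulNr expRN -ler_pdivlMr ?invr_gt0 ?expR_gt0//.
by rewrite invrK.
Qed.

(** Squaring makes the positive part differentiable at 0, which turns [le0_barrier] into a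
    monotonicity argument for the squared positive part of [h]. *)
Lemma is_derive_possq (x : R) :
  is_derive x 1 (fun y : R => Num.max y 0 ^+ 2) (2 * Num.max x 0).
Proof.
apply/is_derive_epsP => e e0; exists e => // y xy.
apply: (@le_trans _ _ (`|y - x| ^+ 2)).
  rewrite real_normK ?num_real// /GRing.scale/= ler_norml.
  have p0 := sqr_ge0 (y - x); have p1 := sqr_ge0 x; have p2 := sqr_ge0 y.
  have [hx|hx] := leP x 0; have [hy|hy] := leP y 0; rewrite ?expr0n /=.
  - by apply/andP; split; lra.
  - have h : 0 <= - x * y by rewrite mulr_ge0 ?oppr_ge0// ltW.
    by apply/andP; split; nra.
  - have h : 0 <= - y * x by rewrite mulr_ge0 ?oppr_ge0// ltW.
    by apply/andP; split; nra.
  - by apply/andP; split; nra.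
by rewrite expr2 ler_wpM2r// ltW.
Qed.

Lemma le0_barrier (h h' : R -> R) T : continuous h ->
  (forall t, 0 < t < T -> is_derive t 1 h (h' t)) ->
  (forall t, 0 < t < T -> 0 < h t -> h' t <= 0) -> h 0 <= 0 ->
  forall t, 0 <= t <= T -> h t <= 0.
Proof.
move=> ch dh hh h0 t /andP[t0 tT].
have := @nonincreasing_of_derive _ (fun s => Num.max (h s) 0 ^+ 2)
  (fun s => 2 * Num.max (h s) 0 * h' s) 0 T _ _ _ 0 t (lexx 0) t0 tT.
rewrite (max_r h0) expr0n/= => h1.
have {}h1 : Num.max (h t) 0 ^+ 2 <= 0.
  apply: h1.
  - move=> s; apply: (@continuous_comp _ _ _ h (fun y : R => Num.max y 0 ^+ 2)).
      exact: ch.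
    exact: is_derive_cvg (is_derive_possq _).
  - move=> s sT; have := is_derive1_comp (is_derive_possq (h s)) (dh _ sT).
    by rewrite /GRing.scale/=.
  - move=> s sT; have [hs|hs] := leP (h s) 0.
      by rewrite mulr0 mul0r.
    by rewrite mulr_ge0_le0// ?mulr_ge0 ?(ltW hs)// hh.
have : Num.max (h t) 0 == 0 by rewrite -sqrf_eq0 eq_le h1 sqr_ge0.
by move=> /eqP <-; rewrite le_max lexx.
Qed.

(** Before the infimum of the times where [g] is at least 1 the inequality holds, so the premise
    gives it at the infimum and continuity gives it shortly after, a contradiction. At [T = 0] the
    inner assumption is vacuous, so the premise also supplies the initial inequality. *)
Lemma bootstrap (g : R -> R) : continuous g ->
  (forall T, 0 <= T -> (forall t, 0 <= t < T -> g t < 1) -> g T < 1) ->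
  forall t, 0 <= t -> g t < 1.
Proof.
move=> cg hg t t0; rewrite ltNge; apply/negP => gt1.
pose S := [set s : R | 0 <= s /\ 1 <= g s].
have S0 : S !=set0 by exists t.
have lS : has_lbound S by exists 0 => s [].
have hS : has_inf S by split.
have i0 : 0 <= inf S by apply: lb_le_inf => // s [].
have gi : g (inf S) < 1.
  apply: hg => // s /andP[s0 si]; rewrite ltNge; apply/negP => gs.
  have : inf S <= s by apply: ge_inf.
  by rewrite leNgt si.
have g1 : 0 < 1 - g (inf S) by rewrite subr_gt0.
have /cvgrPdist_lt/(_ _ g1) := cg (inf S); move=> /nbhs_ballP[d /= d0 hd].
have [s [s0 gs] sd] := inf_adherent d0 hS.
have i_s : inf S <= s by apply: ge_inf.
have := hd s; rewrite -ball_normE /= ler0_norm ?subr_le0// opprB ltrBlDr addrC.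
move=> /(_ sd); rewrite ltr_norml => /andP[h _]; move: h; lra.
Qed.

End VectorCalculus.

(** * Global solutions of Lipschitz systems in a Hilbert space *)

Section Picard.
Context {R : realType} {H : completeNormedModType R} {ip : {dot H for idfun}}.
Hypothesis hip : induces_norm ip.
Implicit Types (s t T e : R).

Lemma ucvg_ucauchy {V : normedModType R} (h : nat -> R -> V) k :
  ucvg h k -> ucauchy h.
Proof.
move=> hk T e e0; have e2 : 0 < e / 2 by rewrite divr_gt0.
have [N hN] := hk T _ e2; exists N => n Nn t tT.
have h1 := hN _ (leqnn N) _ tT; have h2 := hN _ Nn _ tT.
have -> : h N t - h n t = (h N t - k t) - (h n t - k t).
  by rewrite opprB addrA subrK.
by apply: le_trans (ler_normB _ _) _; lra.
Qed.

Lemma ucauchy_primitive (f g : nat -> R -> H) : (forall n, C1on (f n) (g n)) ->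
  ucauchy g -> cvgn (fun n => f n 0) -> ucauchy f.
Proof.
move=> fg cg /cvg_ex[a f0] T e e0.
have T1 : 0 < `|T| + 1 by rewrite ltr_wpDl.
have e1 : 0 < e / 2 / (`|T| + 1) / 2 by rewrite !divr_gt0.
have e4 : 0 < e / 4 by rewrite divr_gt0.
have [N1 hN1] := cg T _ e1; have /cvgrPdist_le/(_ _ e4) [N2 _ hN2] := f0.
pose N := maxn N1 N2; exists N => n Nn t /andP[t0 tT].
have N1N : (N1 <= N)%N by exact: leq_maxl.
have N2N : (N2 <= N)%N by exact: leq_maxr.
have i1 : `|f N 0 - f n 0| <= e / 2.
  have h1 := hN2 _ N2N; have h2 := hN2 _ (leq_trans N2N Nn).
  have -> : f N 0 - f n 0 = (a - f n 0) - (a - f N 0).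
    by rewrite opprB [RHS]addrC addrA subrK.
  by apply: le_trans (ler_normB _ _) _; move: h1 h2 => /=; lra.
have fNn : C1on (fun s => f N s + (- 1) *: f n s) (fun s => g N s + (- 1) *: g n s).
  apply: C1onD => //; apply: (C1on_linear (a := 1)) => //.
    by move=> b x y; rewrite !scaleN1r opprD scalerN.
  by move=> x; rewrite scaleN1r normrN mul1r.
have gNn r : 0 < r < t -> `|g N r + (- 1) *: g n r - 0| <= e / 2 / (`|T| + 1).
  move=> /andP[/ltW r0 /ltW rt]; rewrite subr0 scaleN1r.
  have rT : 0 <= r <= T by rewrite r0 (le_trans rt).
  have h1 := hN1 _ N1N _ rT; have h2 := hN1 _ (leq_trans N1N Nn) _ rT.
  have -> : g N r - g n r = (g N1 r - g n r) - (g N1 r - g N r).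
    by rewrite opprB [RHS]addrC addrA subrK.
  by apply: le_trans (ler_normB _ _) _; lra.
have := C1_increment hip fNn (lexx 0) t0 gNn.
rewrite !scaleN1r scaler0 !subr0 => i2.
have i3 : e / 2 / (`|T| + 1) * t <= e / 2.
  rewrite mulrAC ler_pdivrMr// ler_wpM2l ?divr_ge0 ?(ltW e0)//.
  by rewrite (le_trans tT)// (le_trans (ler_norm _))// lerDl.
have -> : f N t - f n t = (f N t - f n t - (f N 0 - f n 0)) + (f N 0 - f n 0).
  by rewrite subrK.
by apply: le_trans (ler_normD _ _) _; lra.
Qed.

(** For positive [m] it rises from 0 to 1 between k/m and (k+1)/m. Combinations of ramps are
    piecewise linear interpolants, whose vector-valued primitives reduce to scalar integrals. *)
Definition ramp (m k : nat) (t : R) : R := Num.min (Num.max (m%:R * t - k%:R) 0) 1.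

Lemma ramp_continuous m k : continuous (ramp m k).
Proof.
move=> t; apply: (@continuous_min _ _ (fun t => Num.max (m%:R * t - k%:R) 0) (fun=> 1)).
  apply: (@continuous_max _ _ (fun t => m%:R * t - k%:R) (fun=> 0)).
    apply: cvgB; last exact: cvg_cst.
    by apply: cvgM; [exact: cvg_cst|exact: cvg_id].
  exact: cvg_cst.
exact: cvg_cst.
Qed.

(** Up to the constant [v 0], the interpolant with value [v k] at k/m for k at most [N]. *)
Definition ramps (m : nat) (v : nat -> H) N (t : R) : H :=
  \sum_(0 <= k < N) ramp m k t *: (v k.+1 - v k).

Lemma rampsE m v N j t : (j < N)%N -> j%:R <= m%:R * t -> m%:R * t < j.+1%:R ->
  ramps m v N t = (v j - v 0%N) + ramp m j t *: (v j.+1 - v j).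
Proof.
move=> jN jt tj; rewrite /ramps (big_cat_nat (n := j.+1))//= big_nat_recr//=.
rewrite [X in _ + X]big_nat_cond [X in _ + X]big1 ?addr0; last first.
  move=> k /andP[/andP[jk _] _]; rewrite /ramp max_r ?min_l ?scale0r//.
  by rewrite subr_le0 (le_trans (ltW tj))// ler_nat.
congr (_ + _); rewrite -telescope_sumr//; apply: eq_big_nat => k /andP[_ kj].
rewrite /ramp min_r ?scale1r// le_max lerBrDr; apply/orP; left.
by apply: le_trans jt; rewrite nat1r ler_nat.
Qed.

Lemma ramps_C1on m v N : exists2 f, C1on f (ramps m v N) & f 0 = 0.
Proof.
elim: N => [|N [f hf f0]].
  exists (fun=> 0) => //; rewrite (_ : ramps m v 0 = fun=> 0); first exact: C1on_cst.
  by apply/funext => t; rewrite /ramps big_geq.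
have [q hq q0] := scalar_primitive (@ramp_continuous m N).
exists (fun t => f t + q t *: (v N.+1 - v N)); last by rewrite f0 q0 scale0r addr0.
rewrite (_ : ramps m v N.+1 = fun t => ramps m v N t + ramp m N t *: (v N.+1 - v N)).
  by apply: C1onD => //; exact: C1on_scalel.
by apply/funext => t; rewrite /ramps big_nat_recr.
Qed.

Lemma primitive_exists (g : R -> H) (a : H) : continuous g ->
  exists f, C1on f g /\ f 0 = a.
Proof.
move=> cg; pose v n k := g (k%:R / n.+1%:R).
(* Cells of length 1/(n+1), in number (n+1)^2, reach up to time n+1, so every compact interval is
   eventually covered. *)
pose G n t := g 0 + ramps n.+1 (v n) (n.+1 * n.+1) t.
have /choice [f hf] : forall n, exists f, C1on f (G n) /\ f 0 = a.
  move=> n; have [f hf f0] := ramps_C1on n.+1 (v n) (n.+1 * n.+1).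
  have h1 := C1onD (C1on_cst a) (C1onD (C1on_scalel (g 0) C1on_id) hf).
  exists (fun t => a + (t *: g 0 + f t)).
  split; last by rewrite f0 scale0r !addr0.
  rewrite (_ : G n = fun t => 0 + (1 *: g 0 + ramps n.+1 (v n) (n.+1 * n.+1) t))//.
  by apply/funext => t; rewrite add0r scale1r.
have uG : ucvg G g.
  move=> T e e0; have e3 : 0 < e / 3 by rewrite divr_gt0.
  have [d d0 hd] := unif_continuous_segment T cg e3.
  pose N := (maxn (Num.truncn (2 / d)) (Num.truncn `|T|)).+1.
  have N1 : 2 / d < N%:R.
    by rewrite (lt_le_trans (truncnS_gt _))// ler_nat ltnS leq_maxl.
  have N2 : T < N%:R.
    rewrite (le_lt_trans (ler_norm T))// (lt_le_trans (truncnS_gt _))//.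
    by rewrite ler_nat ltnS leq_maxr.
  exists N => n Nn t tT; have /andP[t0 tT'] := tT.
  have n0 : (0:R) < n.+1%:R by [].
  have nN : (N%:R : R) <= n.+1%:R by rewrite ler_nat ltnW.
  pose j := Num.truncn (n.+1%:R * t).
  have jt : j%:R <= n.+1%:R * t by rewrite truncn_le// mulr_ge0.
  have tj : n.+1%:R * t < j.+1%:R by rewrite truncnS_gt.
  have jN : (j < n.+1 * n.+1)%N.
    rewrite -(ltr_nat R) natrM (le_lt_trans jt)// ltr_pM2l//.
    by rewrite (lt_le_trans _ nN)// (le_lt_trans tT').
  rewrite /G (rampsE _ jN jt tj) /v mul0r addrA addrCA subrr addr0.
  have dn : 2 < n.+1%:R * d.
    by rewrite -ltr_pdivrMr// (lt_le_trans N1).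
  have near_t q : `|q * n.+1%:R - n.+1%:R * t| <= 1 -> `|g q - g t| <= e / 3.
    move=> h; apply: hd => //; rewrite -(ltr_pM2r n0) -{1}(gtr0_norm n0) -normrM.
    by rewrite mulrBl (mulrC t) (le_lt_trans h)// mulrC (lt_trans _ dn)// ltr1n.
  rewrite -natr1 in tj.
  have e1 : `|g (j%:R / n.+1%:R) - g t| <= e / 3.
    apply: near_t; rewrite divfK ?gt_eqF// ler_norml.
    by apply/andP; split; lra.
  have e2 : `|g (j.+1%:R / n.+1%:R) - g t| <= e / 3.
    apply: near_t; rewrite divfK ?gt_eqF// -natr1 ler_norml.
    by apply/andP; split; lra.
  have r01 : 0 <= ramp n.+1 j t <= 1.
    by rewrite /ramp le_min ler01 le_max lexx orbT ge_min lexx orbT.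
  move: e1 e2; set x := g (j%:R / _); set y := g (j.+1%:R / _) => e1 e2.
  have -> : x + ramp n.+1 j t *: (y - x) - g t =
    (x - g t) + ramp n.+1 j t *: ((y - g t) - (x - g t)).
    rewrite addrAC; congr (_ + _ *: _).
    by rewrite opprB addrA subrK.
  apply: le_trans (ler_normD _ _) _; rewrite normrZ.
  have := ler_normB (y - g t) (x - g t).
  move: r01 => /andP[r0 r1]; rewrite (ger0_norm r0).
  move: (`|_ - _ - (_ - _)|) (normr_ge0 (y - g t - (x - g t))) => z z0 hz.
  by have : ramp n.+1 j t * z <= z; [rewrite ler_piMl|lra].
have cf0 : cvgn (fun n => f n 0).
  by apply/cvg_ex; exists a; apply: cvg_near_cst; apply: nearW => n; have [] := hf n.
have fC n : C1on (f n) (G n) by have [] := hf n.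
have cf n : continuous (f n) by have [] := fC n.
have [F [cF uF _]] := ucauchy_ucvg cf (ucauchy_primitive fC (ucvg_ucauchy uG) cf0).
exists F; split; first exact: (ucvg_C1on hip fC cF cg uF uG).
apply: (cvgn_unique (ucvg_cvg uF (lexx 0))).
by apply: cvg_near_cst; apply: nearW => n; have [] := hf n.
Qed.

Lemma ucauchy_geometric (h : nat -> R -> H) :
  (forall T, exists C, forall k t, 0 <= t <= T ->
     `|h k.+1 t - h k t| <= C * 2^-1 ^+ k) -> ucauchy h.
Proof.
move=> hh T e e0; have [C hC] := hh T.
have h2 : (0 : R) <= 2^-1 by rewrite invr_ge0.
have C' : `|C| * 2 * 2^-1 ^+ k @[k --> \oo] --> (0 : R).
  rewrite -[X in _ --> X](mulr0 (`|C| * 2)); apply: cvgM; first exact: cvg_cst.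
  by apply: cvg_expr; rewrite ger0_norm// invf_lt1// ltr1n.
have /cvgrPdist_le/(_ _ e0) [N _ hN] := C'.
exists N => n Nn t tT.
apply: le_trans (hN _ (leqnn N)); rewrite /= sub0r normrN ger0_norm; last first.
  by rewrite !mulr_ge0// exprn_ge0.
have key j : `|h N t - h (N + j)%N t| <= `|C| * 2 * 2^-1 ^+ N * (1 - 2^-1 ^+ j).
  elim: j => [|j IH]; first by rewrite addn0 expr0 !subrr mulr0 normr0.
  have -> : h N t - h (N + j.+1)%N t =
      (h N t - h (N + j)%N t) - (h (N + j).+1 t - h (N + j)%N t).
    by rewrite opprB addrA subrK addnS.
  apply: le_trans (ler_normB _ _) _.
  have h3 : `|h (N + j).+1 t - h (N + j)%N t| <= `|C| * (2^-1 ^+ N * 2^-1 ^+ j).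
    apply: le_trans (hC _ _ tT) _; rewrite exprD ler_wpM2r ?mulr_ge0 ?exprn_ge0//.
    exact: ler_norm.
  rewrite exprS; move: IH h3; set p := 2^-1 ^+ N; set q := 2^-1 ^+ j => IH h3.
  have -> : `|C| * 2 * p * (1 - 2^-1 * q) = `|C| * 2 * p * (1 - q) + `|C| * (p * q).
    by field.
  by lra.
have := key (n - N)%N; rewrite subnKC// => /le_trans; apply.
rewrite -[X in _ <= X]mulr1; apply: ler_wpM2l.
  by rewrite !mulr_ge0// exprn_ge0.
by rewrite gerBl exprn_ge0.
Qed.

Section System.
Variables (G : R -> H -> H -> H) (L : R) (a b : H).
Hypothesis L0 : 0 <= L.
Hypothesis lipG : forall t u v u' v', 0 <= t ->
  `|G t u v - G t u' v'| <= L * (`|u - u'| + `|v - v'|).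
Hypothesis contG : forall u v : R -> H, continuous u -> continuous v ->
  continuous (fun t => G (rho t) (u t) (v t)).

(** Integrating the weight [expR (K * t)] gains a factor 1/K. Measured against this weight, a Picard
    step contracts by 1/2 on intervals of any length. *)
Lemma picard_step_bound (f f' : R -> H) (M K : R) T : C1on f f' -> f 0 = 0 ->
  0 <= M -> 2 <= K ->
  (forall t, 0 < t < T -> `|f' t| <= M * (K / 2) * expR (K * t)) ->
  forall t, 0 <= t <= T -> `|f t| <= M / 2 * expR (K * t).
Proof.
move=> [cf cf' df] f0 M0 K2 hf t /andP[t0 tT].
have dw s : is_derive s 1 (fun s => M / 2 * expR (K * s)) (M / 2 * (K * expR (K * s))).
  apply: is_derive_mull.
  have := is_derive1_comp (is_derive_expR (K * s)) (is_derive_mull K (is_derive_id s (1 : R))).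
  by rewrite mulr1 mulrC.
have cw : continuous (fun s => M / 2 * expR (K * s)).
  by move=> s; exact: is_derive_cvg (dw s).
have df' s : 0 < s < T -> is_derive s 1 f (f' s) by move=> /andP[s0 _]; exact: df.
have hf' s : 0 < s < T -> `|f' s| <= M / 2 * (K * expR (K * s)).
  move=> sT; apply: le_trans (hf _ sT) _; rewrite le_eqVlt; apply/orP; left.
  by apply/eqP; field.
have := norm_increment_le hip cf cw df' (fun s _ => dw s) hf' (lexx 0) t0 tT.
rewrite f0 subr0 mulr0 expR0 mulr1 => /le_trans; apply.
by rewrite gerBl divr_ge0.
Qed.

Lemma picard : exists u v, [/\ C1on u v,
  C1on v (fun t => G (rho t) (u t) (v t)), u 0 = a & v 0 = b].
Proof.
have /choice [I hI] : forall gc : {g : R -> H | continuous g},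
    exists f, C1on f (sval gc) /\ f 0 = 0.
  by move=> [g cg]; exact: primitive_exists.
pose step (p : {f : R -> H | continuous f} * {f : R -> H | continuous f}) :
  ((R -> H) * (R -> H)) :=
  (fun t => a + I p.2 t,
   fun t => b + I (exist _ _ (contG (svalP p.1) (svalP p.2))) t).
have cstep p : continuous (step p).1 /\ continuous (step p).2.
  have [[c1 _ _] _] := hI p.2.
  have [[c2 _ _] _] := hI (exist _ _ (contG (svalP p.1) (svalP p.2))).
  split=> t; apply: cvgD; [exact: cvg_cst|exact: c1|exact: cvg_cst|exact: c2].
have cc (x : H) : continuous (fun _ : R => x) by move=> t; exact: cvg_cst.
(* The iterates are carried together with their continuity, which is what the primitive operator [I]
   takes as input. *)
pose it := fix it k := if k is k'.+1 then
    (exist _ _ (proj1 (cstep (it k'))), exist _ _ (proj2 (cstep (it k'))))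
  else (exist _ _ (cc a), exist _ _ (cc b)) :
     {f : R -> H | continuous f} * {f : R -> H | continuous f}.
pose u k := sval (it k).1; pose v k := sval (it k).2.
pose Gk k t := G (rho t) (u k t) (v k t).
have cu k : continuous (u k) := svalP (it k).1.
have cv k : continuous (v k) := svalP (it k).2.
have cG k : continuous (Gk k) by exact: contG.
have du k : C1on (u k.+1) (v k) /\ u k.+1 0 = a.
  have [h0 e0] := hI (it k).2; split; last by rewrite /u /= e0 addr0.
  rewrite (_ : v k = fun t => 0 + v k t); first exact: (C1onD (C1on_cst a) h0).
  by apply/funext => t; rewrite add0r.
have dv k : C1on (v k.+1) (Gk k) /\ v k.+1 0 = b.
  have [h0 e0] := hI (exist _ _ (contG (svalP (it k).1) (svalP (it k).2))).
  split; last by rewrite /v /= e0 addr0.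
  rewrite (_ : Gk k = fun t => 0 + Gk k t); first exact: (C1onD (C1on_cst b) h0).
  by apply/funext => t; rewrite add0r.
(* Then K/2 is at least 1, as needed for the component whose derivative is the other one, and at
   least 2L, as needed for the component driven by [G], which is Lipschitz in two arguments. *)
pose K := 4 * L + 2.
have K2 : 2 <= K by rewrite lerDr mulr_ge0.
have K0 : 0 <= K by exact: le_trans K2.
have C1onB (f g f' g' : R -> H) : C1on f f' -> C1on g g' ->
    C1on (fun t => f t - g t) (fun t => f' t - g' t).
  move=> h1 h2; have hN : C1on (fun t => - g t) (fun t => - g' t).
    apply: (C1on_linear (a := 1)) h2; first by move=> ? ? ?; rewrite opprD scalerN.
    by move=> ?; rewrite normrN mul1r.
  exact: (C1onD h1 hN).
have bound T : exists C, forall k t, 0 <= t <= T ->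
    `|u k.+1 t - u k t| <= C * 2^-1 ^+ k * expR (K * t) /\
    `|v k.+1 t - v k t| <= C * 2^-1 ^+ k * expR (K * t).
  have cB (f g : R -> H) : continuous f -> continuous g -> continuous (fun t => f t - g t).
    by move=> h1 h2 t; apply: cvgB; [exact: h1|exact: h2].
  have [M1 M10 hM1] := bounded_segment T (cB _ _ (cu 1%N) (cu 0%N)).
  have [M2 M20 hM2] := bounded_segment T (cB _ _ (cv 1%N) (cv 0%N)).
  exists (M1 + M2); elim=> [|k IH] t tT.
    have e1 : 1 <= expR (K * t).
      by rewrite -expR0 ler_expR mulr_ge0//; have /andP[] := tT.
    have h1 : `|u 1%N t - u 0%N t| <= M1 := hM1 _ tT.
    have h2 : `|v 1%N t - v 0%N t| <= M2 := hM2 _ tT.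
    rewrite expr0 mulr1.
    have h3 : M1 + M2 <= (M1 + M2) * expR (K * t) by rewrite ler_peMr// addr_ge0.
    split; [apply: (le_trans h1)|apply: (le_trans h2)]; apply: le_trans h3.
      by rewrite lerDl.
    by rewrite lerDr.
  pose C := (M1 + M2) * 2^-1 ^+ k.
  have C0 : 0 <= C by rewrite mulr_ge0 ?addr_ge0// exprn_ge0// invr_ge0.
  have -> : (M1 + M2) * 2^-1 ^+ k.+1 = C / 2 by rewrite exprSr mulrA.
  have sub s : 0 < s < T -> 0 <= s <= T.
    by move=> /andP[/ltW -> /ltW ->].
  have [du2 e2] := du k.+1; have [du1 e1] := du k.
  have [dv2 e2'] := dv k.+1; have [dv1 e1'] := dv k.
  split.
    apply: (picard_step_bound (C1onB _ _ _ _ du2 du1) _ C0 K2 _ tT).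
      by rewrite e1 e2 subrr.
    move=> s sT; have [_ h2] := IH s (sub _ sT).
    apply: le_trans h2 _; rewrite -/C ler_wpM2r ?expR_ge0// ler_peMr//.
    by rewrite ler_pdivlMr// mul1r.
  apply: (picard_step_bound (C1onB _ _ _ _ dv2 dv1) _ C0 K2 _ tT).
    by rewrite e1' e2' subrr.
  move=> s sT; have [h1 h2] := IH s (sub _ sT).
  apply: le_trans (lipG _ _ _ _ (rho_ge0 s)) _.
  have e0 : 0 < expR (K * s) by exact: expR_gt0.
  move: h1 h2; rewrite -/C => h1 h2.
  apply: (@le_trans _ _ (L * (C * expR (K * s) + C * expR (K * s)))).
    by rewrite ler_wpM2l// lerD.
  have -> : L * (C * expR (K * s) + C * expR (K * s)) = C * (2 * L) * expR (K * s) by ring.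
  rewrite ler_wpM2r ?expR_ge0// ler_wpM2l// /K.
  by rewrite ler_pdivlMr//; lra.
have geo (h : nat -> R -> H) : (forall T, exists C, forall k t, 0 <= t <= T ->
    `|h k.+1 t - h k t| <= C * 2^-1 ^+ k * expR (K * t)) -> ucauchy h.
  move=> hh; apply: ucauchy_geometric => T; have [C hC] := hh T.
  exists (`|C| * expR (K * T)) => k t tT; apply: le_trans (hC _ _ tT) _.
  rewrite mulrAC; apply: ler_wpM2r; first by rewrite exprn_ge0// invr_ge0.
  apply: (@le_trans _ _ (`|C| * expR (K * t))).
    by rewrite ler_wpM2r ?expR_ge0// ler_norm.
  by rewrite ler_wpM2l// ler_expR ler_wpM2l//; have /andP[] := tT.
have [U [cU uU _]] : exists k, [/\ continuous k, ucvg u k & forall t, k t = k (rho t)].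
  apply: ucauchy_ucvg => //; apply: geo => T; have [C hC] := bound T.
  by exists C => k t tT; have [] := hC k t tT.
have [V [cV uV _]] : exists k, [/\ continuous k, ucvg v k & forall t, k t = k (rho t)].
  apply: ucauchy_ucvg => //; apply: geo => T; have [C hC] := bound T.
  by exists C => k t tT; have [] := hC k t tT.
have ushift (W : normedModType R) (h : nat -> R -> W) k : ucvg h k -> ucvg (fun n => h n.+1) k.
  move=> hk T e e0; have [N hN] := hk T e e0; exists N => n Nn t tT.
  by apply: hN => //; exact: leqW.
have uG : ucvg Gk (fun t => G (rho t) (U t) (V t)).
  move=> T e e0; have L1 : 0 < L + 1 by rewrite ltr_wpDl.
  have e1 : 0 < e / (L + 1) / 2 by rewrite !divr_gt0.
  have [N1 hN1] := uU T _ e1; have [N2 hN2] := uV T _ e1.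
  exists (maxn N1 N2) => n; rewrite geq_max => /andP[n1 n2] t tT.
  apply: le_trans (lipG _ _ _ _ (rho_ge0 t)) _.
  have h1 := hN1 _ n1 _ tT; have h2 := hN2 _ n2 _ tT.
  apply: (@le_trans _ _ (L * (e / (L + 1)))); first by rewrite ler_wpM2l//; lra.
  by rewrite mulrA ler_pdivrMr// mulrC ler_wpM2l ?(ltW e0)// lerDl.
exists U, V; split.
- apply: (ucvg_C1on hip (f := fun n => u n.+1) (g := v)) => //; last exact: ushift.
  by move=> n; have [] := du n.
- apply: (ucvg_C1on hip (f := fun n => v n.+1) (g := Gk)) => //; last exact: ushift.
    by move=> n; have [] := dv n.
  exact: contG.
- apply: (cvgn_unique (ucvg_cvg (ushift _ _ _ uU) (lexx 0))).
  by apply: cvg_near_cst; apply: nearW => n; have [] := du n.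
- apply: (cvgn_unique (ucvg_cvg (ushift _ _ _ uV) (lexx 0))).
  by apply: cvg_near_cst; apply: nearW => n; have [] := dv n.
Qed.

End System.
End Picard.

(** * The Lyapunov function *)

Section LyapunovAlgebra.
Context {R : realType}.
Variables (w c c1 eps nu mu : R).
Hypothesis w1 : 1 <= w.
Hypothesis nu0 : 0 < nu.
Hypothesis mu1 : 1 <= mu.
Hypothesis nuc : nu <= c.
Hypothesis cmu : c <= mu.
Hypothesis eps0 : 0 < eps.
Hypothesis eps8 : eps <= 8^-1.
Hypothesis epsnu : eps * (12 * mu) <= nu.
Hypothesis epsc1 : eps * w * `|c1| <= c / 2.

Let w0 : 0 < w. Proof. exact: lt_le_trans w1. Qed.
Let c0 : 0 < c. Proof. exact: lt_le_trans nuc. Qed.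
Let mu0 : 0 < mu. Proof. exact: lt_le_trans mu1. Qed.

Let nz := (gt_eqF c0, gt_eqF w0, gt_eqF mu0, gt_eqF nu0).

(** Here [k] is a squared velocity, [K2] the product of acceleration and velocity, [b] the product
    of velocity and force. Friction yields -2k/c, and the derivative of 1/c costs at most k/(2c) by
    [epsc1], whence 3/2. The same computation serves both energy levels. *)
Lemma energy_decay (k K2 b : R) : 0 <= k -> eps * K2 = - (k / w) - c * b ->
  w * (eps * (2 * K2 / c - k * (c1 / c ^+ 2)) + 2 * b) <= - (3 / 2 * (k / c)).
Proof.
move=> k0 e.
have -> : w * (eps * (2 * K2 / c - k * (c1 / c ^+ 2)) + 2 * b) =
    - (2 * (k / c)) - (eps * w * c1) * (k / c ^+ 2).
  have -> : w * (eps * (2 * K2 / c - k * (c1 / c ^+ 2)) + 2 * b) =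
    w * (2 * (eps * K2) / c - eps * k * (c1 / c ^+ 2) + 2 * b) by field; rewrite ?nz.
  by rewrite e; field; rewrite ?nz.
have h1 : - (eps * w * c1) <= c / 2.
  apply: le_trans epsc1; rewrite -mulrN ler_pM2l ?mulr_gt0//.
  by rewrite -normrN ler_norm.
have h2 : 0 <= k / c ^+ 2 by rewrite divr_ge0// sqr_ge0.
have h3 := ler_wpM2r h2 h1.
have e3 : c / 2 * (k / c ^+ 2) = 2^-1 * (k / c) by field; rewrite ?nz.
by move: h3; rewrite e3 mulNr; lra.
Qed.

Let ic : mu^-1 <= c^-1. Proof. by rewrite lef_pV2 ?posrE. Qed.

Let eps_nu : eps / nu <= (12 * mu)^-1.
Proof. by rewrite ler_pdivrMr// mulrC ler_pdivlMr ?mulr_gt0. Qed.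

(** Of the 3 w p dissipated by the mixed term, the derivative of w^2 takes 2. For w k the
    coefficients are -3/2 + 2/8 + 3/12 = -1, better than the -1/2 claimed; this is where the
    smallness of [eps] enters. *)
Lemma weighted_energy_decay (k p d : R) : 0 <= k -> 0 <= p ->
  w * d <= - (3 / 2 * (k / c)) ->
  2 * w * (eps * (k / c) + p) + w ^+ 2 * d + 3 / nu * (eps * w * k - w * c * p)
  <= - (w * p) - w * k / (2 * mu).
Proof.
move=> k0 p0 hd.
have h1 : w ^+ 2 * d <= w * (- (3 / 2 * (k / c))).
  by rewrite expr2 -mulrA ler_wpM2l// ltW.
have h2 : 3 / nu * (w * c * p) >= 3 * (w * p).
  have h : 0 <= w * p * (c - nu) by rewrite mulr_ge0 ?subr_ge0// mulr_ge0// ltW.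
  by rewrite mulrAC ler_pdivlMr//; lra.
have wk : 0 <= w * k by rewrite mulr_ge0// ltW.
have h3 : w * k / mu <= w * k / c by rewrite ler_wpM2l.
have hb : 0 <= w * k / mu by rewrite divr_ge0// ltW.
have h4 : eps * (w * k / c) <= 8^-1 * (w * k / c).
  by rewrite ler_wpM2r// divr_ge0// ltW.
have h5 : w * k * (eps / nu) <= w * k / (12 * mu) by rewrite ler_wpM2l.
have e5 : w * k / (12 * mu) = 12^-1 * (w * k / mu) by field; rewrite ?nz.
have e6 : w * k / (2 * mu) = 2^-1 * (w * k / mu) by field; rewrite ?nz.
have e7 : 2 * w * (eps * (k / c) + p) = 2 * (eps * (w * k / c)) + 2 * (w * p) by ring.
have e8 : w * (- (3 / 2 * (k / c))) = - (3 / 2 * (w * k / c)) by ring.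
have e9 : 3 / nu * (eps * w * k - w * c * p) =
  3 * (w * k * (eps / nu)) - 3 / nu * (w * c * p) by ring.
rewrite e5 in h5; rewrite e8 in h1; rewrite e6 e7 e9.
by lra.
Qed.

(** Of the 5 w^3 r dissipated by the mixed term, the derivative of w^4 takes 4. For w^3 q the
    coefficients are -3/2 + 4/8 + 5/12 = -7/12, below -1/2. The remainder [5 / nu * (w * p)] is left
    to the first level. *)
Lemma weighted_energy2_decay (q r p d : R) : 0 <= q -> 0 <= r -> 0 <= p ->
  w * d <= - (3 / 2 * (q / c)) ->
  4 * w ^+ 3 * (eps * (q / c) + r) + w ^+ 4 * d +
    5 / nu * (eps * w ^+ 3 * q - w ^+ 3 * c * r + (1 - 3 * eps) * w * p)
  <= - (w ^+ 3 * r) - w ^+ 3 * q / (2 * mu) + 5 / nu * (w * p).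
Proof.
move=> q0 r0 p0 hd; set v := w ^+ 3.
have v0 : 0 < v by rewrite exprn_gt0.
have h1 : w ^+ 4 * d <= v * (- (3 / 2 * (q / c))).
  by rewrite exprSr -mulrA ler_wpM2l// ltW.
have h2 : 5 / nu * (v * c * r) >= 5 * (v * r).
  have h : 0 <= v * r * (c - nu) by rewrite mulr_ge0 ?subr_ge0// mulr_ge0// ltW.
  by rewrite [X in _ <= X](_ : _ = 5 * (v * c * r) / nu) ?ler_pdivlMr//; [lra|ring].
have vq : 0 <= v * q by rewrite mulr_ge0// ltW.
have h3 : v * q / mu <= v * q / c by rewrite ler_wpM2l.
have hb : 0 <= v * q / mu by rewrite divr_ge0// ltW.
have h4 : eps * (v * q / c) <= 8^-1 * (v * q / c).
  by rewrite ler_wpM2r// divr_ge0// ltW.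
have h5 : v * q * (eps / nu) <= v * q / (12 * mu) by rewrite ler_wpM2l.
have h6 : 5 / nu * ((1 - 3 * eps) * w * p) <= 5 / nu * (w * p).
  rewrite ler_wpM2l ?divr_ge0 ?(ltW nu0)// -mulrA ler_piMl//.
    by rewrite mulr_ge0// ltW.
  by rewrite lerBlDr lerDl mulr_ge0// ltW.
have e5 : v * q / (12 * mu) = 12^-1 * (v * q / mu) by field; rewrite ?nz.
have e6 : v * q / (2 * mu) = 2^-1 * (v * q / mu) by field; rewrite ?nz.
have e7 : 4 * v * (eps * (q / c) + r) = 4 * (eps * (v * q / c)) + 4 * (v * r) by ring.
have e8 : v * (- (3 / 2 * (q / c))) = - (3 / 2 * (v * q / c)) by ring.
have e9 : 5 / nu * (eps * v * q - v * c * r + (1 - 3 * eps) * w * p) =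
  5 * (v * q * (eps / nu)) - 5 / nu * (v * c * r) + 5 / nu * ((1 - 3 * eps) * w * p).
  by ring.
rewrite e5 in h5; rewrite e8 in h1; rewrite e6 e7 e9.
by lra.
Qed.

Lemma weighted_energy_lower (k p n b : R) : 0 <= n ->
  (forall l, 0 <= k + 2 * l * b + l ^+ 2 * n) ->
  w ^+ 2 * p + 3 / nu * (n / 4) <=
  w ^+ 2 * (eps * (k / c) + p) + 3 / nu * (eps * w * b + (1 - eps) / 2 * n).
Proof.
(* With this [l] and the factor w^2 eps / (2c), the cross term of the square is exactly the mixed
   term, at the price of half the kinetic energy and a small multiple of [n]. *)
move=> n0 hk; have := hk (3 / nu * c / w); set l := 3 / nu * c / w => h.
have k0 : 0 <= k by have := hk 0; rewrite !(mulr0, mul0r, addr0, expr0n).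
have a0 : 0 <= w ^+ 2 * eps / (2 * c).
  by apply: divr_ge0; apply: ltW; rewrite mulr_gt0// exprn_gt0.
have {h} := mulr_ge0 a0 h.
have -> : w ^+ 2 * eps / (2 * c) * (k + 2 * l * b + l ^+ 2 * n) =
   2^-1 * (w ^+ 2 * (eps * (k / c))) + 3 / nu * (eps * w * b) +
   3 / nu * (eps / nu * (3 / 2 * c) * n).
  by rewrite /l; field; rewrite ?nz.
have h1 : eps / nu * (3 / 2 * c) <= 8^-1.
  apply: (@le_trans _ _ ((12 * mu)^-1 * (3 / 2 * mu))).
    by rewrite ler_pM ?divr_ge0 ?mulr_ge0 ?(ltW eps0) ?(ltW nu0) ?(ltW c0)// ler_wpM2l.
  by rewrite le_eqVlt; apply/orP; left; apply/eqP; field; rewrite ?nz.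
have h2 : 3 / nu * (eps / nu * (3 / 2 * c) * n) <= 3 / nu * (8^-1 * n).
  by rewrite ler_wpM2l ?divr_ge0 ?(ltW nu0)// ler_wpM2r.
have h3 : 0 <= w ^+ 2 * (eps * (k / c)).
  apply: mulr_ge0; first exact: sqr_ge0.
  by apply: mulr_ge0; [exact: ltW|exact: (divr_ge0 k0 (ltW c0))].
have nu3 : 0 <= 3 / nu by rewrite divr_ge0// ltW.
have h4 : 0 <= 3 / nu * n * (8^-1 - eps).
  by apply: mulr_ge0; rewrite ?subr_ge0//; apply: mulr_ge0.
have e4 : 3 / nu * n * (8^-1 - eps) = 3 / nu * (8^-1 * n) - 3 / nu * n * eps by ring.
have e1 : 3 / nu * (eps * w * b + (1 - eps) / 2 * n) =
  3 / nu * (eps * w * b) + 4 * (3 / nu * (8^-1 * n)) - 2^-1 * (3 / nu * n * eps) by field; rewrite ?nz.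
have e2 : 3 / nu * (n / 4) = 2 * (3 / nu * (8^-1 * n)) by field; rewrite ?nz.
have e3 : w ^+ 2 * (eps * (k / c) + p) = w ^+ 2 * (eps * (k / c)) + w ^+ 2 * p by ring.
rewrite e4 in h4; rewrite e1 e2 e3 => h.
have h5 : 0 <= 3 / nu * (8^-1 * n) by apply: mulr_ge0 => //; apply: mulr_ge0.
by lra.
Qed.

(** Unlike at the first level, half of the kinetic term is kept, since it bounds |A^(1/2) u'|; the
    term in [p] is spent entirely, as the first level already provides one. *)
Lemma weighted_energy2_lower (q r p b : R) : 0 <= p ->
  (forall l, 0 <= q + 2 * l * b + l ^+ 2 * p) ->
  w ^+ 4 * (eps * q / (2 * mu) + r) <=
  w ^+ 4 * (eps * (q / c) + r) + 5 / nu * (eps * w ^+ 3 * b + (1 - 3 * eps) / 2 * (w ^+ 2 * p)).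
Proof.
move=> p0 hq; have := hq (5 / nu * c / w); set l := 5 / nu * c / w => h.
have q0 : 0 <= q by have := hq 0; rewrite !(mulr0, mul0r, addr0, expr0n).
have a0 : 0 <= w ^+ 4 * eps / (2 * c).
  by apply: divr_ge0; apply: ltW; rewrite mulr_gt0// exprn_gt0.
have {h} := mulr_ge0 a0 h.
have -> : w ^+ 4 * eps / (2 * c) * (q + 2 * l * b + l ^+ 2 * p) =
   2^-1 * (w ^+ 4 * (eps * (q / c))) + 5 / nu * (eps * w ^+ 3 * b) +
   5 / nu * (eps / nu * (5 / 2 * c) * (w ^+ 2 * p)).
  by rewrite /l; field; rewrite ?nz.
have wp : 0 <= w ^+ 2 * p by rewrite mulr_ge0 ?sqr_ge0.
have h1 : eps / nu * (5 / 2 * c) <= 24^-1 * 5.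
  apply: (@le_trans _ _ ((12 * mu)^-1 * (5 / 2 * mu))).
    by rewrite ler_pM ?divr_ge0 ?mulr_ge0 ?(ltW eps0) ?(ltW nu0) ?(ltW c0)// ler_wpM2l.
  by rewrite le_eqVlt; apply/orP; left; apply/eqP; field; rewrite ?nz.
have h1' : eps / nu * (5 / 2 * c) <= (1 - 3 * eps) / 2 by move: eps8 h1; lra.
have h2 : 5 / nu * (eps / nu * (5 / 2 * c) * (w ^+ 2 * p)) <=
    5 / nu * ((1 - 3 * eps) / 2 * (w ^+ 2 * p)).
  by rewrite ler_wpM2l ?divr_ge0 ?(ltW nu0)// ler_wpM2r.
have h3 : w ^+ 4 * (eps * q) / mu <= w ^+ 4 * (eps * q) / c.
  apply: ler_wpM2l => //; apply: mulr_ge0; first by rewrite exprn_ge0// ltW.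
  by rewrite mulr_ge0// ltW.
have e1 : 5 / nu * (eps * w ^+ 3 * b + (1 - 3 * eps) / 2 * (w ^+ 2 * p)) =
  5 / nu * (eps * w ^+ 3 * b) + 5 / nu * ((1 - 3 * eps) / 2 * (w ^+ 2 * p)) by ring.
have e2 : w ^+ 4 * (eps * (q / c) + r) = w ^+ 4 * (eps * q) / c + w ^+ 4 * r by ring.
have e3 : w ^+ 4 * (eps * q / (2 * mu) + r) = 2^-1 * (w ^+ 4 * (eps * q) / mu) + w ^+ 4 * r.
  by field; rewrite ?nz.
have e4 : w ^+ 4 * (eps * (q / c)) = w ^+ 4 * (eps * q) / c by ring.
rewrite e1 e2 e3 e4 => h.
by lra.
Qed.

End LyapunovAlgebra.

Section DerivativeRules.
Context {R : realType}.
Implicit Types (t : R) (f g : R -> R) (a b : R).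

Lemma is_derive_add f g t a b : is_derive t 1 f a -> is_derive t 1 g b ->
  is_derive t 1 (fun s => f s + g s) (a + b).
Proof. by move=> hf hg; exact: (is_deriveD hf hg). Qed.

Lemma is_derive_mul f g t a b : is_derive t 1 f a -> is_derive t 1 g b ->
  is_derive t 1 (fun s => f s * g s) (f t * b + g t * a).
Proof. by move=> hf hg; exact: (is_deriveM hf hg). Qed.

Lemma is_derive_exp n f t a : is_derive t 1 f a ->
  is_derive t 1 (fun s => f s ^+ n) (n%:R * f t ^+ n.-1 * a).
Proof.
move=> hf; have := is_deriveX n hf; congr (is_derive _ _ _ _).
by apply/funext => s; elim: n => [|n IH] //; rewrite !exprS -IH.
Qed.

Lemma is_derive_inv f t a : f t != 0 -> is_derive t 1 f a ->
  is_derive t 1 (fun s => (f s)^-1) (- (a / f t ^+ 2)).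
Proof.
move=> f0 hf; have := is_deriveV f0 hf; rewrite /GRing.scale/=.
by congr (is_derive _ _ _ _); rewrite mulNr mulrC.
Qed.

Lemma is_derive_weight t : is_derive t 1 (fun s => 1 + s) 1.
Proof.
have := is_derive_add (is_derive_cst (1 : R) t (1 : R)) (is_derive_id t (1 : R)).
by rewrite add0r.
Qed.

End DerivativeRules.

(* The energy at each level of regularity is only dissipated after adding a
   multiple of the mixed term, and the weight of each level is chosen so that
   its dissipation absorbs the growth of the weight of the level above. *)
Definition lyap {R : realType} (eps nu c w n k p q r b1 b2 : R) : R :=
  w ^+ 4 * (eps * (q / c) + r) +
    5 / nu * (eps * w ^+ 3 * b2 + (1 - 3 * eps) / 2 * (w ^+ 2 * p)) +
  (5 / nu + 1) * (w ^+ 2 * (eps * (k / c) + p) +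
    3 / nu * (eps * w * b1 + (1 - eps) / 2 * n)).

(** * Lyapunov estimates for a linear equation with a bounded nonnegative operator *)

Section Lyapunov.
Context {R : realType} {H : completeNormedModType R} {ip : {dot H for idfun}}.
Hypothesis hip : induces_norm ip.
Variables (S : H -> H) (a : R).
Hypothesis linS : forall b x y, S (b *: x + y) = b *: S x + S y.
Hypothesis bdS : forall x, `|S x| <= a * `|x|.
Hypothesis symS : forall x y, ip (S x) y = ip x (S y).
Hypothesis posS : forall x, 0 <= ip (S x) x.
Variables (x x1 x2 : R -> H) (c c1 : R -> R) (eps nu mu T : R).
Hypothesis dx : C1on x x1.
Hypothesis dx1 : C1on x1 x2.
Hypothesis cc : continuous c.
Hypothesis dc : forall t, 0 < t < T -> is_derive t 1 c (c1 t).
Hypothesis eqx : forall t, 0 < t < T ->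
  eps *: x2 t + (1 + t)^-1 *: x1 t + c t *: S (x t) = 0.
Hypothesis nu0 : 0 < nu.
Hypothesis mu1 : 1 <= mu.
Hypothesis cnu : forall t, nu <= c t.
Hypothesis cmu : forall t, c t <= mu.
Hypothesis eps0 : 0 < eps.
Hypothesis eps8 : eps <= 8^-1.
Hypothesis epsnu : eps * (12 * mu) <= nu.
Hypothesis epsc1 : forall t, 0 < t < T -> eps * (1 + t) * `|c1 t| <= c t / 2.

Let n t := ip (x t) (x t).
Let k t := ip (x1 t) (x1 t).
Let p t := ip (S (x t)) (x t).
Let q t := ip (S (x1 t)) (x1 t).
Let r t := ip (S (x t)) (S (x t)).
Let b1 t := ip (x1 t) (x t).
Let b2 t := ip (x1 t) (S (x t)).
Let w (t : R) : R := 1 + t.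

Definition lyap_fun t := lyap eps nu (c t) (w t) (n t) (k t) (p t) (q t) (r t) (b1 t) (b2 t).

Definition lyap_rate t := w t ^+ 3 * (q t + r t) + w t * (k t + p t).

Let c0 t : 0 < c t. Proof. exact: lt_le_trans (cnu t). Qed.
Let mu0 : 0 < mu. Proof. exact: lt_le_trans mu1. Qed.
Let dSx : C1on (fun t => S (x t)) (fun t => S (x1 t)). Proof. exact: C1on_linear dx. Qed.
Let dSx1 : C1on (fun t => S (x1 t)) (fun t => S (x2 t)). Proof. exact: C1on_linear dx1. Qed.
Let cw : continuous w.
Proof. by move=> t; apply: cvgD; [exact: cvg_cst|exact: cvg_id]. Qed.

Let ip_continuous (f g : R -> H) : continuous f -> continuous g ->
  continuous (fun t => ip (f t) (g t)).
Proof. by move=> cf cg t; apply: (ip_cvg hip); [exact: cf|exact: cg]. Qed.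

Let cx : continuous x. Proof. by have [] := dx. Qed.
Let cx1 : continuous x1. Proof. by have [] := dx1. Qed.
Let cSx : continuous (fun t => S (x t)). Proof. by have [] := dSx. Qed.
Let cSx1 : continuous (fun t => S (x1 t)). Proof. by have [] := dSx1. Qed.
Let cn : continuous n. Proof. exact: ip_continuous. Qed.
Let ck : continuous k. Proof. exact: ip_continuous. Qed.
Let cp : continuous p. Proof. exact: ip_continuous. Qed.
Let cq : continuous q. Proof. exact: ip_continuous. Qed.
Let cr : continuous r. Proof. exact: ip_continuous. Qed.
Let cb1 : continuous b1. Proof. exact: ip_continuous. Qed.
Let cb2 : continuous b2. Proof. exact: ip_continuous. Qed.

Let n0 t : 0 <= n t. Proof. by rewrite /n -hip sqr_ge0. Qed.
Let k0 t : 0 <= k t. Proof. by rewrite /k -hip sqr_ge0. Qed.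
Let p0 t : 0 <= p t. Proof. exact: posS. Qed.
Let q0 t : 0 <= q t. Proof. exact: posS. Qed.
Let r0 t : 0 <= r t. Proof. by rewrite /r -hip sqr_ge0. Qed.

Lemma lyap_rate_continuous : continuous lyap_rate.
Proof.
move=> t; have ce m : w s ^+ m @[s --> t] --> w t ^+ m.
  apply: (@continuous_comp _ _ _ w (fun y : R => y ^+ m)); first exact: cw.
  exact: exprn_continuous.
by apply: cvgD; apply: cvgM; [exact: ce|apply: cvgD; [exact: cq|exact: cr]|
  exact: cw|apply: cvgD; [exact: ck|exact: cp]].
Qed.

Lemma lyap_fun_continuous : continuous lyap_fun.
Proof.
move=> t; have ce m : w s ^+ m @[s --> t] --> w t ^+ m.
  apply: (@continuous_comp _ _ _ w (fun y : R => y ^+ m)); first exact: cw.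
  exact: exprn_continuous.
have cV : (c s)^-1 @[s --> t] --> (c t)^-1 by apply: cvgV; [rewrite gt_eqF|exact: cc].
rewrite /lyap_fun /lyap.
apply: cvgD; [apply: cvgD|apply: cvgMr; apply: cvgD].
- apply: cvgM; [exact: ce|apply: cvgD; last exact: cr].
  by apply: cvgMr; apply: cvgM; [exact: cq|exact: cV].
- apply: cvgMr; apply: cvgD; first by apply: cvgM; [apply: cvgMr; exact: ce|exact: cb2].
  by apply: cvgMr; apply: cvgM; [exact: ce|exact: cp].
- apply: cvgM; [exact: ce|apply: cvgD; last exact: cp].
  by apply: cvgMr; apply: cvgM; [exact: ck|exact: cV].
- apply: cvgMr; apply: cvgD; last by apply: cvgMr; exact: cn.
  by apply: cvgM; [apply: cvgMr; exact: cw|exact: cb1].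
Qed.

Lemma lyap_lower t : 0 <= t ->
  w t ^+ 4 * (eps * q t / (2 * mu) + r t) + w t ^+ 2 * p t + 3 / nu * (n t / 4)
  <= lyap_fun t.
Proof.
move=> t0; have w1 : 1 <= w t by rewrite lerDl.
have hq l : 0 <= q t + 2 * l * b2 t + l ^+ 2 * p t.
  have := posS (l *: x t + x1 t); rewrite linS !ipDl !ipDr !ipZl !ipZr.
  by rewrite (symS (x1 t) (x t)) (ipC (S (x t)) (x1 t)) -/(q t) -/(p t) -/(b2 t); lra.
have hk l : 0 <= k t + 2 * l * b1 t + l ^+ 2 * n t.
  have := sqr_ge0 `|l *: x t + x1 t|; rewrite hip !ipDl !ipDr !ipZl !ipZr.
  by rewrite (ipC (x t) (x1 t)) -/(n t) -/(k t) -/(b1 t); lra.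
have h2 := weighted_energy2_lower w1 nu0 mu1 (cnu t) (cmu t) eps0 eps8 epsnu (r t) (p0 t) hq.
have h1 := weighted_energy_lower w1 nu0 mu1 (cnu t) (cmu t) eps0 eps8 epsnu (p t) (n0 t) hk.
rewrite /lyap_fun /lyap; set u1 := (X in (5 / nu + 1) * X); set u2 := (X in X + (5 / nu + 1) * u1).
rewrite -/u1 in h1; rewrite -/u2 in h2.
have h3 : 0 <= u1.
  apply: le_trans h1; apply: addr_ge0; first by rewrite mulr_ge0 ?sqr_ge0.
  by rewrite mulr_ge0// divr_ge0// ltW.
have h4 : 0 <= 5 / nu * u1 by rewrite mulr_ge0// divr_ge0// ltW.
by lra.
Qed.

Let isd_ip (f f' g g' : R -> H) (t : R) : C1on f f' -> C1on g g' -> 0 < t ->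
  is_derive t 1 (fun s => ip (f s) (g s)) (ip (f' t) (g t) + ip (f t) (g' t)).
Proof. by move=> [_ _ hf] [_ _ hg] t0; exact: is_derive_ip hip (hf _ t0) (hg _ t0). Qed.

Let eq_ip (t : R) v : 0 < t < T ->
  eps * ip (x2 t) v = - (ip (x1 t) v / w t) - c t * ip (S (x t)) v.
Proof.
move=> tT; have := congr1 (ip^~ v) (eqx tT).
by rewrite !ipDl !ipZl ip0l; lra.
Qed.

Lemma lyap_derive (t : R) : 0 < t < T -> exists2 d, is_derive t 1 lyap_fun d &
  d <= - (lyap_rate t / (2 * mu)).
Proof.
move=> tT; have /andP[t0 _] := tT; have w1 : 1 <= w t by rewrite lerDl ltW.
have w0 : 0 < w t by exact: lt_le_trans w1.
pose K2 := ip (x2 t) (x1 t); pose Q2 := ip (x2 t) (S (x1 t)).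
pose B2 := ip (x2 t) (x t); pose R2 := ip (x2 t) (S (x t)).
pose s := ip (x1 t) (S (S (x t))).
have dn : is_derive t 1 n (2 * b1 t).
  by have := isd_ip dx dx t0; rewrite (ipC (x t) (x1 t)) -/(b1 t) mulr_natl mulr2n.
have dk : is_derive t 1 k (2 * K2).
  by have := isd_ip dx1 dx1 t0; rewrite (ipC (x1 t) (x2 t)) -/K2 mulr_natl mulr2n.
have dp : is_derive t 1 p (2 * b2 t).
  have := isd_ip dSx dx t0.
  by rewrite symS (ipC (S (x t))) -/(b2 t) mulr_natl mulr2n.
have dq : is_derive t 1 q (2 * Q2).
  have := isd_ip dSx1 dx1 t0.
  by rewrite symS (ipC (S (x1 t))) -/Q2 mulr_natl mulr2n.
have dr : is_derive t 1 r (2 * s).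
  have := isd_ip dSx dSx t0.
  by rewrite symS (ipC (S (x t))) symS -/s mulr_natl mulr2n.
have db1 : is_derive t 1 b1 (B2 + k t) by exact: isd_ip dx1 dx t0.
have db2 : is_derive t 1 b2 (R2 + q t).
  by have := isd_ip dx1 dSx t0; rewrite (ipC (x1 t) (S (x1 t))).
have dw := is_derive_weight t : is_derive t 1 w 1.
have dV := is_derive_inv (lt0r_neq0 (c0 t)) (dc tT).
have eK := eq_ip (x1 t) tT; have eQ := eq_ip (S (x1 t)) tT.
have eB := eq_ip (x t) tT; have eR := eq_ip (S (x t)) tT.
rewrite -/K2 -/(k t) (ipC (S (x t))) -/(b2 t) in eK.
rewrite -/Q2 (ipC (x1 t) (S (x1 t))) -/(q t) -symS (ipC (S (S (x t)))) -/s in eQ.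
rewrite -/B2 -/(b1 t) -/(p t) in eB.
rewrite -/R2 -/(b2 t) -/(r t) in eR.
pose d1 := eps * (2 * K2 / c t - k t * (c1 t / c t ^+ 2)) + 2 * b2 t.
pose d2 := eps * (2 * Q2 / c t - q t * (c1 t / c t ^+ 2)) + 2 * s.
have hd1 : w t * d1 <= - (3 / 2 * (k t / c t)).
  by have := energy_decay w1 nu0 (cnu t) eps0 (epsc1 tT) (k0 t) eK.
have hd2 : w t * d2 <= - (3 / 2 * (q t / c t)).
  by have := energy_decay w1 nu0 (cnu t) eps0 (epsc1 tT) (q0 t) eQ.
have h1 := weighted_energy_decay w1 nu0 mu1 (cnu t) (cmu t) eps8 epsnu (k0 t) (p0 t) hd1.
have h2 := weighted_energy2_decay w1 nu0 mu1 (cnu t) (cmu t) eps0 eps8 epsnu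
  (q0 t) (r0 t) (p0 t) hd2.
set E1 := (X in X <= _) in h1; set E2 := (X in X <= _) in h2.
have dF (f g : R -> R) df dg : is_derive t 1 f df -> is_derive t 1 g dg ->
    is_derive t 1 (fun z => eps * (f z / c z) + g z)
      (eps * (f t * - (c1 t / c t ^+ 2) + (c t)^-1 * df) + dg).
  by move=> hf hg; apply: is_derive_add hg; apply: is_derive_mull; exact: is_derive_mul hf dV.
have D1 := is_derive_mul (is_derive_exp 4 dw) (dF _ _ _ _ dq dr).
have D2 := is_derive_mull (5 / nu) (is_derive_add
  (is_derive_mul (is_derive_mull eps (is_derive_exp 3 dw)) db2)
  (is_derive_mull ((1 - 3 * eps) / 2) (is_derive_mul (is_derive_exp 2 dw) dp))).
have D3 := is_derive_mull (5 / nu + 1) (is_derive_add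
  (is_derive_mul (is_derive_exp 2 dw) (dF _ _ _ _ dk dp))
  (is_derive_mull (3 / nu) (is_derive_add (is_derive_mul (is_derive_mull eps dw) db1)
    (is_derive_mull ((1 - eps) / 2) dn)))).
have D : is_derive t 1 lyap_fun _ := is_derive_add (is_derive_add D1 D2) D3.
exists (E2 + (5 / nu + 1) * E1).
  apply: (is_derive_eq D).
  (* The factors (1 - eps)/2 and (1 - 3 eps)/2 in [lyap] are chosen so that, once the equation is
     inserted, the terms in [b1] and w^2 [b2] cancel. *)
  have eB' : eps * w t * B2 = - b1 t - w t * c t * p t.
    rewrite mulrAC eB mulrBl mulNr divfK ?gt_eqF//; ring.
  have eR' : eps * w t ^+ 3 * R2 = - (w t ^+ 2 * b2 t) - w t ^+ 3 * c t * r t.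
    rewrite mulrAC eR; field; by rewrite gt_eqF.
  rewrite /E1 /E2 /d1 /d2 /=.
  have -> : eps * w t ^+ 3 * q t - w t ^+ 3 * c t * r t =
    eps * w t ^+ 3 * q t + eps * w t ^+ 3 * R2 + w t ^+ 2 * b2 t by rewrite eR'; ring.
  have -> : eps * w t * k t - w t * c t * p t =
    eps * w t * k t + eps * w t * B2 + b1 t by rewrite eB'; ring.
  by field; rewrite (gt_eqF nu0) (gt_eqF (c0 t)).
have nu5 : 0 <= 5 / nu by rewrite divr_ge0// ltW.
(* Of the 5/nu + 1 copies of the first level, 5/nu pay for the remainder of the second level and one
   is kept as dissipation. *)
have h3 := ler_wpM2l (addr_ge0 nu5 ler01) h1.
apply: (le_trans (lerD h2 h3)).
have wk : 0 <= w t * k t by rewrite mulr_ge0// ltW.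
have wp : 0 <= w t * p t by rewrite mulr_ge0// ltW.
have wr : 0 <= w t ^+ 3 * r t by rewrite mulr_ge0// exprn_ge0// ltW.
have i0 : 0 <= (2 * mu)^-1 by rewrite invr_ge0 mulr_ge0// ltW.
have i1 : (2 * mu)^-1 <= 1 by rewrite invf_le1 ?mulr_gt0//; move: mu1; lra.
have g1 : w t * p t * (2 * mu)^-1 <= w t * p t by rewrite ler_piMr.
have g2 : w t ^+ 3 * r t * (2 * mu)^-1 <= w t ^+ 3 * r t by rewrite ler_piMr.
have g3 : 0 <= 5 / nu * (w t * k t * (2 * mu)^-1) by rewrite mulr_ge0// mulr_ge0.
rewrite /lyap_rate.
by lra.
Qed.

Lemma lyapunov (J : R -> R) : C1on J lyap_rate -> J 0 = 0 ->
  forall t, 0 <= t <= T -> lyap_fun t + J t / (2 * mu) <= lyap_fun 0.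
Proof.
move=> [cJ _ dJ] J0 t /andP[t0 tT].
have /choice [d hd] : forall s, exists d, 0 < s < T ->
    is_derive s 1 lyap_fun d /\ d <= - (lyap_rate s / (2 * mu)).
  move=> s; have [sT|sT] := boolP (0 < s < T); last by exists 0.
  by have [d h1 h2] := lyap_derive sT; exists d.
have := @nonincreasing_of_derive _ (fun s => lyap_fun s + (2 * mu)^-1 * J s)
  (fun s => d s + (2 * mu)^-1 * lyap_rate s) 0 T _ _ _ 0 t (lexx 0) t0 tT.
rewrite J0 mulr0 addr0 [J t / _]mulrC; apply.
- move=> s; apply: cvgD; first exact: lyap_fun_continuous.
  by apply: cvgM; [exact: cvg_cst|exact: cJ].
- move=> s sT; have [h1 _] := hd _ sT; have /andP[s0 _] := sT.
  by apply: is_derive_add => //; apply: is_derive_mull; exact: dJ.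
- move=> s sT; have [_ h2] := hd _ sT.
  by rewrite addrC mulrC -lerBrDr sub0r lerNr.
Qed.

(** The unweighted energy bounds |A^(1/2) u|^2 by an explicit function of the data, against which
    the truncation level is set. *)
Lemma energy_nonincreasing t : 0 <= t <= T ->
  eps * (k t / c t) + p t <= eps * (k 0 / c 0) + p 0.
Proof.
move=> /andP[t0 tT].
have := @nonincreasing_of_derive _ (fun s => eps * (k s / c s) + p s)
  (fun s => eps * (k s * - (c1 s / c s ^+ 2) +
     (c s)^-1 * (2 * ip (x2 s) (x1 s))) + 2 * b2 s) 0 T _ _ _ 0 t (lexx 0) t0 tT.
apply.
- move=> s; apply: cvgD; last exact: cp.
  apply: cvgM; first exact: cvg_cst.
  by apply: cvgM; [exact: ck|apply: cvgV; [rewrite gt_eqF|exact: cc]].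
- move=> s sT; have /andP[s0 _] := sT.
  have dk : is_derive s 1 k (2 * ip (x2 s) (x1 s)).
    by have := isd_ip dx1 dx1 s0; rewrite (ipC (x1 s) (x2 s)) mulr_natl mulr2n.
  have dp : is_derive s 1 p (2 * b2 s).
    have := isd_ip dSx dx s0.
    by rewrite symS (ipC (S (x s))) -/(b2 s) mulr_natl mulr2n.
  apply: is_derive_add dp; apply: is_derive_mull.
  exact: is_derive_mul dk (is_derive_inv (lt0r_neq0 (c0 s)) (dc sT)).
- move=> s sT; have /andP[s0 _] := sT; have w1 : 1 <= w s by rewrite lerDl ltW.
  have eK := eq_ip (x1 s) sT; rewrite -/(k s) (ipC (S (x s))) -/(b2 s) in eK.
  have h := energy_decay w1 nu0 (cnu s) eps0 (epsc1 sT) (k0 s) eK.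
  rewrite -(@pmulr_rle0 _ (w s)); last exact: lt_le_trans w1.
  apply: (@le_trans _ _ (- (3 / 2 * (k s / c s)))); last first.
    by rewrite oppr_le0 mulr_ge0// divr_ge0// ltW.
  apply: le_trans h; rewrite le_eqVlt; apply/orP; left; apply/eqP; ring.
Qed.

(** A bound of the velocity without the factor eps. Where w^2 |x'|^2 exceeds [M], the friction
    dominates the force, which decays like w^-2, and w^2 |x'|^2 cannot increase. *)
Lemma velocity_decay M : k 0 <= M -> (forall t, 0 < t < T -> 2 * mu ^+ 2 * (w t ^+ 4 * r t) <= M) ->
  forall t, 0 <= t <= T -> w t ^+ 2 * k t <= M.
Proof.
move=> kM rM t tT; rewrite -subr_le0.
apply: (@le0_barrier _ (fun s => w s ^+ 2 * k s - M)
  (fun s => w s ^+ 2 * (2 * ip (x2 s) (x1 s)) + k s * (2 * w s ^+ 1 * 1)) T) => //.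
- move=> s; apply: cvgB; last exact: cvg_cst.
  apply: cvgM; last exact: ck.
  apply: (@continuous_comp _ _ _ w (fun y : R => y ^+ 2)); first exact: cw.
  exact: exprn_continuous.
- move=> s /andP[s0 _].
  have dk : is_derive s 1 k (2 * ip (x2 s) (x1 s)).
    by have := isd_ip dx1 dx1 s0; rewrite (ipC (x1 s) (x2 s)) mulr_natl mulr2n.
  have dw := is_derive_weight s : is_derive s 1 w 1.
  rewrite -[X in is_derive _ _ _ X]subr0; apply: is_deriveB.
  exact: is_derive_mul (is_derive_exp 2 dw) dk.
- move=> s sT; rewrite subr_gt0 => yM; have /andP[s0 _] := sT.
  have w1 : 1 <= w s by rewrite lerDl ltW.
  have w0 : 0 < w s by exact: lt_le_trans w1.
  have eK := eq_ip (x1 s) sT; rewrite -/(k s) (ipC (S (x s))) -/(b2 s) in eK.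
  (* Young's inequality for the power of the force. The coefficients of w k then add up to at most
     -4 + 2 + 1 + 1/2, from friction, force, Young and the derivative of w^2. *)
  have := sqr_ge0 `|(2 * w s * c s) *: S (x s) + x1 s|.
  rewrite hip !ipDl !ipDr !ipZl !ipZr (ipC (S (x s)) (x1 s)) -/(r s) -/(k s) -/(b2 s) => h.
  rewrite -(@pmulr_rle0 _ (2 * eps)) ?mulr_gt0//.
  have -> : 2 * eps * (w s ^+ 2 * (2 * ip (x2 s) (x1 s)) + k s * (2 * w s ^+ 1 * 1)) =
    4 * w s ^+ 2 * (eps * ip (x2 s) (x1 s)) + 4 * eps * w s * k s by ring.
  rewrite eK.
  have -> : 4 * w s ^+ 2 * (- (k s / w s) - c s * b2 s) + 4 * eps * w s * k s =
     - 4 * (w s * k s) - 4 * w s ^+ 2 * c s * b2 s + 4 * eps * w s * k s.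
    by field; rewrite gt_eqF.
  have h' := mulr_ge0 (ltW w0) h.
  have g1 : eps * (w s * k s) <= 8^-1 * (w s * k s).
    by rewrite ler_wpM2r// mulr_ge0// ltW.
  have g2 : w s ^+ 3 * c s ^+ 2 * r s <= w s ^+ 3 * mu ^+ 2 * r s.
    apply: ler_wpM2r => //; apply: ler_wpM2l; first by rewrite exprn_ge0// ltW.
    by rewrite lerXn2r ?nnegrE ?(ltW (c0 s)) ?(ltW mu0).
  have g3 : 2 * (w s ^+ 3 * mu ^+ 2 * r s) <= w s * k s.
    rewrite -(@ler_pM2l _ (w s))//.
    have := le_trans (rM _ sT) (ltW yM).
    have -> : 2 * mu ^+ 2 * (w s ^+ 4 * r s) = w s * (2 * (w s ^+ 3 * mu ^+ 2 * r s)) by ring.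
    by have -> : w s ^+ 2 * k s = w s * (w s * k s) by ring.
  have e : w s * (2 * w s * c s * (2 * w s * c s * r s) + 2 * w s * c s * b2 s +
    (2 * w s * c s * b2 s + k s)) =
    4 * (w s ^+ 3 * c s ^+ 2 * r s) + 4 * w s ^+ 2 * c s * b2 s + w s * k s by ring.
  have h'' : 0 <= 4 * (w s ^+ 3 * c s ^+ 2 * r s) + 4 * w s ^+ 2 * c s * b2 s + w s * k s.
    by rewrite -e; apply: le_trans h' _; rewrite le_eqVlt; apply/orP; left; apply/eqP; ring.
  have wk : 0 <= w s * k s by rewrite mulr_ge0// ltW.
  by lra.
- by rewrite subr_le0 /w addr0 expr1n mul1r.
Qed.

End Lyapunov.

Section CoefficientExtension.
Context {R : realType}.
Implicit Types (s t : R).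

Lemma eq_of_derive (f g f' : R -> R) : C1on f f' -> C1on g f' -> f 0 = g 0 ->
  forall t, 0 <= t -> f t = g t.
Proof.
move=> [cf _ df] [cg _ dg] fg0 t t0.
have le (p q : R -> R) : continuous p -> continuous q ->
    (forall s, 0 < s -> is_derive s 1 p (f' s)) ->
    (forall s, 0 < s -> is_derive s 1 q (f' s)) -> p 0 = q 0 -> p t <= q t.
  move=> cp cq dp dq e.
  have := @nonincreasing_of_derive _ (fun s => p s - q s) (fun s => f' s - f' s) 0 t
    _ _ _ 0 t (lexx 0) t0 (lexx t).
  rewrite e subrr subr_le0; apply.
  - by move=> s; apply: cvgB; [exact: cp|exact: cq].
  - by move=> s /andP[s0 _]; exact: (is_deriveB (dp _ s0) (dq _ s0)).
  - by move=> s _; rewrite subrr.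
by apply/eqP; rewrite eq_le !le.
Qed.

(** The argument |A^(1/2) u|^2 of the coefficient may vanish, and the chain rule needs a two-sided
    derivative there. The continuous [h1] is integrated instead, from -1, by a unit shift, since
    primitives in the sense of [C1on] are differentiated at positive points only. *)
Lemma C1on_extension (h h1 : R -> R) : C1on h h1 -> exists mt : R -> R,
  (forall s, -1 < s -> is_derive s 1 mt (h1 s)) /\ forall s, 0 <= s -> mt s = h s.
Proof.
move=> [ch ch1 dh].
have cs : continuous (fun s : R => h1 (s - 1)).
  move=> s; apply: (@continuous_comp _ _ _ (fun s : R => s - 1) h1); last exact: ch1.
  by apply: cvgB; [exact: cvg_id|exact: cvg_cst].
have [Q [cQ _ dQ] Q0] := scalar_primitive cs.
pose mt s := Q (s + 1) - Q 1 + h 0.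
have dm s : -1 < s -> is_derive s 1 mt (h1 s).
  move=> s1; have s0 : 0 < s + 1 by rewrite -ltrBlDr sub0r.
  have di : is_derive s 1 (fun s : R => s + 1) (1 + 0).
    exact: is_derive_add (is_derive_id s (1 : R)) (is_derive_cst (1 : R) s (1 : R)).
  have dQs : is_derive s 1 (fun s => Q (s + 1)) (h1 (s + 1 - 1) * (1 + 0)).
    exact: (@is_derive1_comp _ Q (fun s : R => s + 1) s _ _ (dQ _ s0) di).
  have := is_derive_add (is_derive_add dQs
    (is_derive_cst (- Q 1) s (1 : R))) (is_derive_cst (h 0) s (1 : R)).
  by rewrite addrK !addr0 mulr1.
exists mt; split => // s s0; apply: (@eq_of_derive mt h h1) => //; last first.
  by rewrite /mt add0r subrr add0r.
split => //; last by move=> r r0; apply: dm; exact: lt_trans r0.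
move=> r; apply: cvgD; last exact: cvg_cst.
apply: cvgB; last exact: cvg_cst.
apply: (@continuous_comp _ _ _ (fun s : R => s + 1) Q); last exact: cQ.
by apply: cvgD; [exact: cvg_id|exact: cvg_cst].
Qed.

Lemma lipschitz_of_derive (f f' : R -> R) (L N : R) :
  (forall s, -1 < s -> is_derive s 1 f (f' s)) ->
  (forall s, 0 <= s <= N -> `|f' s| <= L) ->
  forall s t, 0 <= s <= N -> 0 <= t <= N -> `|f s - f t| <= L * `|s - t|.
Proof.
move=> df fL.
have main s t : 0 <= s -> s <= t -> t <= N -> `|f t - f s| <= L * (t - s).
  move=> s0 st tN.
  have [->|sneqt] := eqVneq s t; first by rewrite !subrr mulr0 normr0.
  have lst : s < t by rewrite lt_neqAle sneqt.
  have [||c + e] := @MVT R f f' s t lst.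
  - move=> x; rewrite in_itv /= => /andP[sx _]; apply: df.
    by apply: lt_trans sx; apply: lt_le_trans s0.
  - apply: derivable_within_continuous => x; rewrite in_itv /= => /andP[sx _].
    by have [] := df x (lt_le_trans (lt_le_trans (ltrN10 R) s0) sx).
  rewrite in_itv /= => /andP[sc ct]; rewrite e normrM [`|t - s|]ger0_norm ?subr_ge0//.
  rewrite ler_wpM2r ?subr_ge0// fL// (le_trans s0 (ltW sc))/=.
  exact: le_trans (ltW ct) tN.
move=> s t /andP[s0 sN] /andP[t0 tN]; have [st|ts] := leP s t.
  by rewrite distrC [`|s - t|]distrC [X in _ <= _ * X]ger0_norm ?subr_ge0// main.
by rewrite [X in _ <= _ * X]ger0_norm ?subr_ge0 ?(ltW ts)// main// ltW.
Qed.

End CoefficientExtension.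

(** * Strong solutions and their continuous dependence on the data *)

Section Stability.
Context {R : realType} {H : completeNormedModType R} {ip : {dot H for idfun}}.
Hypothesis hip : induces_norm ip.
Implicit Types (s t : R).
Variables (A B : @operator R H) (P : nat -> H -> H).
Hypothesis cut : cutoffs ip A B P.
Variables (mt m1 : R -> R) (eps : R).
Hypothesis dmt : forall s : R, -1 < s -> is_derive s 1 mt (m1 s).
Hypothesis eps0 : 0 < eps.

(** The functions are continuous on the whole line but solve the equation at positive times only; at
    time 0 it is recovered by continuity. *)
Record strong_sol (u u1 u2 : R -> H) : Prop := StrongSol {
  sol_C1 : C1on u u1 ;
  sol_C2 : C1on u1 u2 ;
  sol_domA : forall t, dom A (u t) ;
  sol_domB : forall t, dom B (u1 t) ;
  sol_B : C1on (fun t => B (u t)) (fun t => B (u1 t)) ;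
  sol_A : continuous (fun t => A (u t)) ;
  sol_eq : forall t, 0 < t ->
    eps *: u2 t + (1 + t)^-1 *: u1 t + mt (`|B (u t)| ^+ 2) *: A (u t) = 0 }.

Lemma op_linearB (O : @operator R H) x y : op_linear O -> dom O x -> dom O y ->
  dom O (x - y) /\ O (x - y) = O x - O y.
Proof.
move=> lO dx dy; have [] := lO (-1) y x dy dx.
by rewrite !scaleN1r addrC [- O y + _]addrC.
Qed.

Lemma op_linearZ (O : @operator R H) (a : R) x : op_linear O -> dom O x ->
  dom O (a *: x) /\ O (a *: x) = a *: O x.
Proof.
move=> lO dx; have [d0 e0] := op_linearB lO dx dx.
rewrite !subrr in d0 e0.
by have [] := lO a x 0 dx d0; rewrite e0 !addr0.
Qed.

Lemma sol_coefficient u u1 u2 t : strong_sol u u1 u2 -> 0 < t ->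
  is_derive t 1 (fun s => mt (`|B (u s)| ^+ 2))
    (m1 (`|B (u t)| ^+ 2) * (2 * ip (A (u t)) (u1 t))).
Proof.
move=> [_ _ dA dB [_ _ dBu] _ _] t0.
have hs : is_derive t 1 (fun s => `|B (u s)| ^+ 2) (2 * ip (A (u t)) (u1 t)).
  have := is_derive_ip hip (dBu _ t0) (dBu _ t0).
  rewrite (ipC (B (u1 t))) (cut_ipAB cut (dA t) (dB t)) mulr_natl mulr2n.
  by congr (is_derive _ _ _ _); apply/funext => s; rewrite hip.
have s1 : -1 < `|B (u t)| ^+ 2 by apply: lt_le_trans (sqr_ge0 _); exact: ltrN10.
exact: (@is_derive1_comp _ mt (fun s => `|B (u s)| ^+ 2) t _ _ (dmt s1) hs).
Qed.

Lemma mt_continuous_norm (f : R -> H) : continuous f ->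
  continuous (fun t => mt (`|f t| ^+ 2)).
Proof.
move=> cf t; apply: (@continuous_comp _ _ _ (fun t => `|f t| ^+ 2) mt).
  by apply: cvg_normsq; exact: cf.
apply: is_derive_cvg; apply: dmt.
by apply: lt_le_trans (sqr_ge0 _); exact: ltrN10.
Qed.

(** Energy estimate for the difference at the level of A^(1/2). The main force term cancels against
    the derivative of the potential part of [E]; the difference of the coefficients is made to
    multiply [A (v t)], which is bounded by [a]. It gives both uniqueness and convergence of the
    approximations. *)
Lemma stability (u u1 u2 v v1 v2 : R -> H) (nu L N a G T : R) :
  strong_sol u u1 u2 -> strong_sol v v1 v2 ->
  0 < nu -> (forall s, 0 <= s -> nu <= mt s) -> 0 <= L ->
  (forall s t, 0 <= s <= N ^+ 2 -> 0 <= t <= N ^+ 2 -> `|mt s - mt t| <= L * `|s - t|) ->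
  0 <= N -> 0 <= a -> 0 <= G ->
  (forall t, 0 <= t <= T -> `|B (u t)| <= N) ->
  (forall t, 0 <= t <= T -> `|B (v t)| <= N) ->
  (forall t, 0 <= t <= T -> `|A (v t)| <= a) ->
  (forall t, 0 < t < T -> `|m1 (`|B (u t)| ^+ 2) * (2 * ip (A (u t)) (u1 t))| <= G) ->
  let E t := eps * `|u1 t - v1 t| ^+ 2 + mt (`|B (u t)| ^+ 2) * `|B (u t) - B (v t)| ^+ 2 in
  forall t, 0 <= t <= T ->
    E t <= E 0 * expR ((2 * L * N * a * (nu^-1 + eps^-1) + G / nu) * t).
Proof.
move=> su sv nu0 hnu L0 hL N0 a0 G0 hBu hBv hAv hG E.
set Gam := (_ + _ / nu).
have [Cu Cu1 dAu dBu CBu cAu eu] := su; have [Cv Cv1 dAv dBv CBv cAv ev] := sv.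
have [cu cu1 du] := Cu; have [_ cu2 du1] := Cu1.
have [cv cv1 dv] := Cv; have [_ cv2 dv1] := Cv1.
have [cBu cBu1 dBu'] := CBu; have [cBv cBv1 dBv'] := CBv.
pose c s := mt (`|B (u s)| ^+ 2); pose c' s := m1 (`|B (u s)| ^+ 2) * (2 * ip (A (u s)) (u1 s)).
pose z1 s := u1 s - v1 s; pose bz s := B (u s) - B (v s).
pose E' s := eps * (ip (u2 s - v2 s) (z1 s) + ip (z1 s) (u2 s - v2 s)) +
  (c s * (ip (B (u1 s) - B (v1 s)) (bz s) + ip (bz s) (B (u1 s) - B (v1 s))) +
   ip (bz s) (bz s) * c' s).
have EE : E = fun s => eps * ip (z1 s) (z1 s) + c s * ip (bz s) (bz s).
  by apply/funext => s; rewrite -!hip.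
have cz1 : continuous z1 by move=> s; apply: cvgB; [exact: cu1|exact: cv1].
have cbz : continuous bz by move=> s; apply: cvgB; [exact: cBu|exact: cBv].
apply: (@gronwall _ E E' Gam T).
- rewrite EE => s; apply: cvgD.
    apply: cvgM; first exact: cvg_cst.
    by apply: (ip_cvg hip); exact: cz1.
  apply: cvgM; first exact: mt_continuous_norm.
  by apply: (ip_cvg hip); exact: cbz.
- rewrite EE => s /andP[s0 _].
  have d1 := is_deriveB (du1 _ s0) (dv1 _ s0).
  have d2 := is_deriveB (dBu' _ s0) (dBv' _ s0).
  have d3 := is_derive_mull eps (is_derive_ip hip d1 d1).
  have d4 := is_derive_mul (sol_coefficient su s0) (is_derive_ip hip d2 d2).
  exact: is_derive_add d3 d4.
- move=> s sT; have /andP[s0 /ltW s1] := sT; have sT' : 0 <= s <= T by rewrite ltW.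
  have w0 : 0 < 1 + s by rewrite addr_gt0.
  have [dAz eAz] := op_linearB (cut_linA cut) (dAu s) (dAv s).
  have [dBz eBz] := op_linearB (cut_linB cut) (cut_domAB cut (dAu s)) (cut_domAB cut (dAv s)).
  have [dBz1 eBz1] := op_linearB (cut_linB cut) (dBu s) (dBv s).
  have eip : ip (bz s) (B (u1 s) - B (v1 s)) = ip (A (u s)) (z1 s) - ip (A (v s)) (z1 s).
    by rewrite /bz -eBz -eBz1 (cut_ipAB cut dAz dBz1) eAz ipBl.
  pose cv' := mt (`|B (v s)| ^+ 2).
  have eq1 := congr1 (ip^~ (z1 s)) (eu _ s0); have eq2 := congr1 (ip^~ (z1 s)) (ev _ s0).
  rewrite !ipDl !ipZl ip0l -/(c s) in eq1; rewrite !ipDl !ipZl ip0l -/cv' in eq2.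
  have hz : eps * ip (u2 s - v2 s) (z1 s) = - ((1 + s)^-1 * `|z1 s| ^+ 2) -
     c s * ip (A (u s)) (z1 s) + cv' * ip (A (v s)) (z1 s).
    have e1 : `|z1 s| ^+ 2 = ip (u1 s) (z1 s) - ip (v1 s) (z1 s) by rewrite hip -ipBl.
    by rewrite e1 ipBl; move: eq1 eq2; lra.
  have -> : E' s = - (2 * ((1 + s)^-1 * `|z1 s| ^+ 2)) - 2 * ((c s - cv') * ip (A (v s)) (z1 s))
      + `|bz s| ^+ 2 * c' s.
    rewrite /E' (ipC (z1 s)) (ipC (_ - _) (bz s)) eip -hip mulrDr hz; ring.
  have h1 : `|c s - cv'| <= L * (2 * N * `|bz s|).
    have b2 x : `|x : H| <= N -> 0 <= `|x| ^+ 2 <= N ^+ 2.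
      by move=> xN; rewrite sqr_ge0 lerXn2r ?nnegrE.
    apply: le_trans (hL _ _ (b2 _ (hBu _ sT')) (b2 _ (hBv _ sT'))) _.
    rewrite ler_wpM2l// subr_sqr normrM mulrC ler_pM//.
      rewrite ger0_norm ?addr_ge0//; have := hBu _ sT'; have := hBv _ sT'; lra.
    exact: ler_dist_dist.
  have h2 : `|ip (A (v s)) (z1 s)| <= a * `|z1 s|.
    by apply: le_trans (ler_ip hip _ _) _; rewrite ler_wpM2r// hAv.
  have h3 : - ((c s - cv') * ip (A (v s)) (z1 s)) <= L * (2 * N * `|bz s|) * (a * `|z1 s|).
    by apply: le_trans (ler_norm _) _; rewrite normrN normrM ler_pM.
  have h4 : `|bz s| ^+ 2 * c' s <= `|bz s| ^+ 2 * G.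
    by rewrite ler_wpM2l ?sqr_ge0// (le_trans (ler_norm _))// hG.
  have h5 : 0 <= (1 + s)^-1 * `|z1 s| ^+ 2 by rewrite mulr_ge0 ?sqr_ge0// invr_ge0 ltW.
  have h6 : 0 <= L * N * a * (`|bz s| - `|z1 s|) ^+ 2.
    by apply: mulr_ge0; [rewrite !mulr_ge0|exact: sqr_ge0].
  have hc : nu <= c s by apply: hnu; exact: sqr_ge0.
  have h7 : `|bz s| ^+ 2 <= nu^-1 * E s.
    rewrite mulrC ler_pdivlMr// mulrC; apply: (@le_trans _ _ (c s * `|bz s| ^+ 2)).
      by rewrite ler_wpM2r ?sqr_ge0.
    by rewrite /E lerDr mulr_ge0 ?sqr_ge0// ltW.
  have h8 : `|z1 s| ^+ 2 <= eps^-1 * E s.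
    rewrite mulrC ler_pdivlMr// mulrC /E lerDl mulr_ge0 ?sqr_ge0//.
    by rewrite (le_trans (ltW nu0)).
  have LNa : 0 <= 2 * L * N * a by rewrite !mulr_ge0.
  have h9 := ler_wpM2l LNa (lerD h7 h8).
  have h10 := ler_wpM2l G0 h7.
  have -> : Gam * E s = 2 * L * N * a * (nu^-1 * E s + eps^-1 * E s) + G * (nu^-1 * E s).
    by rewrite /Gam; ring.
  by move: h3 h4 h5 h6 h9 h10; lra.
Qed.

End Stability.

(** * Galerkin approximation *)

Section Galerkin.
Context {R : realType} {H : completeNormedModType R} {ip : {dot H for idfun}}.
Hypothesis hip : induces_norm ip.
Implicit Types (s t : R) (n j : nat).
Variables (A B : @operator R H) (P : nat -> H -> H).
Hypothesis cut : cutoffs ip A B P.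

Definition cutA n x := A (P n x).

Lemma cutA_lin n (b : R) x y : cutA n (b *: x + y) = b *: cutA n x + cutA n y.
Proof.
rewrite /cutA (cut_lin cut).
by have [] := cut_linA cut b (cut_domA cut n x) (cut_domA cut n y).
Qed.

Lemma cut_domBP n x : dom B (P n x).
Proof. by have := cut_domAB cut (cut_domA cut n x). Qed.

Lemma cutA_ip n x y : ip (cutA n x) y = ip (B (P n x)) (B (P n y)).
Proof.
rewrite /cutA -{1}(cut_idem cut) (cut_A cut n (cut_domA cut n x)) (cut_sym cut).
by rewrite (cut_ipAB cut (cut_domA cut n x) (cut_domBP n y)).
Qed.

Lemma cutA_sym n x y : ip (cutA n x) y = ip x (cutA n y).
Proof. by rewrite (ipC x) !cutA_ip ipC. Qed.

Lemma cutA_pos n x : 0 <= ip (cutA n x) x.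
Proof. by rewrite cutA_ip -hip sqr_ge0. Qed.

Lemma cutA_bd n x : `|cutA n x| <= n%:R * `|x|.
Proof. exact: (cut_bdA cut n x). Qed.

Lemma cutB_lin n (b : R) x y : B (P n (b *: x + y)) = b *: B (P n x) + B (P n y).
Proof.
rewrite (cut_lin cut).
by have [] := cut_linB cut b (cut_domBP n x) (cut_domBP n y).
Qed.

(** The natural bound is the square root of [n]; the cruder n+1 avoids roots. *)
Lemma cutB_bd n x : `|B (P n x)| <= n.+1%:R * `|x|.
Proof.
rewrite -(@ler_pXn2r _ 2%N)// ?nnegrE ?mulr_ge0// hip -cutA_ip.
apply: le_trans (ler_norm _) _; apply: le_trans (ler_ip hip _ _) _.
apply: (@le_trans _ _ (n%:R * `|x| ^+ 2)).
  by rewrite expr2 mulrA ler_wpM2r// cutA_bd.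
rewrite exprMn ler_wpM2r ?sqr_ge0// -natrX ler_nat.
by rewrite (leq_trans (leqnSn n))// -mulnn leq_pmulr.
Qed.

Lemma cutA_le_cutB n x : `|cutA n x| <= n.+1%:R * `|B (P n x)|.
Proof.
have [->|h] := eqVneq (cutA n x) 0; first by rewrite normr0 mulr_ge0.
rewrite -(@ler_pM2r _ `|cutA n x|) ?normr_gt0// -expr2 hip cutA_ip.
apply: le_trans (ler_norm _) _; apply: le_trans (ler_ip hip _ _) _.
by rewrite mulrC mulrAC ler_wpM2r// cutB_bd.
Qed.

Lemma cutB_lin_sub n x y : B (P n x) - B (P n y) = B (P n (x - y)).
Proof. by rewrite [x - y]addrC -(scaleN1r y) cutB_lin scaleN1r addrC. Qed.

Lemma cutA_lin_sub n x y : cutA n x - cutA n y = cutA n (x - y).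
Proof. by rewrite [x - y]addrC -(scaleN1r y) cutA_lin scaleN1r addrC. Qed.

Lemma cut_lin_sub n x y : P n x - P n y = P n (x - y).
Proof. by rewrite [x - y]addrC -(scaleN1r y) (cut_lin cut) scaleN1r addrC. Qed.

Variables (mt m1 : R -> R) (eps nu mu L N : R).
Hypothesis dmt : forall s, -1 < s -> is_derive s 1 mt (m1 s).
Hypothesis nu0 : 0 < nu.
Hypothesis mtnu : forall s, 0 <= s -> nu <= mt s.
Hypothesis mu1 : 1 <= mu.
Hypothesis mtmu : forall s, 0 <= s <= N ^+ 2 -> mt s <= mu.
Hypothesis L0 : 0 <= L.
Hypothesis m1L : forall s, 0 <= s <= N ^+ 2 -> `|m1 s| <= L.
Hypothesis N0 : 0 < N.
Hypothesis eps0 : 0 < eps.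

Definition trunc s := Num.min s (N ^+ 2).

Lemma trunc_itv s : 0 <= s -> 0 <= trunc s <= N ^+ 2.
Proof.
by move=> s0; rewrite /trunc le_min s0 sqr_ge0 ge_min lexx orbT.
Qed.

Lemma mt_trunc_bd s : 0 <= s -> 0 <= mt (trunc s) <= mu.
Proof.
move=> /trunc_itv h; rewrite mtmu// andbT.
by have /andP[h0 _] := h; rewrite (le_trans (ltW nu0))// mtnu.
Qed.

(** Without truncation the product would be Lipschitz only locally. The difference of coefficients
    multiplies the vector with the smaller norm: if that norm is at least [N] both coefficients
    agree, otherwise [cutA n u] is at most (n+1) N by [cutA_le_cutB]. *)
Lemma trunc_lipschitz n u v : `|B (P n u)| <= `|B (P n v)| ->
  `|mt (trunc (`|B (P n u)| ^+ 2)) *: cutA n u - mt (trunc (`|B (P n v)| ^+ 2)) *: cutA n v|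
  <= (mu * n%:R + 2 * L * N ^+ 2 * n.+1%:R ^+ 2) * `|u - v|.
Proof.
set b := `|B (P n u)|; set d := `|B (P n v)| => bd.
have b0 : 0 <= b by exact: normr_ge0.
have d0 : 0 <= d by exact: normr_ge0.
have /andP[cv0 cv1] := mt_trunc_bd (sqr_ge0 d).
have -> : mt (trunc (b ^+ 2)) *: cutA n u - mt (trunc (d ^+ 2)) *: cutA n v =
   mt (trunc (d ^+ 2)) *: (cutA n u - cutA n v) +
   (mt (trunc (b ^+ 2)) - mt (trunc (d ^+ 2))) *: cutA n u.
  by rewrite scalerBr scalerBl [RHS]addrC addrA subrK.
apply: le_trans (ler_normD _ _) _; rewrite mulrDl lerD//.
  rewrite normrZ cutA_lin_sub ger0_norm// -mulrA ler_pM//; exact: cutA_bd.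
rewrite normrZ; have [Nb|bN] := leP (N ^+ 2) (b ^+ 2).
  have Nd : N ^+ 2 <= d ^+ 2 by rewrite (le_trans Nb)// lerXn2r ?nnegrE.
  rewrite /trunc !min_r// subrr normr0 mul0r mulr_ge0//.
  by rewrite !mulr_ge0 ?sqr_ge0// ?exprn_ge0// ltW.
have bN' : b < N by move: bN; rewrite ltr_pXn2r ?nnegrE ?(ltW N0).
pose e := Num.min d N.
have eE : trunc (d ^+ 2) = e ^+ 2.
  rewrite /trunc /e; have [dN|dN] := leP d N.
    by rewrite min_l// lerXn2r ?nnegrE ?(ltW N0).
  by rewrite min_r// lerXn2r ?nnegrE ?(ltW N0)// ltW.
have be : b <= e by rewrite le_min bd ltW.
have eN : e <= N by rewrite ge_min lexx orbT.
have ed : e <= d by rewrite ge_min lexx.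
have tb : trunc (b ^+ 2) = b ^+ 2 by rewrite /trunc min_l// ltW.
have h1 : `|mt (trunc (b ^+ 2)) - mt (trunc (d ^+ 2))| <= L * (2 * N * (n.+1%:R * `|u - v|)).
  apply: le_trans (lipschitz_of_derive dmt m1L (trunc_itv (sqr_ge0 b)) (trunc_itv (sqr_ge0 d))) _.
  rewrite ler_wpM2l// eE tb distrC subr_sqr normrM mulrC ler_pM//.
    by rewrite ger0_norm; lra.
  rewrite ger0_norm ?subr_ge0//; apply: (@le_trans _ _ (d - b)); first by rewrite lerB.
  apply: le_trans (ler_norm _) _; rewrite distrC.
  by apply: le_trans (ler_dist_dist _ _) _; rewrite cutB_lin_sub cutB_bd.
have h2 : `|cutA n u| <= n.+1%:R * N.
  by apply: le_trans (cutA_le_cutB _ _) _; rewrite ler_wpM2l// ltW.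
apply: le_trans (ler_pM _ _ h1 h2) _ => //.
by rewrite le_eqVlt; apply/orP; left; apply/eqP; ring.
Qed.

Definition galerkin_rhs n t u v : H :=
  - eps^-1 *: ((1 + t)^-1 *: v + mt (trunc (`|B (P n u)| ^+ 2)) *: cutA n u).

Variables (u0 u1 : H).

Lemma galerkin_exists n : exists u v v1, [/\ C1on u v, C1on v v1,
  (forall t, P n (u t) = u t) /\ (forall t, P n (v t) = v t),
  u 0 = P n u0 /\ v 0 = P n u1 &
  forall t, 0 <= t -> eps *: v1 t + (1 + t)^-1 *: v t +
    mt (trunc (`|B (u t)| ^+ 2)) *: A (u t) = 0].
Proof.
pose K := mu * n%:R + 2 * L * N ^+ 2 * n.+1%:R ^+ 2.
have mu0 : 0 <= mu by exact: le_trans mu1.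
have K0 : 0 <= K.
  by rewrite addr_ge0 ?mulr_ge0// ?exprn_ge0// ltW.
have lip t x y x' y' : 0 <= t -> `|galerkin_rhs n t x y - galerkin_rhs n t x' y'| <=
    (eps^-1 * (1 + K)) * (`|x - x'| + `|y - y'|).
  move=> t0; rewrite /galerkin_rhs -scalerBr normrZ normrN ger0_norm ?invr_ge0 ?(ltW eps0)//.
  rewrite -mulrA ler_wpM2l ?invr_ge0 ?(ltW eps0)//.
  have w1 : `|(1 + t)^-1| <= 1.
    by rewrite ger0_norm ?invr_ge0 ?addr_ge0// invf_le1 ?lerDl// ltr_wpDr.
  have hl : `|mt (trunc (`|B (P n x)| ^+ 2)) *: cutA n x -
      mt (trunc (`|B (P n x')| ^+ 2)) *: cutA n x'| <= K * `|x - x'|.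
    have [h|/ltW h] := leP `|B (P n x)| `|B (P n x')|; first exact: trunc_lipschitz.
    by rewrite distrC (distrC x); exact: trunc_lipschitz.
  have hy : `|(1 + t)^-1 *: y - (1 + t)^-1 *: y'| <= `|y - y'|.
    by rewrite -scalerBr normrZ ler_piMl.
  rewrite opprD addrACA; apply: le_trans (ler_normD _ _) _.
  apply: le_trans (lerD hy hl) _.
  by have : 0 <= K * `|y - y'| by [rewrite mulr_ge0|]; have := normr_ge0 (x - x'); lra.
have mcont (f : R -> H) : continuous f ->
    continuous (fun t => mt (trunc (`|B (P n (f t))| ^+ 2)) *: cutA n (f t)).
  move=> cf t.
  have cSf : {for t, continuous (fun t => cutA n (f t))}.
    have cS : continuous (cutA n).
      move=> x; apply/cvgrPdist_le => e e0.
      have ne : 0 < e / n.+1%:R by rewrite divr_gt0.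
      have hid : y @[y --> x] --> x by exact: cvg_id.
      have /cvgrPdist_le/(_ _ ne) hid' := hid.
      near=> y; rewrite cutA_lin_sub; apply: le_trans (cutA_bd _ _) _.
      apply: (@le_trans _ _ (n.+1%:R * `|x - y|)); first by rewrite ler_wpM2r// ler_nat.
      by rewrite mulrC -ler_pdivlMr//; near: y.
    exact: (continuous_comp (cf t) (cS _)).
  apply: cvgZ; last exact: cSf.
  apply: (@continuous_comp _ _ _ (fun t => trunc (`|B (P n (f t))| ^+ 2)) mt).
    apply: (@continuous_min _ _ (fun t => `|B (P n (f t))| ^+ 2) (fun=> N ^+ 2)); last exact: cvg_cst.
    rewrite (_ : (fun t => _) = fun t => ip (cutA n (f t)) (f t)); last first.
      by apply/funext => z; rewrite cutA_ip hip.
    by apply: (ip_cvg hip); [exact: cSf|exact: cf].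
  apply: is_derive_cvg; apply: dmt; apply: lt_le_trans (ltrN10 R) _.
  by have /andP[] := trunc_itv (sqr_ge0 `|B (P n (f t))|).
have cont (f g : R -> H) : continuous f -> continuous g ->
    continuous (fun t => galerkin_rhs n (rho t) (f t) (g t)).
  move=> cf cg t; apply: cvgZr; apply: cvgD; last exact: mcont.
  apply: cvgZ; last exact: cg.
  apply: cvgV; first by rewrite gt_eqF// ltr_wpDr// rho_ge0.
  by apply: cvgD; [exact: cvg_cst|exact: rho_continuous].
have eK0 : 0 <= eps^-1 * (1 + K) by rewrite mulr_ge0 ?invr_ge0 ?(ltW eps0)// addr_ge0.
have [u [v [uv vG uu0 vu1]]] := picard hip u0 u1 eK0 lip cont.
have linP := cut_lin cut n.
have bdP x : `|P n x| <= 1 * `|x| by rewrite mul1r; exact: (cut_contr cut).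
(* The right-hand side sees [u] only through [P n u], so the projection of the Picard solution
   solves the projected system. *)
exists (fun t => P n (u t)), (fun t => P n (v t)),
  (fun t => P n (galerkin_rhs n (rho t) (u t) (v t))); split.
- exact: C1on_linear linP bdP uv.
- exact: C1on_linear linP bdP vG.
- by split => t; exact: (cut_idem cut).
- by rewrite uu0 vu1.
- move=> t t0; rewrite rho_id// /galerkin_rhs -/(cutA n (u t)).
  have lZ (a : R) x : P n (a *: x) = a *: P n x.
    have P0 : P n 0 = 0 by rewrite -[RHS](subrr (P n 0)) cut_lin_sub subrr.
    by have := linP a x 0; rewrite P0 !addr0.
  have lD x y : P n (x + y) = P n x + P n y by have := linP 1 x y; rewrite !scale1r.
  have PS : P n (cutA n (u t)) = cutA n (u t).
    by rewrite /cutA -(cut_A cut n (cut_domA cut n _)) (cut_idem cut).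
  rewrite lZ lD !lZ PS scalerA mulrN mulfV ?gt_eqF// scaleN1r.
  by rewrite -addrA addNr.
Unshelve. all: by end_near. Qed.

End Galerkin.

(** The bound of the initial value is free of [eps], as the constant of the theorem must be. The
    7/nu collects 1/nu from the kinetic term and twice 3/nu from the mixed one. *)
Lemma lyap_init {R : realType} (eps nu c n k p q r b1 b2 : R) : 0 < eps -> eps <= 8^-1 ->
  0 < nu -> nu <= c -> 0 <= n -> 0 <= k -> 0 <= p -> 0 <= q -> 0 <= r ->
  2 * b1 <= k + n -> 2 * b2 <= k + r ->
  lyap eps nu c 1 n k p q r b1 b2 <=
  (nu^-1 + 1 + 5 / nu + (5 / nu + 1) * (7 / nu + 1)) * (n + k + p + q + r).
Proof.
move=> eps0 eps8 nu0 nuc n0 k0 p0 q0 r0 hb1 hb2; rewrite /lyap !expr1n !mul1r !mulr1.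
have c0 : 0 < c by exact: lt_le_trans nuc.
have i0 : 0 <= nu^-1 by rewrite invr_ge0 ltW.
have ic : c^-1 <= nu^-1 by rewrite lef_pV2 ?posrE.
have ed (x : R) : 0 <= x -> eps * (x / c) <= nu^-1 * x.
  move=> x0; apply: (@le_trans _ _ (x / c)).
    by rewrite ler_piMl ?divr_ge0 ?(ltW c0)// (le_trans eps8)// invf_le1// ler1n.
  by rewrite mulrC ler_wpM2r.
have ep x : eps * (x / 2) <= `|x| / 2.
  rewrite mulrA ler_wpM2r ?invr_ge0//; apply: le_trans (ler_norm _) _.
  by rewrite normrM ler_piMl// gtr0_norm// (le_trans eps8)// invf_le1// ler1n.
have g1 : eps * b1 <= k + n.
  have h : eps * b1 <= eps * ((k + n) / 2) by rewrite ler_pM2l// ler_pdivlMr// mulrC.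
  by apply: le_trans h _; have := ep (k + n); rewrite ger0_norm ?addr_ge0//; lra.
have g2 : eps * b2 <= k + r.
  have h : eps * b2 <= eps * ((k + r) / 2) by rewrite ler_pM2l// ler_pdivlMr// mulrC.
  by apply: le_trans h _; have := ep (k + r); rewrite ger0_norm ?addr_ge0//; lra.
have g3 : (1 - 3 * eps) / 2 * p <= p by rewrite ler_piMl//; lra.
have g4 : (1 - eps) / 2 * n <= n by rewrite ler_piMl//; lra.
set D := n + k + p + q + r.
have D0 : 0 <= D by rewrite /D; lra.
have s1 : 5 / nu * (eps * b2 + (1 - 3 * eps) / 2 * p) <= 5 / nu * D.
  by rewrite ler_wpM2l ?mulr_ge0//; rewrite /D; lra.
have s2 : 3 / nu * (eps * b1 + (1 - eps) / 2 * n) <= 3 / nu * (2 * D).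
  by rewrite ler_wpM2l ?mulr_ge0//; rewrite /D; lra.
have iD (x : R) : x <= D -> nu^-1 * x <= nu^-1 * D by move=> xD; rewrite ler_wpM2l.
have hk := ed _ k0; have hq := ed _ q0.
have hkD : nu^-1 * k <= nu^-1 * D by apply: iD; rewrite /D; lra.
have hqD : nu^-1 * q <= nu^-1 * D by apply: iD; rewrite /D; lra.
have pD : p <= D by rewrite /D; lra.
have rD : r <= D by rewrite /D; lra.
have s3 : (5 / nu + 1) * (eps * (k / c) + p + 3 / nu * (eps * b1 + (1 - eps) / 2 * n)) <=
    (5 / nu + 1) * ((7 / nu + 1) * D).
  rewrite ler_wpM2l ?addr_ge0 ?mulr_ge0//.
  have -> : (7 / nu + 1) * D = nu^-1 * D + D + 3 / nu * (2 * D) by field; rewrite gt_eqF.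
  by lra.
have -> : (nu^-1 + 1 + 5 / nu + (5 / nu + 1) * (7 / nu + 1)) * D =
  nu^-1 * D + D + 5 / nu * D + (5 / nu + 1) * ((7 / nu + 1) * D) by ring.
by lra.
Qed.

Section GalerkinBounds.
Context {R : realType} {H : completeNormedModType R} {ip : {dot H for idfun}}.
Hypothesis hip : induces_norm ip.
Implicit Types (s t : R).
Variables (A B : @operator R H) (P : nat -> H -> H).
Hypothesis cut : cutoffs ip A B P.
Variables (mt m1 : R -> R) (nu mu L : R).
Variables (u0 u1 : H).

(* [N ^+ 2 / 4] exceeds the initial energy, so that the truncation of the
   coefficient at [N ^+ 2] is never active. *)
Definition enrg_radius := 2 * (`|u1| ^+ 2 / nu + `|B u0| ^+ 2 + 1).
Local Notation N := enrg_radius.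

Definition lyap_cst := nu^-1 + 1 + 5 / nu + (5 / nu + 1) * (7 / nu + 1).

(** [Q] is the identity for the global bounds and 1 - P_j for the tails. *)
Definition data_size (Q : H -> H) := `|Q u0| ^+ 2 + `|Q u1| ^+ 2 + `|Q (B u0)| ^+ 2 +
  `|Q (B u1)| ^+ 2 + `|Q (A u0)| ^+ 2.

Definition lyap_bound := lyap_cst * data_size id.

Definition vel_bound := `|u1| ^+ 2 + 2 * mu ^+ 2 * lyap_bound.

Hypothesis dmt : forall s, -1 < s -> is_derive s 1 mt (m1 s).
Hypothesis nu0 : 0 < nu.
Hypothesis mtnu : forall s, 0 <= s -> nu <= mt s.
Hypothesis mu1 : 1 <= mu.
Hypothesis mtmu : forall s, 0 <= s <= N ^+ 2 -> mt s <= mu.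
Hypothesis L0 : 0 <= L.
Hypothesis m1L : forall s, 0 <= s <= N ^+ 2 -> `|m1 s| <= L.
Hypothesis du0 : dom A u0.
Hypothesis du1 : dom B u1.
Variable eps : R.
Hypothesis eps0 : 0 < eps.
Hypothesis eps8 : eps <= 8^-1.
Hypothesis epsnu : eps * (12 * mu) <= nu.
Hypothesis epsL : eps * (8 * L * (lyap_bound + vel_bound)) <= nu.
Variables (n : nat) (u v v1 : R -> H).
Hypothesis uv : C1on u v.
Hypothesis vv1 : C1on v v1.
Hypothesis Pu : forall t, P n (u t) = u t.
Hypothesis Pv : forall t, P n (v t) = v t.
Hypothesis hu0 : u 0 = P n u0.
Hypothesis hv0 : v 0 = P n u1.
Hypothesis equ : forall t, 0 <= t -> eps *: v1 t + (1 + t)^-1 *: v t +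
    mt (trunc N (`|B (u t)| ^+ 2)) *: A (u t) = 0.

Let N0 : 0 < N.
Proof.
by rewrite /enrg_radius mulr_gt0// ltr_wpDl// addr_ge0 ?sqr_ge0// divr_ge0 ?sqr_ge0// ltW.
Qed.
Let S := cutA A P n.
Let Su t : S (u t) = A (u t). Proof. by rewrite /S /cutA Pu. Qed.
Let sg t := `|B (u t)| ^+ 2.
Let sgE t : sg t = ip (S (u t)) (u t).
Proof. by rewrite /sg hip /S (cutA_ip cut) Pu. Qed.
Let c t := mt (trunc N (sg t)).
Let c1 t := m1 (sg t) * (2 * ip (A (u t)) (v t)).
Let cu : continuous u. Proof. by have [] := uv. Qed.
Let cv : continuous v. Proof. by have [] := vv1. Qed.
Let CS : C1on (fun t => S (u t)) (fun t => S (v t)).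
Proof. exact: C1on_linear (cutA_lin cut n) (cutA_bd cut n) uv. Qed.
Let cS : continuous (fun t => S (u t)). Proof. by have [] := CS. Qed.

Let sg_continuous : continuous sg.
Proof.
rewrite (_ : sg = fun t => ip (S (u t)) (u t)); last by apply/funext => t; rewrite sgE.
by move=> t; apply: (ip_cvg hip); [exact: cS|exact: cu].
Qed.

Let sg_derive t : 0 < t -> is_derive t 1 sg (2 * ip (A (u t)) (v t)).
Proof.
move=> t0; rewrite (_ : sg = fun t => ip (S (u t)) (u t)); last first.
  by apply/funext => s; rewrite sgE.
have [_ _ dS] := CS; have [_ _ du] := uv.
have := is_derive_ip hip (dS _ t0) (du _ t0).
rewrite (cutA_sym cut) (ipC (v t)) -/S Su mulr_natl mulr2n; exact.
Qed.

Let c_continuous : continuous c.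
Proof.
move=> t; apply: (@continuous_comp _ _ _ (fun t => trunc N (sg t)) mt).
  apply: (@continuous_min _ _ sg (fun=> N ^+ 2)); last exact: cvg_cst.
  exact: sg_continuous.
apply: is_derive_cvg; apply: dmt; apply: lt_le_trans (ltrN10 R) _.
by have /andP[] := trunc_itv N (sqr_ge0 `|B (u t)|).
Qed.

Let c_derive t : 0 < t -> sg t < N ^+ 2 -> is_derive t 1 c (c1 t).
Proof.
move=> t0 sN; apply: (near_is_derive (f := fun s => mt (sg s))).
  have e0 : 0 < N ^+ 2 - sg t by rewrite subr_gt0.
  have := @sg_continuous t; move=> /cvgrPdist_lt/(_ _ e0).
  apply: filterS => s; rewrite ltr_norml => /andP[h _].
  rewrite /c /trunc min_l//; move: h; lra.
have s1 : -1 < sg t by apply: lt_le_trans (ltrN10 R) _; exact: sqr_ge0.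
exact: (@is_derive1_comp _ mt sg t _ _ (dmt s1) (sg_derive t0)).
Qed.

Let c_bd t : nu <= c t /\ c t <= mu.
Proof.
have h := trunc_itv N (sqr_ge0 `|B (u t)|); split; last exact: mtmu.
by apply: mtnu; have /andP[] := h.
Qed.

Section Filtered.
Variables (Q : H -> H).
Hypothesis linQ : forall b x y, Q (b *: x + y) = b *: Q x + Q y.
Variable aQ : R.
Hypothesis bdQ : forall x, `|Q x| <= aQ * `|x|.
Hypothesis PQ : forall x, P n (Q x) = Q (P n x).
Hypothesis AQ : forall x, dom A x -> dom A (Q x) /\ A (Q x) = Q (A x).
Hypothesis BQ : forall x, dom B x -> dom B (Q x) /\ B (Q x) = Q (B x).

(** For [Q] the identity, the sum of the integrands of the two integral estimates. *)
Definition rate t := (1 + t) ^+ 3 * (`|B (Q (v t))| ^+ 2 + `|A (Q (u t))| ^+ 2) +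
  (1 + t) * (`|Q (v t)| ^+ 2 + `|B (Q (u t))| ^+ 2).

Let linS := cutA_lin cut n.
Let SQ t : S (Q (u t)) = A (Q (u t)). Proof. by rewrite /S /cutA PQ Pu. Qed.
Let pQ t : ip (S (Q (u t))) (Q (u t)) = `|B (Q (u t))| ^+ 2.
Proof. by rewrite (cutA_ip cut) -hip PQ Pu. Qed.
Let qQ t : ip (S (Q (v t))) (Q (v t)) = `|B (Q (v t))| ^+ 2.
Proof. by rewrite (cutA_ip cut) -hip PQ Pv. Qed.
Let CQu : C1on (fun t => Q (u t)) (fun t => Q (v t)).
Proof. exact: C1on_linear linQ bdQ uv. Qed.
Let CQv : C1on (fun t => Q (v t)) (fun t => Q (v1 t)).
Proof. exact: C1on_linear linQ bdQ vv1. Qed.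

Lemma rateE : rate = lyap_rate (ip := ip) S (fun t => Q (u t)) (fun t => Q (v t)).
Proof. by apply/funext => t; rewrite /rate /lyap_rate pQ qQ -!hip SQ. Qed.

Lemma rate_continuous : continuous rate.
Proof.
rewrite rateE.
exact: (lyap_rate_continuous hip linS (cutA_bd cut n) CQu CQv).
Qed.

Variable T : R.
Hypothesis sgT : forall t, 0 < t < T -> sg t < N ^+ 2.
Hypothesis c1T : forall t, 0 < t < T -> eps * (1 + t) * `|c1 t| <= c t / 2.

Let eqQ t : 0 < t < T -> eps *: Q (v1 t) + (1 + t)^-1 *: Q (v t) + c t *: S (Q (u t)) = 0.
Proof.
move=> /andP[t0 _]; have := congr1 Q (equ (ltW t0)).
have Q0 : Q 0 = 0 by have := bdQ 0; rewrite normr0 mulr0 normr_le0 => /eqP.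
have QZ b x : Q (b *: x) = b *: Q x by have := linQ b x 0; rewrite Q0 !addr0.
have QD x y : Q (x + y) = Q x + Q y by have := linQ 1 x y; rewrite !scale1r.
rewrite !QD !QZ Q0 => <-; congr (_ + _ *: _).
rewrite SQ; have dA : dom A (u t) by rewrite -Pu; exact: (cut_domA cut n).
by have [_ ->] := AQ dA.
Qed.

Lemma filtered_lyapunov (J : R -> R) : C1on J rate -> J 0 = 0 -> forall t, 0 <= t <= T ->
  (1 + t) ^+ 4 * (eps * `|B (Q (v t))| ^+ 2 / (2 * mu) + `|A (Q (u t))| ^+ 2) +
  (1 + t) ^+ 2 * `|B (Q (u t))| ^+ 2 + 3 / nu * (`|Q (u t)| ^+ 2 / 4) + J t / (2 * mu)
  <= lyap_cst * data_size Q.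
Proof.
move=> CJ J0 t tT; have /andP[t0 _] := tT.
have hnu s : nu <= c s by have [] := c_bd s.
have hmu s : c s <= mu by have [] := c_bd s.
have dc s : 0 < s < T -> is_derive s 1 c (c1 s).
  by move=> sT; have /andP[s0 _] := sT; apply: c_derive => //; exact: sgT.
rewrite rateE in CJ.
have h1 := lyapunov hip linS (cutA_bd cut n) (cutA_sym cut n) (cutA_pos hip cut n) CQu CQv
  c_continuous dc eqQ nu0 mu1 hnu hmu eps0 eps8 epsnu c1T CJ J0 tT.
have h2 := lyap_lower hip linS (cutA_sym cut n) (cutA_pos hip cut n) (fun t => Q (u t))
  (fun t => Q (v t)) nu0 mu1 hnu hmu eps0 eps8 epsnu t0.
cbv beta zeta in h2; rewrite -/S pQ qQ -!hip SQ in h2.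
apply: (@le_trans _ _ (lyap_fun (ip := ip) S (fun t => Q (u t)) (fun t => Q (v t)) c eps nu t + J t / (2 * mu))).
  by rewrite lerD2r.
apply: le_trans h1 _; rewrite /lyap_fun addr0; cbv beta zeta; rewrite -/S.
have QP x : Q (P n x) = P n (Q x) by rewrite PQ.
have b2 x y : 2 * ip x y <= `|x| ^+ 2 + `|y| ^+ 2.
  by have := sqr_ge0 `|x - y|; rewrite (normrBsq hip); lra.
rewrite pQ qQ -!hip SQ.
apply: le_trans (lyap_init eps0 eps8 nu0 (hnu 0) _ _ _ _ _ (b2 _ _) (b2 _ _)) _;
  rewrite ?sqr_ge0//.
have C0 : 0 <= lyap_cst.
  have i0 : 0 <= nu^-1 by rewrite invr_ge0 ltW.
  by rewrite /lyap_cst !addr_ge0 ?mulr_ge0 ?addr_ge0 ?mulr_ge0.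
rewrite -/lyap_cst ler_wpM2l// hu0 hv0 !QP.
have le2 (x y : H) : `|x| <= `|y| -> `|x| ^+ 2 <= `|y| ^+ 2.
  by move=> xy; rewrite lerXn2r ?nnegrE.
have dBu0 : dom B u0 by exact: (cut_domAB cut du0).
have [dAQ eAQ] := AQ du0; have [dBQ eBQ] := BQ dBu0; have [dBQ1 eBQ1] := BQ du1.
rewrite (cut_A cut n dAQ) eAQ (cut_B cut n dBQ) eBQ (cut_B cut n dBQ1) eBQ1.
have ct := cut_contr cut n.
by rewrite /data_size; have := le2 _ _ (ct (Q u0)); have := le2 _ _ (ct (Q u1));
  have := le2 _ _ (ct (Q (B u0))); have := le2 _ _ (ct (Q (B u1)));
  have := le2 _ _ (ct (Q (A u0))); lra.
Qed.

End Filtered.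
(** Wherever the truncation is inactive, [X] bounds eps w |c'| relative to nu/2. Using [L] in place
    of [m1] keeps it continuous. The sum [g] thus encodes in one inequality [g t < 1] both the
    inactivity of the truncation and the proviso on c'. *)
Let X t := eps * (1 + t) * (L * `|2 * ip (A (u t)) (v t)|) * (2 / nu).
Let g t := sg t / N ^+ 2 + X t.

Let N2 : 0 < N ^+ 2. Proof. exact: exprn_gt0. Qed.

Let X0 t : 0 <= t -> 0 <= X t.
Proof.
move=> t0; apply: mulr_ge0; last by rewrite divr_ge0// ltW.
by apply: mulr_ge0; [rewrite mulr_ge0 ?(ltW eps0)// addr_ge0|rewrite mulr_ge0].
Qed.

Let g_continuous : continuous g.
Proof.
move=> t; have cip : ip (A (u s)) (v s) @[s --> t] --> ip (A (u t)) (v t).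
  rewrite -Su (_ : (fun s => _) = fun s => ip (S (u s)) (v s)); last first.
    by apply/funext => s; rewrite Su.
  by apply: (ip_cvg hip); [exact: cS|exact: cv].
apply: cvgD; first by apply: cvgM; [exact: sg_continuous|exact: cvg_cst].
apply: cvgM; last exact: cvg_cst.
apply: cvgM.
  apply: cvgM; first exact: cvg_cst.
  by apply: cvgD; [exact: cvg_cst|exact: cvg_id].
apply: cvgM; first exact: cvg_cst.
by apply: cvg_norm; apply: cvgM; [exact: cvg_cst|exact: cip].
Qed.

Let g_coef t : 0 <= t -> g t < 1 ->
  sg t < N ^+ 2 /\ eps * (1 + t) * `|c1 t| <= c t / 2.
Proof.
move=> t0 g1; have x0 := X0 t0.
have s1 : sg t / N ^+ 2 < 1 by move: g1; rewrite /g; lra.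
have sN : sg t < N ^+ 2 by move: s1; rewrite ltr_pdivrMr// mul1r.
have s0 : 0 <= sg t / N ^+ 2 by rewrite divr_ge0 ?sqr_ge0// ltW.
have X1 : X t <= 1 by move: g1; rewrite /g; lra.
split => //; have [hc _] := c_bd t.
apply: (@le_trans _ _ (nu / 2)); last by rewrite ler_wpM2r ?invr_ge0.
apply: (@le_trans _ _ (eps * (1 + t) * (L * `|2 * ip (A (u t)) (v t)|))).
  rewrite ler_wpM2l ?mulr_ge0 ?addr_ge0 ?(ltW eps0)// normrM ler_wpM2r// m1L//.
  by rewrite sqr_ge0 ltW.
rewrite -(@ler_pM2r _ (2 / nu)) ?divr_gt0//.
have -> : nu / 2 * (2 / nu) = 1 by field; rewrite gt_eqF.
exact: X1.
Qed.

Let rate_id_ge0 t : 0 < t -> 0 <= rate id t.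
Proof.
move=> t0; have w0 : 0 <= 1 + t by rewrite addr_ge0// ltW.
by apply: addr_ge0; apply: mulr_ge0; rewrite ?exprn_ge0// addr_ge0 ?sqr_ge0.
Qed.

Lemma C1on_ge0 (J f : R -> R) : C1on J f -> J 0 = 0 -> (forall t, 0 < t -> 0 <= f t) ->
  forall t, 0 <= t -> 0 <= J t.
Proof.
move=> [cJ _ dJ] J0 f0 t t0.
have := @nonincreasing_of_derive _ (fun s => - J s) (fun s => - f s) 0 t _ _ _ 0 t
  (lexx 0) t0 (lexx t).
rewrite J0 oppr0 oppr_le0; apply.
- by move=> s; apply: cvgN; exact: cJ.
- by move=> s /andP[s0 _]; exact: (is_deriveN (dJ _ s0)).
- by move=> s /andP[s0 _]; rewrite oppr_le0 f0.
Qed.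

Let bounds_on T : (forall t, 0 <= t < T -> g t < 1) -> forall t, 0 <= t <= T ->
  [/\ sg t <= `|u1| ^+ 2 / nu + `|B u0| ^+ 2,
      (1 + t) ^+ 4 * `|A (u t)| ^+ 2 <= lyap_bound &
      (1 + t) ^+ 2 * `|v t| ^+ 2 <= vel_bound].
Proof.
move=> gT; have g' t : 0 < t < T -> g t < 1.
  by move=> /andP[/ltW t0 tT]; apply: gT; rewrite t0.
have sgT t : 0 < t < T -> sg t < N ^+ 2.
  by move=> tT; have /andP[/ltW t0 _] := tT; have [] := g_coef t0 (g' _ tT).
have c1T t : 0 < t < T -> eps * (1 + t) * `|c1 t| <= c t / 2.
  by move=> tT; have /andP[/ltW t0 _] := tT; have [] := g_coef t0 (g' _ tT).
have bd1 (x : H) : `|id x| <= 1 * `|x| by rewrite mul1r.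
have lin1 (b : R) (x y : H) : id (b *: x + y) = b *: id x + id y by [].
have P1 (x : H) : P n (id x) = id (P n x) by [].
have A1 (x : H) : dom A x -> dom A (id x) /\ A (id x) = id (A x) by [].
have B1 (x : H) : dom B x -> dom B (id x) /\ B (id x) = id (B x) by [].
have cr : continuous (rate id) := rate_continuous lin1 bd1 P1.
have [J CJ J0] := scalar_primitive cr.
have J_ge0 := C1on_ge0 CJ J0 rate_id_ge0.
have est t : 0 <= t <= T -> (1 + t) ^+ 4 * `|A (u t)| ^+ 2 <= lyap_bound.
  move=> tT; have /andP[t0 _] := tT; have w0 : 0 <= 1 + t by rewrite addr_ge0.
  have mu0 : 0 < mu by exact: lt_le_trans mu1.
  have h := filtered_lyapunov lin1 bd1 P1 A1 B1 sgT c1T CJ J0 tT.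
  apply: le_trans h.
  have i1 : 0 <= (1 + t) ^+ 4 * (eps * `|B (v t)| ^+ 2 / (2 * mu)).
    apply: mulr_ge0; first exact: exprn_ge0.
    by rewrite divr_ge0 ?mulr_ge0 ?sqr_ge0 ?(ltW eps0) ?(ltW mu0).
  have i2 : 0 <= (1 + t) ^+ 2 * `|B (u t)| ^+ 2 by rewrite mulr_ge0 ?sqr_ge0.
  have i3 : 0 <= 3 / nu * (`|u t| ^+ 2 / 4).
    by rewrite mulr_ge0// divr_ge0 ?sqr_ge0// ltW.
  have i4 : 0 <= J t / (2 * mu) by rewrite divr_ge0 ?J_ge0// mulr_ge0// ltW.
  by rewrite /=; lra.
have hnu s : nu <= c s by have [] := c_bd s.
have hmu s : c s <= mu by have [] := c_bd s.
have dc s : 0 < s < T -> is_derive s 1 c (c1 s).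
  by move=> sT; have /andP[s0 _] := sT; apply: c_derive => //; exact: sgT.
have eqS t : 0 < t < T -> eps *: v1 t + (1 + t)^-1 *: v t + c t *: S (u t) = 0.
  by move=> /andP[/ltW t0 _]; rewrite Su; exact: equ.
have ct := cut_contr cut n.
have le2 (x y : H) : `|x| <= `|y| -> `|x| ^+ 2 <= `|y| ^+ 2.
  by move=> xy; rewrite lerXn2r ?nnegrE.
have v0 : `|v 0| ^+ 2 <= `|u1| ^+ 2 by rewrite hv0 le2.
have estr t : 0 < t < T -> 2 * mu ^+ 2 * ((1 + t) ^+ 4 * ip (S (u t)) (S (u t))) <= vel_bound.
  move=> /andP[/ltW t0 /ltW tT]; rewrite -hip Su.
  apply: (@le_trans _ _ (2 * mu ^+ 2 * lyap_bound)); last by rewrite lerDr sqr_ge0.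
  by apply: ler_wpM2l; [rewrite mulr_ge0 ?sqr_ge0|apply: est; rewrite t0].
have lb0 : 0 <= lyap_bound.
  have i0 : 0 <= nu^-1 by rewrite invr_ge0 ltW.
  apply: mulr_ge0; last by rewrite /data_size !addr_ge0 ?exprn_ge0.
  by rewrite /lyap_cst !addr_ge0 ?mulr_ge0 ?addr_ge0 ?mulr_ge0.
have vM : ip (v 0) (v 0) <= vel_bound.
  by rewrite -hip (le_trans v0)// lerDl mulr_ge0// mulr_ge0// sqr_ge0.
move=> t tT; split.
- have := energy_nonincreasing hip (cutA_lin cut n) (cutA_bd cut n) (cutA_sym cut n)
    uv vv1 c_continuous dc eqS nu0 hnu eps0 c1T tT.
  cbv beta zeta; rewrite -/S -!sgE -!hip => h.
  have cp s : 0 < c s by exact: lt_le_trans nu0 (hnu s).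
  have h1 : 0 <= eps * (`|v t| ^+ 2 / c t).
    by rewrite mulr_ge0 ?(ltW eps0)// divr_ge0 ?sqr_ge0// ltW.
  have h2 : eps * (`|v 0| ^+ 2 / c 0) <= `|u1| ^+ 2 / nu.
    apply: (@le_trans _ _ (`|v 0| ^+ 2 / c 0)).
      rewrite ler_piMl ?divr_ge0 ?sqr_ge0 ?(ltW (cp 0))// (le_trans eps8)//.
      by rewrite invf_le1// ler1n.
    by rewrite ler_pM ?sqr_ge0 ?invr_ge0 ?(ltW (cp 0))// lef_pV2 ?posrE.
  have h3 : sg 0 <= `|B u0| ^+ 2.
    by rewrite /sg hu0 (cut_B cut n (cut_domAB cut du0)) le2.
  by move: h h1 h2 h3; rewrite /sg; lra.
- exact: est.
- have := velocity_decay hip vv1 eqS nu0 mu1 hnu hmu eps0 eps8 vM estr tT.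
  by rewrite /= -hip.
Qed.

Let g_lt1 t : 0 <= t -> g t < 1.
Proof.
apply: bootstrap; first exact: g_continuous.
move=> T T0 gT; have TT : 0 <= T <= T by rewrite T0 lexx.
have [h1 h2 h3] := bounds_on gT TT; set w := 1 + T in h2 h3.
have w1 : 1 <= w by rewrite lerDl.
set K := `|u1| ^+ 2 / nu + `|B u0| ^+ 2 in h1.
have K0 : 0 <= K by rewrite addr_ge0 ?sqr_ge0// divr_ge0 ?sqr_ge0// ltW.
(* [N] is twice K + 1, and K is at most (K + 1)^2. *)
have e1 : sg T / N ^+ 2 <= 4^-1.
  rewrite ler_pdivrMr//; apply: (le_trans h1).
  have -> : N ^+ 2 = 4 * (K + 1) ^+ 2 by rewrite /enrg_radius -/K; ring.
  by rewrite mulrA mulVf// mul1r; nra.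
(* The decay of the two factors would bear the weight w^3; only one power of w is needed. *)
have hA : w * `|2 * ip (A (u T)) (v T)| <= lyap_bound + vel_bound.
  have i1 : `|2 * ip (A (u T)) (v T)| <= 2 * (`|A (u T)| * `|v T|).
    by rewrite normrM ger0_norm// ler_wpM2l// ler_ip.
  apply: (@le_trans _ _ (w ^+ 3 * (2 * (`|A (u T)| * `|v T|)))).
    rewrite ler_pM// ?(le_trans ler01)//.
    by rewrite -[X in X <= _]expr1 ler_weXn2l.
  have := sqr_ge0 (w ^+ 2 * `|A (u T)| - w * `|v T|).
  have -> : (w ^+ 2 * `|A (u T)| - w * `|v T|) ^+ 2 = w ^+ 4 * `|A (u T)| ^+ 2 +
    w ^+ 2 * `|v T| ^+ 2 - w ^+ 3 * (2 * (`|A (u T)| * `|v T|)) by ring.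
  by move: h2 h3; lra.
(* The factor 8 in [epsL] is chosen to give 1/4 here, so that [g] is at most 1/2. *)
have hX : X T <= 4^-1.
  rewrite /X -/w; have eL : 0 <= eps * L by rewrite mulr_ge0// ltW.
  have h := ler_wpM2l eL hA.
  have -> : eps * w * (L * `|2 * ip (A (u T)) (v T)|) * (2 / nu) =
    2 * (eps * L * (w * `|2 * ip (A (u T)) (v T)|)) / nu by ring.
  by rewrite ler_pdivrMr//; move: epsL h; lra.
by rewrite /g; lra.
Qed.

Lemma galerkin_coef t : 0 <= t -> sg t < N ^+ 2 /\ eps * (1 + t) * `|c1 t| <= c t / 2.
Proof. by move=> t0; apply: g_coef => //; exact: g_lt1. Qed.

Lemma galerkin_velocity t : 0 <= t -> (1 + t) ^+ 2 * `|v t| ^+ 2 <= vel_bound.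
Proof.
move=> t0; have tt : 0 <= t <= t by rewrite t0 lexx.
by have [] := bounds_on (fun s h => g_lt1 (andP h).1) tt.
Qed.

Lemma galerkin_lyapunov (Q : H -> H) (aQ : R) :
  (forall (b : R) x y, Q (b *: x + y) = b *: Q x + Q y) ->
  (forall x, `|Q x| <= aQ * `|x|) -> (forall x, P n (Q x) = Q (P n x)) ->
  (forall x, dom A x -> dom A (Q x) /\ A (Q x) = Q (A x)) ->
  (forall x, dom B x -> dom B (Q x) /\ B (Q x) = Q (B x)) ->
  forall J, C1on J (rate Q) -> J 0 = 0 -> forall t, 0 <= t ->
  (1 + t) ^+ 4 * (eps * `|B (Q (v t))| ^+ 2 / (2 * mu) + `|A (Q (u t))| ^+ 2) +
  (1 + t) ^+ 2 * `|B (Q (u t))| ^+ 2 + 3 / nu * (`|Q (u t)| ^+ 2 / 4) + J t / (2 * mu)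
  <= lyap_cst * data_size Q.
Proof.
move=> lQ bQ PQ AQ BQ J CJ J0 t t0.
have sgT s : 0 < s < t -> sg s < N ^+ 2.
  by move=> /andP[/ltW s0 _]; have [] := galerkin_coef s0.
have c1T s : 0 < s < t -> eps * (1 + s) * `|c1 s| <= c s / 2.
  by move=> /andP[/ltW s0 _]; have [] := galerkin_coef s0.
by apply: (filtered_lyapunov lQ bQ PQ AQ BQ sgT c1T CJ J0); rewrite t0 lexx.
Qed.

Lemma galerkin_strong_sol : strong_sol A B mt eps u v v1.
Proof.
split=> //.
- by move=> t; rewrite -Pu; exact: (cut_domA cut n).
- by move=> t; rewrite -Pv; exact: (cut_domBP cut n).
- have h := C1on_linear (cutB_lin cut n) (cutB_bd hip cut n) uv.
  rewrite (_ : (fun t => B (u t)) = fun t => B (P n (u t))); last first.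
    by apply/funext => t; rewrite Pu.
  rewrite (_ : (fun t => B (v t)) = fun t => B (P n (v t)))//.
  by apply/funext => t; rewrite Pv.
- by rewrite (_ : (fun t => A (u t)) = fun t => S (u t))//; apply/funext => t; rewrite Su.
- move=> t t0; have [sN _] := galerkin_coef (ltW t0).
  by have := equ (ltW t0); rewrite /trunc min_l// ltW.
Qed.

End GalerkinBounds.

(** * Strong convergence of the Galerkin approximations *)

Section GalerkinLimit.
Context {R : realType} {H : completeNormedModType R} {ip : {dot H for idfun}}.
Hypothesis hip : induces_norm ip.
Implicit Types (s t e T : R).
Variables (A B : @operator R H) (P : nat -> H -> H).
Hypothesis cut : cutoffs ip A B P.
Variables (mt m1 : R -> R) (nu mu L : R) (u0 u1 : H).
Local Notation N := (enrg_radius B nu u0 u1).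
Local Notation LB := (lyap_bound A B nu u0 u1).
Local Notation VB := (vel_bound A B nu mu u0 u1).
Local Notation lcst := (lyap_cst nu).
Hypothesis dmt : forall s, -1 < s -> is_derive s 1 mt (m1 s).
Hypothesis nu0 : 0 < nu.
Hypothesis mtnu : forall s, 0 <= s -> nu <= mt s.
Hypothesis mu1 : 1 <= mu.
Hypothesis mtmu : forall s, 0 <= s <= N ^+ 2 -> mt s <= mu.
Hypothesis L0 : 0 <= L.
Hypothesis m1L : forall s, 0 <= s <= N ^+ 2 -> `|m1 s| <= L.
Hypothesis du0 : dom A u0.
Hypothesis du1 : dom B u1.
Variable eps : R.
Hypothesis eps0 : 0 < eps.
Hypothesis eps8 : eps <= 8^-1.
Hypothesis epsnu : eps * (12 * mu) <= nu.
Hypothesis epsL : eps * (8 * L * (LB + VB)) <= nu.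
Variables (u v v1 : nat -> R -> H).
Hypothesis uv : forall n, C1on (u n) (v n).
Hypothesis vv1 : forall n, C1on (v n) (v1 n).
Hypothesis Pu : forall n t, P n (u n t) = u n t.
Hypothesis Pv : forall n t, P n (v n t) = v n t.
Hypothesis hu0 : forall n, u n 0 = P n u0.
Hypothesis hv0 : forall n, v n 0 = P n u1.
Hypothesis equ : forall n t, 0 <= t -> eps *: v1 n t + (1 + t)^-1 *: v n t +
    mt (trunc N (`|B (u n t)| ^+ 2)) *: A (u n t) = 0.

Let mu0 : 0 < mu. Proof. exact: lt_le_trans mu1. Qed.
Let N0 : 0 < N.
Proof.
by rewrite /enrg_radius mulr_gt0// ltr_wpDl// addr_ge0 ?sqr_ge0// divr_ge0 ?sqr_ge0// ltW.
Qed.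
Let lcst0 : 0 <= lcst.
Proof.
have i0 : 0 <= nu^-1 by rewrite invr_ge0 ltW.
by rewrite /lyap_cst !addr_ge0 ?mulr_ge0 ?addr_ge0 ?mulr_ge0.
Qed.
Let LB0 : 0 <= LB.
Proof. by apply: mulr_ge0 => //; rewrite /data_size !addr_ge0 ?exprn_ge0. Qed.

Let coef n := galerkin_coef hip cut dmt nu0 mtnu mu1 mtmu L0 m1L du0 du1 eps0 eps8 epsnu
  epsL (uv n) (vv1 n) (Pu n) (Pv n) (hu0 n) (hv0 n) (equ n).
Let vel n := galerkin_velocity hip cut dmt nu0 mtnu mu1 mtmu L0 m1L du0 du1 eps0 eps8 epsnu
  epsL (uv n) (vv1 n) (Pu n) (Pv n) (hu0 n) (hv0 n) (equ n).
Let lya n := galerkin_lyapunov hip cut dmt nu0 mtnu mu1 mtmu L0 m1L du0 du1 eps0 eps8 epsnu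
  epsL (uv n) (vv1 n) (Pu n) (Pv n) (hu0 n) (hv0 n) (equ n).
Let ssol n : strong_sol A B mt eps (u n) (v n) (v1 n) :=
  galerkin_strong_sol hip cut dmt nu0 mtnu mu1 mtmu L0 m1L du0 du1 eps0 eps8 epsnu
  epsL (uv n) (vv1 n) (Pu n) (Pv n) (hu0 n) (hv0 n) (equ n).

Lemma filtered_bound n (Q : H -> H) (aQ : R) :
  (forall (b : R) x y, Q (b *: x + y) = b *: Q x + Q y) ->
  (forall x, `|Q x| <= aQ * `|x|) -> (forall x, P n (Q x) = Q (P n x)) ->
  (forall x, dom A x -> dom A (Q x) /\ A (Q x) = Q (A x)) ->
  (forall x, dom B x -> dom B (Q x) /\ B (Q x) = Q (B x)) ->
  forall t, 0 <= t ->
  (1 + t) ^+ 4 * (eps * `|B (Q (v n t))| ^+ 2 / (2 * mu) + `|A (Q (u n t))| ^+ 2) +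
  (1 + t) ^+ 2 * `|B (Q (u n t))| ^+ 2 + 3 / nu * (`|Q (u n t)| ^+ 2 / 4)
  <= lcst * data_size A B u0 u1 Q.
Proof.
move=> lQ bQ PQ AQ BQ t t0.
have cr : continuous (rate A B (u n) (v n) Q).
  exact: (rate_continuous hip cut (uv n) (vv1 n) (Pu n) (Pv n) lQ bQ PQ).
have [J CJ J0] := scalar_primitive cr.
apply: le_trans (lya lQ bQ PQ AQ BQ CJ J0 t0); rewrite lerDl.
apply: divr_ge0; last by rewrite mulr_ge0// ltW.
apply: (C1on_ge0 CJ J0) => // s s0; have w0 : 0 <= 1 + s by rewrite addr_ge0// ltW.
by apply: addr_ge0; apply: mulr_ge0; rewrite ?exprn_ge0// addr_ge0 ?sqr_ge0.
Qed.

Let full n t : 0 <= t ->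
  (1 + t) ^+ 4 * (eps * `|B (v n t)| ^+ 2 / (2 * mu) + `|A (u n t)| ^+ 2) +
  (1 + t) ^+ 2 * `|B (u n t)| ^+ 2 + 3 / nu * (`|u n t| ^+ 2 / 4) <= LB.
Proof.
by apply: (filtered_bound (Q := id) (aQ := 1)) => // x; rewrite mul1r.
Qed.

Let parts (w b a b' n' : R) : 1 <= w -> 0 <= b -> 0 <= a -> 0 <= b' -> 0 <= n' ->
  forall D, w ^+ 4 * (eps * b / (2 * mu) + a) + w ^+ 2 * b' + 3 / nu * (n' / 4) <= D ->
  a <= D /\ b <= 2 * mu / eps * D.
Proof.
move=> w1 b0 a0 b'0 n'0 D hD.
have i1 : 0 <= eps * b / (2 * mu) by rewrite divr_ge0 ?mulr_ge0// ltW.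
have i2 : 0 <= w ^+ 2 * b' by rewrite mulr_ge0// sqr_ge0.
have i3 : 0 <= 3 / nu * (n' / 4) by rewrite mulr_ge0// divr_ge0// ltW.
have i4 : eps * b / (2 * mu) + a <= w ^+ 4 * (eps * b / (2 * mu) + a).
  by rewrite ler_peMl ?addr_ge0// exprn_ege1.
split; first by lra.
have : eps * b / (2 * mu) <= D by lra.
rewrite ler_pdivrMr ?mulr_gt0// => h.
have -> : 2 * mu / eps * D = D * (2 * mu) / eps by ring.
by rewrite ler_pdivlMr// mulrC.
Qed.

Let le_of_sq (x : R) D : 0 <= x -> x ^+ 2 <= D -> x <= D + 1.
Proof. by move=> x0 h; have := sqr_ge0 (x - 1); nra. Qed.

Let a := LB + 1.

Lemma A_bound n t : 0 <= t -> `|A (u n t)| <= a.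
Proof.
move=> t0; apply: le_of_sq => //.
have w1 : 1 <= 1 + t by rewrite lerDl.
by have [] := parts w1 (sqr_ge0 _) (sqr_ge0 _) (sqr_ge0 _) (sqr_ge0 _) (full n t0).
Qed.

Lemma B_bound n t : 0 <= t -> `|B (u n t)| <= N.
Proof.
move=> t0; have [/ltW h _] := coef n t0.
by rewrite -(@ler_pXn2r _ 2%N) ?nnegrE ?(ltW N0).
Qed.

(** The proviso eps w |c'| <= c / 2 itself bounds c'. The bound degenerates with [eps], which is
    harmless since convergence is proved at fixed [eps]. *)
Let G := mu / (2 * eps).

Lemma coef_derive_bound n t : 0 <= t ->
  `|m1 (`|B (u n t)| ^+ 2) * (2 * ip (A (u n t)) (v n t))| <= G.
Proof.
move=> t0; have [/ltW sN h] := coef n t0.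
have hc : mt (trunc N (`|B (u n t)| ^+ 2)) <= mu.
  by apply: mtmu; apply: trunc_itv; exact: sqr_ge0.
rewrite /G ler_pdivlMr ?mulr_gt0//; set z := `|_| in h *.
have : eps * z <= eps * (1 + t) * z.
  rewrite -mulrA ler_pM2l//; apply: ler_peMl; first exact: normr_ge0.
  by rewrite lerDl.
by move: h hc; lra.
Qed.

Let Q j x := x - P j x.
Let linQ j (b : R) x y : Q j (b *: x + y) = b *: Q j x + Q j y.
Proof. by rewrite /Q (cut_lin cut) scalerBr opprD addrACA. Qed.
Let bdQ j x : `|Q j x| <= 2 * `|x|.
Proof.
apply: le_trans (ler_normB _ _) _; have := cut_contr cut j x; lra.
Qed.
Let PQ n j x : P n (Q j x) = Q j (P n x).
Proof. by rewrite /Q -(cut_lin_sub cut) (cut_comm cut). Qed.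
Let AQ j x : dom A x -> dom A (Q j x) /\ A (Q j x) = Q j (A x).
Proof.
move=> dx; have [] := op_linearB (cut_linA cut) dx (cut_domA cut j x).
by rewrite (cut_A cut j dx).
Qed.
Let BQ j x : dom B x -> dom B (Q j x) /\ B (Q j x) = Q j (B x).
Proof.
move=> dx; have [] := op_linearB (cut_linB cut) dx (cut_domBP cut j x).
by rewrite (cut_B cut j dx).
Qed.

Let data_tail : data_size A B u0 u1 (Q j) @[j --> \oo] --> 0.
Proof.
have h x : `|Q j x| ^+ 2 @[j --> \oo] --> 0.
  have c : Q j x @[j --> \oo] --> x - x by apply: cvgB; [exact: cvg_cst|exact: (cut_cvg cut)].
  by have := cvg_normsq c; rewrite subrr normr0 expr0n; apply.
rewrite /data_size; have := cvgD (cvgD (cvgD (cvgD (h u0) (h u1)) (h (B u0))) (h (B u1))) (h (A u0)).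
by rewrite !addr0; move=> h'; exact: h'.
Qed.

Let small_of_sq (x d : R) : 0 <= x -> 0 < d -> x ^+ 2 <= d ^+ 2 -> x <= d.
Proof. by move=> x0 d0; rewrite ler_pXn2r ?nnegrE ?(ltW d0). Qed.

(** [A] maps the range of [P n] into itself and the truncation is inactive, so each approximation
    solves the original equation exactly. Two of them differ only in their initial data, and
    [stability] applies. *)
Lemma weak_cauchy : ucauchy v /\ ucauchy (fun n t => B (u n t)).
Proof.
suff h T e : 0 < e -> exists M, forall n, (M <= n)%N -> forall t, 0 <= t <= T ->
    `|v M t - v n t| <= e /\ `|B (u M t) - B (u n t)| <= e.
  split=> T e e0; have [M hM] := h T e e0; exists M => n Mn t tT.
    by have [] := hM n Mn t tT.
  by have [] := hM n Mn t tT.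
move=> e0; pose Gam := 2 * L * N * a * (nu^-1 + eps^-1) + G / nu.
have a0 : 0 <= a by rewrite addr_ge0.
have G0 : 0 <= G by rewrite divr_ge0 ?(ltW mu0)// mulr_ge0// ltW.
have Gam0 : 0 <= Gam.
  apply: addr_ge0; last by rewrite divr_ge0// ltW.
  apply: mulr_ge0; last by rewrite addr_ge0// invr_ge0 ltW.
  by apply: mulr_ge0 a0; apply: mulr_ge0 (ltW N0); exact: mulr_ge0.
pose F := expR (Gam * T); have F0 : 0 < F by exact: expR_gt0.
pose kk := Num.min eps nu; have kk0 : 0 < kk by rewrite lt_min eps0.
pose d := e ^+ 2 * kk / F; have d0 : 0 < d by rewrite divr_gt0// mulr_gt0// exprn_gt0.
have c1 : P n u1 @[n --> \oo] --> u1 by exact: (cut_cvg cut).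
have c2 : P n (B u0) @[n --> \oo] --> B u0 by exact: (cut_cvg cut).
(* Bounds the squared differences of the data, so that the initial energy is at most (eps + mu) e1,
   hence d/4; being at most 1, [e1] dominates its own square. *)
pose e1 := Num.min 1 (d / (4 * (eps + mu))).
have em : 0 < 4 * (eps + mu) by rewrite mulr_gt0// addr_gt0.
have e10 : 0 < e1 by rewrite lt_min ltr01 divr_gt0.
have e12 : 0 < e1 / 2 by rewrite divr_gt0.
have /cvgrPdist_le/(_ _ e12) [M1 _ hM1] := c1.
have /cvgrPdist_le/(_ _ e12) [M2 _ hM2] := c2.
pose M := maxn M1 M2; exists M => n Mn t tT; have /andP[t0 tT'] := tT.
have lipm s r : 0 <= s <= N ^+ 2 -> 0 <= r <= N ^+ 2 -> `|mt s - mt r| <= L * `|s - r|.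
  exact: (lipschitz_of_derive dmt m1L).
have tpos r : 0 <= r <= T -> 0 <= r by move=> /andP[].
have := stability hip cut dmt eps0 (ssol M) (ssol n) nu0 mtnu L0 lipm (ltW N0) a0 G0
  (fun r h => B_bound M (tpos _ h)) (fun r h => B_bound n (tpos _ h))
  (fun r h => A_bound n (tpos _ h))
  (fun r h => coef_derive_bound M (ltW (andP h).1)) tT.
cbv beta zeta; rewrite -/Gam !hu0 !hv0.
have dBu0 := cut_domAB cut du0.
rewrite (cut_B cut M dBu0) (cut_B cut n dBu0).
have dist (x : H) (M' : nat) : (M' <= M)%N -> (forall n, (M' <= n)%N -> `|x - P n x| <= e1 / 2) ->
    `|P M x - P n x| ^+ 2 <= e1.
  move=> M'M hh; have h1 := hh _ M'M; have h2 := hh _ (leq_trans M'M Mn).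
  have h3 : `|P M x - P n x| <= e1.
    have -> : P M x - P n x = (x - P n x) - (x - P M x) by rewrite opprB [RHS]addrC addrA subrK.
    by apply: le_trans (ler_normB _ _) _; lra.
  have e11 : e1 <= 1 by rewrite ge_min lexx.
  apply: (@le_trans _ _ (e1 ^+ 2)); first by rewrite lerXn2r ?nnegrE ?(ltW e10).
  by rewrite expr2 ler_piMr// ltW.
have hu := dist u1 M1 (leq_maxl _ _) hM1.
have hb := dist (B u0) M2 (leq_maxr _ _) hM2.
set z := `|v M t - v n t|; set y := `|B (u M t) - B (u n t)|.
set E0 := (X in _ <= X * _) => hE.
have hE0 : E0 <= d / 4.
  have hc : mt (`|P M (B u0)| ^+ 2) <= mu.
    rewrite -(cut_B cut M dBu0) -hu0; apply: mtmu; rewrite sqr_ge0.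
    by rewrite lerXn2r ?nnegrE ?(ltW N0)// B_bound.
  apply: (@le_trans _ _ (eps * e1 + mu * e1)).
    apply: lerD; first by rewrite ler_pM2l.
    by rewrite ler_pM ?sqr_ge0// (le_trans (ltW nu0))// mtnu// sqr_ge0.
  have : e1 <= d / (4 * (eps + mu)) by rewrite ge_min lexx orbT.
  by rewrite ler_pdivlMr// => h; lra.
have hF : expR (Gam * t) <= F by rewrite ler_expR ler_wpM2l.
have E00 : 0 <= E0.
  rewrite addr_ge0// mulr_ge0 ?sqr_ge0 ?(ltW eps0)//.
  by rewrite (le_trans (ltW nu0))// mtnu// sqr_ge0.
have hEd : E0 * expR (Gam * t) <= e ^+ 2 * kk.
  apply: (@le_trans _ _ (d * F)).
    by rewrite ler_pM ?expR_ge0//; lra.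
  by rewrite /d divfK ?gt_eqF.
have hz : eps * z ^+ 2 <= e ^+ 2 * kk.
  apply: le_trans hEd; apply: le_trans hE; rewrite lerDl mulr_ge0 ?sqr_ge0//.
  by rewrite (le_trans (ltW nu0))// mtnu// sqr_ge0.
have hy : nu * y ^+ 2 <= e ^+ 2 * kk.
  apply: le_trans hEd; apply: le_trans hE.
  apply: (@le_trans _ _ (mt (`|B (u M t)| ^+ 2) * y ^+ 2)).
    by rewrite ler_wpM2r ?sqr_ge0// mtnu// sqr_ge0.
  by rewrite lerDr mulr_ge0 ?sqr_ge0// ltW.
have ee : 0 <= e ^+ 2 by exact: sqr_ge0.
split; (apply: small_of_sq => //; first exact: normr_ge0).
- have : eps * z ^+ 2 <= eps * e ^+ 2.
    by apply: (le_trans hz); rewrite mulrC ler_wpM2r// ge_min lexx.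
  by rewrite (ler_pM2l eps0).
- have : nu * y ^+ 2 <= nu * e ^+ 2.
    by apply: (le_trans hy); rewrite mulrC ler_wpM2r// ge_min lexx orbT.
  by rewrite (ler_pM2l nu0).
Qed.

Lemma u_cauchy : ucauchy u.
Proof.
apply: (ucauchy_primitive hip uv); first by have [] := weak_cauchy.
apply/cvg_ex; exists u0; rewrite (_ : (fun n => _) = fun n => P n u0); first exact: (cut_cvg cut).
by apply/funext => n.
Qed.

(* The part [P j] of the sequence converges because [O \o P j] is bounded; the
   remainder is small uniformly in [n]. *)
Lemma ucauchy_of_tail (O : H -> H) (f : nat -> R -> H) (K : R) :
  ucauchy f ->
  (forall j, exists C, forall n k t, 0 <= t ->
     `|(O (f n t) - O (Q j (f n t))) - (O (f k t) - O (Q j (f k t)))| <= C * `|f n t - f k t|) ->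
  (forall n j t, 0 <= t -> `|O (Q j (f n t))| ^+ 2 <= K * data_size A B u0 u1 (Q j)) ->
  ucauchy (fun n t => O (f n t)).
Proof.
move=> cf low tail T e e0; have e4 : 0 < (e / 4) ^+ 2 by rewrite exprn_gt0// divr_gt0.
have K1 : 0 < `|K| + 1 by rewrite ltr_wpDl.
have ek : 0 < (e / 4) ^+ 2 / (`|K| + 1) by rewrite divr_gt0.
have /cvgrPdist_le/(_ _ ek) [j _ hj] := data_tail.
have := hj j (leqnn j); rewrite /= sub0r normrN => dj.
have tl n t : 0 <= t -> `|O (Q j (f n t))| <= e / 4.
  move=> t0; apply: small_of_sq => //; first by rewrite divr_gt0.
  apply: le_trans (tail n j t t0) _; apply: le_trans (ler_norm _) _; rewrite normrM.
  apply: (@le_trans _ _ ((`|K| + 1) * ((e / 4) ^+ 2 / (`|K| + 1)))).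
    by rewrite ler_pM// lerDl.
  by rewrite mulrC divfK// gt_eqF.
have [C hC] := low j; have C1 : 0 < `|C| + 1 by rewrite ltr_wpDl.
have ec : 0 < e / 2 / (`|C| + 1) by rewrite !divr_gt0.
have [M hM] := cf T _ ec; exists M => n Mn t tT; have /andP[t0 _] := tT.
have h1 := hC M n t t0; have h2 := hM n Mn t tT.
have h3 := tl M t t0; have h4 := tl n t t0.
have h5 : C * `|f M t - f n t| <= e / 2.
  apply: (@le_trans _ _ ((`|C| + 1) * `|f M t - f n t|)).
    by rewrite ler_wpM2r// (le_trans (ler_norm _))// lerDl.
  by rewrite mulrC -ler_pdivlMr.
set x := O (f M t) in h1 *; set y := O (f n t) in h1 *.
set p := O (Q j (f M t)) in h1 h3; set q := O (Q j (f n t)) in h1 h4.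
have -> : x - y = (x - p - (y - q)) + (p - q).
  by rewrite opprB [q - y]addrC [x - p + _]addrACA [- p + q]addrC -[p - q]opprB addrK.
apply: le_trans (ler_normD _ _) _; have := ler_normB p q.
by lra.
Qed.

Let tails n j t : 0 <= t ->
  `|A (Q j (u n t))| ^+ 2 <= lcst * data_size A B u0 u1 (Q j) /\
  `|B (Q j (v n t))| ^+ 2 <= 2 * mu / eps * (lcst * data_size A B u0 u1 (Q j)).
Proof.
move=> t0; have w1 : 1 <= 1 + t by rewrite lerDl.
have h := filtered_bound (linQ j) (bdQ j) (fun x => PQ n j x) (@AQ j) (@BQ j) t0.
exact: (parts w1 (sqr_ge0 _) (sqr_ge0 _) (sqr_ge0 _) (sqr_ge0 _) h).
Qed.

Lemma Au_cauchy : ucauchy (fun n t => A (u n t)).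
Proof.
have dA n t := sol_domA (ssol n) t.
apply: (ucauchy_of_tail (K := lcst)) u_cauchy _ _.
- move=> j; exists j%:R => n k t _.
  have E x : dom A x -> A x - A (Q j x) = A (P j x).
    by move=> dx; have [_ ->] := AQ j dx; rewrite /Q opprB addrC subrK (cut_A cut j dx).
  rewrite !E//; have := cutA_lin_sub cut j (u n t) (u k t); rewrite /cutA => ->.
  exact: (cut_bdA cut).
- by move=> n j t t0; have [] := tails n j t0.
Qed.

Lemma Bv_cauchy : ucauchy (fun n t => B (v n t)).
Proof.
have dB n t := sol_domB (ssol n) t.
apply: (ucauchy_of_tail (K := 2 * mu / eps * lcst)) (weak_cauchy.1) _ _.
- move=> j; exists j.+1%:R => n k t _.
  have E x : dom B x -> B x - B (Q j x) = B (P j x).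
    by move=> dx; have [_ ->] := BQ j dx; rewrite /Q opprB addrC subrK (cut_B cut j dx).
  rewrite !E// (cutB_lin_sub cut); exact: (cutB_bd hip cut).
- by move=> n j t t0; rewrite -mulrA; have [] := tails n j t0.
Qed.

Let limit_op (O : @operator R H) (f : nat -> R -> H) (F K : R -> H) : op_closed O ->
  (forall n t, dom O (f n t)) -> ucvg f F -> ucvg (fun n t => O (f n t)) K ->
  (forall t, F t = F (rho t)) -> (forall t, K t = K (rho t)) ->
  (forall t, dom O (F t)) /\ (fun t => O (F t)) = K.
Proof.
move=> cO df fF OG Fr Gr.
have h t : 0 <= t -> dom O (F t) /\ O (F t) = K t.
  move=> t0; apply: (cO (fun n => f n t)) => //; first exact: ucvg_cvg fF t0.
  exact: (ucvg_cvg OG t0).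
split=> [t|]; first by rewrite Fr; have [] := h _ (rho_ge0 t).
by apply/funext => t; rewrite Fr Gr; have [] := h _ (rho_ge0 t).
Qed.

(** The integrand is cut off at time [n], which reduces the integral to a compact interval and the
    fundamental theorem of calculus; Fatou removes the cut in the limit. *)
Let rate_integral n : (\int[lebesgue_measure]_(s in half_line)
  ((fun s => (rate A B (u n) (v n) id s)%:E) \_ `[0%R, n%:R]%classic) s <=
  (2 * mu * LB)%:E)%E.
Proof.
have lin1 (b : R) (x y : H) : id (b *: x + y) = b *: id x + id y by [].
have bd1 (x : H) : `|id x| <= 1 * `|x| by rewrite mul1r.
have cr : continuous (rate A B (u n) (v n) id).
  exact: (rate_continuous hip cut (uv n) (vv1 n) (Pu n) (Pv n) lin1 bd1).
have [J CJ J0] := scalar_primitive cr.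
have hJ t : 0 <= t -> J t <= 2 * mu * LB.
  move=> t0; have := lya lin1 bd1 (fun=> erefl) (fun _ d => conj d erefl)
    (fun _ d => conj d erefl) CJ J0 t0 => /= h.
  have i1 : 0 <= eps * `|B (v n t)| ^+ 2 / (2 * mu).
    by rewrite divr_ge0 ?mulr_ge0 ?sqr_ge0// ltW.
  have i2 : 0 <= (1 + t) ^+ 2 * `|B (u n t)| ^+ 2 by rewrite mulr_ge0 ?sqr_ge0.
  have i3 : 0 <= 3 / nu * (`|u n t| ^+ 2 / 4) by rewrite mulr_ge0 ?divr_ge0 ?sqr_ge0// ltW.
  have i4 : 0 <= (1 + t) ^+ 4 * (eps * `|B (v n t)| ^+ 2 / (2 * mu) + `|A (u n t)| ^+ 2).
    by rewrite mulr_ge0 ?exprn_ge0 ?addr_ge0 ?sqr_ge0.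
  have : J t / (2 * mu) <= LB by rewrite /lyap_bound; move: h i2 i3 i4; lra.
  by rewrite ler_pdivrMr ?mulr_gt0// mulrC.
rewrite -integral_mkcondr setIidr; last first.
  by move=> s; rewrite /half_line /= !in_itv /= andbT => /andP[].
have [n0|n0] := posnP n.
  rewrite n0 set_itv1 integral_set1 lee_fin; apply: mulr_ge0 LB0.
  by apply: mulr_ge0 => //; exact: ltW.
have [cJ _ dJ] := CJ.
rewrite [leLHS](_ : _ = (J n%:R)%:E - (J 0)%:E)%E.
  by rewrite J0 sube0 lee_fin hJ.
apply: continuous_FTC2; first by rewrite ltr0n.
- exact: continuous_subspaceT.
- split.
  + move=> x; rewrite in_itv /= => /andP[x0 _]; have := dJ _ x0; by case.
  + exact/cvg_at_right_filter/cJ.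
  + exact/cvg_at_left_filter/cJ.
- move=> x; rewrite in_itv /= => /andP[x0 _]; rewrite derive1E.
  by apply: derive_val; exact: dJ.
Qed.

Lemma galerkin_limit : exists U V W, [/\ strong_sol A B mt eps U V W,
  U 0 = u0 /\ V 0 = u1,
  forall t, 0 <= t -> (1 + t) ^+ 4 * (eps * `|B (V t)| ^+ 2 / (2 * mu) + `|A (U t)| ^+ 2) +
    (1 + t) ^+ 2 * `|B (U t)| ^+ 2 + 3 / nu * (`|U t| ^+ 2 / 4) <= LB,
  forall t, 0 <= t -> (1 + t) ^+ 2 * `|V t| ^+ 2 <= VB &
  (\int[lebesgue_measure]_(s in half_line) (rate A B U V id s)%:E <= (2 * mu * LB)%:E)%E].
Proof.
have [U [cU uU Ur]] := ucauchy_ucvg (fun n => let: And3 h _ _ := uv n in h) u_cauchy.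
have [V [cV uV Vr]] := ucauchy_ucvg (fun n => let: And3 h _ _ := vv1 n in h) weak_cauchy.1.
have CB n := sol_B (ssol n).
have [BU [cBU uBU BUr]] := ucauchy_ucvg (fun n => let: And3 h _ _ := CB n in h) weak_cauchy.2.
have [BV [cBV uBV BVr]] := ucauchy_ucvg (fun n => let: And3 _ h _ := CB n in h) Bv_cauchy.
have [AU [cAU uAU AUr]] := ucauchy_ucvg (fun n => sol_A (ssol n)) Au_cauchy.
have dA n t := sol_domA (ssol n) t.
have [dAU eAU] := limit_op (cut_closedA cut) dA uU uAU Ur AUr.
have [_ eBU] := limit_op (cut_closedB cut) (fun n t => cut_domAB cut (dA n t)) uU uBU Ur BUr.
have [dBV eBV] := limit_op (cut_closedB cut) (fun n => sol_domB (ssol n)) uV uBV Vr BVr.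
(* The acceleration is defined by the limit equation; [uW] then shows that the approximate
   accelerations tend to it, so no separate Cauchy estimate is required. *)
pose W t := - eps^-1 *: ((1 + rho t)^-1 *: V t + mt (`|BU t| ^+ 2) *: AU t).
have w0 t : 0 < 1 + rho t by rewrite ltr_wpDr// rho_ge0.
have cW : continuous W.
  move=> t; apply: cvgZl_tmp; apply: cvgD; apply: cvgZ.
  - apply: cvgV; first by rewrite gt_eqF.
    by apply: cvgD; [exact: cvg_cst|exact: rho_continuous].
  - exact: cV.
  - exact: (mt_continuous_norm dmt cBU).
  - exact: cAU.
have BUN t : 0 <= t -> `|BU t| <= N.
  by move=> t0; apply: (cvgn_norm_le (ucvg_cvg uBU t0)) => n; exact: B_bound.
have AUa t : 0 <= t -> `|AU t| <= a.
  by move=> t0; apply: (cvgn_norm_le (ucvg_cvg uAU t0)) => n; exact: A_bound.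
have eqW n t : 0 <= t -> v1 n t =
    - eps^-1 *: ((1 + t)^-1 *: v n t + mt (`|B (u n t)| ^+ 2) *: A (u n t)).
  move=> t0; have [/ltW sN _] := coef n t0.
  have := equ n t0; rewrite /trunc min_l// => /eqP; rewrite -addrA addr_eq0 => /eqP h.
  by rewrite scaleNr -scalerN -h scalerA mulVf ?gt_eqF// scale1r.
have uW : ucvg v1 W.
  (* Errors of size [d] in the velocity, in [A u] and in the coefficient contribute the three
     summands of [K]. *)
  move=> T e e0; pose K := 1 + mu + 2 * L * N * a.
  have a0 : 0 <= a by rewrite addr_ge0.
  have la0 : 0 <= 2 * L * N * a.
    by apply: mulr_ge0 a0; apply: mulr_ge0 (ltW N0); exact: mulr_ge0.
  have K0 : 0 < K by rewrite /K ltr_wpDr// addr_gt0.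
  pose d := e * eps / K; have d0 : 0 < d by rewrite divr_gt0// mulr_gt0.
  have [M1 h1] := uV T d d0; have [M2 h2] := uBU T d d0; have [M3 h3] := uAU T d d0.
  exists (maxn M1 (maxn M2 M3)) => n; rewrite !geq_max => /and3P[n1 n2 n3] t tT.
  have := h1 n n1 t tT; have := h2 n n2 t tT; have := h3 n n3 t tT.
  have /andP[t0 _] := tT; rewrite (eqW _ _ t0) /W (rho_id t0).
  have bn := B_bound n t0; have bU := BUN t t0; have aU := AUa t t0.
  set x := A (u n t); set y := B (u n t) in bn *; set z := v n t => hx hy hz.
  have ci r : 0 <= r <= N -> 0 <= r ^+ 2 <= N ^+ 2.
    by move=> /andP[r0 rN]; rewrite sqr_ge0 lerXn2r ?nnegrE ?(ltW N0).
  have cmu : `|mt (`|y| ^+ 2)| <= mu.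
    rewrite ger0_norm ?mtmu ?ci ?normr_ge0//.
    by rewrite (le_trans (ltW nu0))// mtnu// sqr_ge0.
  have cL : `|mt (`|y| ^+ 2) - mt (`|BU t| ^+ 2)| <= L * (2 * N * d).
    apply: (le_trans (lipschitz_of_derive dmt m1L (ci _ _) (ci _ _))); rewrite ?normr_ge0//.
    apply: ler_wpM2l => //; rewrite subr_sqr normrM mulrC.
    apply: ler_pM => //; first by rewrite ger0_norm ?addr_ge0//; lra.
    exact: le_trans (ler_dist_dist _ _) hy.
  rewrite -scalerBr normrZ normrN normfV (gtr0_norm eps0) mulrC ler_pdivrMr//.
  have -> : (1 + t)^-1 *: z + mt (`|y| ^+ 2) *: x - ((1 + t)^-1 *: V t + mt (`|BU t| ^+ 2) *: AU t)
    = (1 + t)^-1 *: (z - V t) + (mt (`|y| ^+ 2) *: (x - AU t) +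
      (mt (`|y| ^+ 2) - mt (`|BU t| ^+ 2)) *: AU t).
    by rewrite !scalerBr scalerBl subrKA opprD addrACA.
  apply: (@le_trans _ _ (d + (mu * d + L * (2 * N * d) * a))); last first.
    have Kd : K * d = e * eps by rewrite /d mulrC divfK// gt_eqF.
    by rewrite -Kd /K; lra.
  apply: le_trans (ler_normD _ _) _; apply: lerD.
    rewrite normrZ; apply: le_trans hz; rewrite ler_piMl// normfV.
    by rewrite ger0_norm ?addr_ge0// invf_le1 ?lerDl// ltr_wpDr.
  apply: le_trans (ler_normD _ _) _; rewrite !normrZ.
  by apply: lerD; apply: ler_pM.
have CU := ucvg_C1on hip uv cU cV uU uV.
have CV := ucvg_C1on hip vv1 cV cW uV uW.
have CBU := ucvg_C1on hip CB cBU cBV uBU uBV.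
exists U, V, W; split.
- split=> //; first by rewrite eBU eBV.
    by rewrite eAU.
  move=> t t0; have -> : B (U t) = BU t by rewrite -eBU.
  have -> : A (U t) = AU t by rewrite -eAU.
  rewrite /W (rho_id (ltW t0)) scalerA mulrN divff ?gt_eqF// scaleN1r.
  by rewrite -addrA addNr.
- split.
    apply: (cvgn_unique (ucvg_cvg uU (lexx 0))).
    rewrite (_ : (fun n => u n 0) = fun n => P n u0); first exact: (cut_cvg cut).
    by apply/funext => n.
  apply: (cvgn_unique (ucvg_cvg uV (lexx 0))).
  rewrite (_ : (fun n => v n 0) = fun n => P n u1); first exact: (cut_cvg cut).
  by apply/funext => n.
- move=> t t0; have -> : B (U t) = BU t by rewrite -eBU.
  have -> : A (U t) = AU t by rewrite -eAU.
  have -> : B (V t) = BV t by rewrite -eBV.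
  apply: (@cvgn_le _ (fun n => _)) (fun n => full n t0).
  apply: cvgD; last first.
    by apply: cvgMr; apply: cvgMl; apply: cvg_normsq; exact: ucvg_cvg uU t0.
  apply: cvgD; last by apply: cvgMr; apply: cvg_normsq; exact: ucvg_cvg uBU t0.
  apply: cvgMr; apply: cvgD; last by apply: cvg_normsq; exact: ucvg_cvg uAU t0.
  by apply: cvgMl; apply: cvgMr; apply: cvg_normsq; exact: ucvg_cvg uBV t0.
- move=> t t0; apply: (@cvgn_le _ (fun n => _)) (fun n => vel n t0).
  by apply: cvgMr; apply: cvg_normsq; exact: ucvg_cvg uV t0.
- have rc n : continuous (rate A B (u n) (v n) id).
    have lin1 (b : R) (x y : H) : id (b *: x + y) = b *: id x + id y by [].
    have bd1 (x : H) : `|id x| <= 1 * `|x| by rewrite mul1r.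
    exact: (rate_continuous hip cut (uv n) (vv1 n) (Pu n) (Pv n) lin1 bd1).
  pose g n : measurableTypeR R -> \bar R :=
    (fun s => (rate A B (u n) (v n) id s)%:E) \_ `[0%R, n%:R]%classic.
  have g_ge0 n s : 0 <= s -> 0 <= rate A B (u n) (v n) id s.
    move=> s0; have w0' : 0 <= 1 + s by rewrite addr_ge0.
    by apply: addr_ge0; apply: mulr_ge0; rewrite ?exprn_ge0// addr_ge0 ?sqr_ge0.
  apply: (@fatou_le_cst _ (measurableTypeR R) R lebesgue_measure half_line g).
  + by rewrite /half_line; exact: measurable_itv.
  + move=> n; apply: measurable_funTS; apply: (measurable_restrictT _ _).1 => //.
    apply/measurable_EFinP; apply: measurable_funTS.
    exact: continuous_measurable_fun.
  + move=> n s; rewrite /half_line /= in_itv /= andbT => s0.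
    by rewrite /g patchE; case: ifPn => // _; rewrite lee_fin g_ge0.
  + move=> s; rewrite /half_line /= in_itv /= andbT => s0.
    have h : (rate A B (u n) (v n) id s)%:E @[n --> \oo] --> (rate A B U V id s)%:E.
      apply: (@cvg_comp _ _ _ _ EFin _ (nbhs (rate A B U V id s))) => //.
      rewrite /rate; have -> : B (U s) = BU s by rewrite -eBU.
      have -> : A (U s) = AU s by rewrite -eAU.
      have -> : B (V s) = BV s by rewrite -eBV.
      by apply: cvgD; apply: cvgMr; apply: cvgD; apply: cvg_normsq;
        [exact: ucvg_cvg uBV s0|exact: ucvg_cvg uAU s0|
         exact: ucvg_cvg uV s0|exact: ucvg_cvg uBU s0].
    apply: cvg_trans h; apply: near_eq_cvg; near=> n.
    rewrite /g patchE mem_set//= in_itv /= s0 /=.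
    by near: n; exact: nbhs_infty_ger.
  + exact: rate_integral.
Unshelve. all: by end_near. Qed.

End GalerkinLimit.
(** * Functions on the half-line *)

Section HalfLineDerivative.
Context {R : realType}.
Implicit Types (s t e : R).

Lemma mem_half_line s : half_line s <-> 0 <= s.
Proof. by rewrite /half_line /= in_itv /= andbT. Qed.

Lemma near_half_line (Q : set R) t :
  (\forall s \near within half_line (nbhs t), Q s) <->
  exists2 d, 0 < d & forall s, 0 <= s -> `|s - t| < d -> Q s.
Proof.
split=> [/nbhs_ballP[d /= d0 hd]|[d d0 hd]].
  exists d => // s s0 sd; apply: hd; last exact/mem_half_line.
  by rewrite /ball /= distrC.
apply/nbhs_ballP; exists d => // s; rewrite /ball /= distrC => sd /mem_half_line s0.
exact: hd.
Qed.

Lemma near_half_line_punctured (Q : set R) t :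
  (\forall s \near within half_line (dnbhs t), Q s) <->
  exists2 d, 0 < d & forall s, 0 <= s -> s != t -> `|s - t| < d -> Q s.
Proof.
split=> [/nbhs_ballP[d /= d0 hd]|[d d0 hd]].
  exists d => // s s0 st sd; apply: hd => //; last exact/mem_half_line.
  by rewrite /ball /= distrC.
apply/nbhs_ballP; exists d => // s; rewrite /ball /= distrC => sd st /mem_half_line s0.
exact: hd.
Qed.

Lemma half_line_punctured_proper t : 0 <= t -> ProperFilter (within half_line (dnbhs t)).
Proof.
move=> t0; apply: Build_ProperFilter_ex => Q /near_half_line_punctured [d d0 hd].
have d2 : 0 < d / 2 by rewrite divr_gt0.
exists (t + d / 2); apply: hd.
- by rewrite addr_ge0// ltW.
- by rewrite -subr_eq0 addrAC subrr add0r gt_eqF.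
- by rewrite addrAC subrr add0r gtr0_norm//; lra.
Qed.

Variable V : normedModType R.
Implicit Types (f g : R -> V) (l : V).

Lemma diff_quotient_cvgP f t l :
  diff_quotient f t s @[s --> within half_line (dnbhs t)] --> l <->
  forall e, 0 < e -> exists2 d, 0 < d & forall s, 0 <= s -> `|s - t| < d ->
    `|f s - f t - (s - t) *: l| <= e * `|s - t|.
Proof.
have E s : s != t -> `|l - diff_quotient f t s| * `|s - t| = `|f s - f t - (s - t) *: l|.
  move=> st; rewrite distrC mulrC -normrZ scalerBr /diff_quotient scalerA mulfV ?scale1r//.
  by rewrite subr_eq0.
split=> [/cvgrPdist_le h e /h /near_half_line_punctured[d d0 hd]|h].
  exists d => // s s0 sd; have [->|st] := eqVneq s t.
    by rewrite !subrr scale0r subrr !normr0 mulr0.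
  by rewrite -E// ler_wpM2r// hd.
apply/cvgrPdist_le => e /h [d d0 hd]; apply/near_half_line_punctured.
exists d => // s s0 st sd; have := hd s s0 sd; rewrite -E// ler_pM2r//.
by rewrite normr_gt0 subr_eq0.
Qed.

Lemma derive_hlP f t l : 0 <= t ->
  diff_quotient f t s @[s --> within half_line (dnbhs t)] --> l ->
  derivable_hl f t /\ derive_hl f t = l.
Proof.
move=> t0 h; have FF := half_line_punctured_proper t0.
by split; [apply/cvg_ex; exists l|apply: cvg_lim h; exact: norm_hausdorff].
Qed.

Lemma continuous_rho_hl f :
  (forall t, 0 <= t -> f s @[s --> within half_line (nbhs t)] --> f t) ->
  continuous (fun t => f (rho t)).
Proof.
move=> cf t; apply/cvgrPdist_le => e e0.
have := cf _ (rho_ge0 t); move=> /cvgrPdist_le/(_ _ e0)/near_half_line[d d0 hd].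
have := @rho_continuous R t; move=> /cvgrPdist_lt/(_ _ d0); apply: filterS => s sd.
by apply: hd; [exact: rho_ge0|rewrite distrC].
Qed.

Lemma continuous_hl_of f g : continuous g -> (forall t, 0 <= t -> f t = g t) ->
  forall t, 0 <= t -> f s @[s --> within half_line (nbhs t)] --> f t.
Proof.
move=> cg fg t t0; apply/cvgrPdist_le => e e0; apply/near_half_line.
have := cg t; move=> /cvgrPdist_le/(_ _ e0)/nbhs_ballP[d /= d0 hd].
by exists d => // s s0 sd; rewrite !fg//; apply: hd; rewrite /ball /= distrC.
Qed.

(** Passage from one-sided limits on the half-line to the whole-line representatives used in the
    construction. *)
Lemma C1on_of_hl f g :
  (forall t, 0 <= t -> diff_quotient f t s @[s --> within half_line (dnbhs t)] --> g t) ->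
  (forall t, 0 <= t -> g s @[s --> within half_line (nbhs t)] --> g t) ->
  C1on (fun t => f (rho t)) (fun t => g (rho t)).
Proof.
move=> df cg; split; last 1 first.
- move=> t t0; apply/is_derive_epsP => e e0.
  have /(_ _ e0)[d d0 hd] := iffLR (diff_quotient_cvgP _ _ _) (df t (ltW t0)).
  exists (Num.min d t); first by rewrite lt_min d0.
  move=> s; rewrite lt_min => /andP[sd st].
  have s0 : 0 <= s by move: st; rewrite ltr_norml => /andP[]; lra.
  by rewrite !(rho_id (ltW t0)) (rho_id s0); exact: hd.
- apply: continuous_rho_hl => t t0; apply/cvgrPdist_le => e e0; apply/near_half_line.
  have [d d0 hd] := iffLR (diff_quotient_cvgP _ _ _) (df t t0) 1 ltr01.
  have K0 : 0 < 1 + `|g t| by rewrite ltr_pwDl.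
  exists (Num.min d (e / (1 + `|g t|))); first by rewrite lt_min d0 divr_gt0.
  move=> s s0; rewrite lt_min => /andP[sd]; rewrite ltr_pdivlMr// => se.
  have := hd s s0 sd; rewrite mul1r => h; rewrite distrC.
  have -> : f s - f t = (f s - f t - (s - t) *: g t) + (s - t) *: g t by rewrite subrK.
  apply: le_trans (ler_normD _ _) _; rewrite normrZ.
  by move: h se; lra.
- exact: continuous_rho_hl.
Qed.

Lemma C1on_of_C1_hl f : C1_hl f -> C1on (fun t => f (rho t)) (fun t => derive_hl f (rho t)).
Proof.
move=> [df cf]; apply: C1on_of_hl.
  by move=> t t0; exact: df.
move=> t t0; have /subspace_continuousP := cf; apply; exact/mem_half_line.
Qed.

End HalfLineDerivative.

Section HalfLineSolutions.
Context {R : realType} {H : completeNormedModType R} {ip : {dot H for idfun}}.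
Hypothesis hip : induces_norm ip.
Implicit Types (s t e : R) (O : @operator R H).

Lemma C1_hl_of_C1on (f f1 u : R -> H) : C1on f f1 -> (forall t, 0 <= t -> u t = f t) ->
  [/\ C1_hl u, forall t, 0 <= t -> derive_hl u t = f1 t &
  forall t, 0 <= t -> diff_quotient u t s @[s --> within half_line (dnbhs t)] --> f1 t].
Proof.
move=> Cf uf; have [_ cf1 _] := Cf.
have dq t : 0 <= t -> diff_quotient u t s @[s --> within half_line (dnbhs t)] --> f1 t.
  move=> t0; apply/diff_quotient_cvgP => e e0; have [d d0 hd] := C1on_eps hip Cf t0 e0.
  by exists d => // s s0 sd; rewrite !uf//; exact: hd.
have du t : 0 <= t -> derive_hl u t = f1 t by move=> t0; have [] := derive_hlP t0 (dq t t0).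
split=> //; split; first by move=> t t0; have [] := derive_hlP t0 (dq t t0).
apply/subspace_continuousP => t /mem_half_line t0.
exact: (continuous_hl_of cf1 du).
Qed.

Lemma graph_norm_bounds O x :
  [/\ `|x| <= graph_norm O x, `|O x| <= graph_norm O x & graph_norm O x <= `|x| + `|O x|].
Proof.
rewrite /graph_norm; have x0 := sqr_ge0 `|x|; have y0 := sqr_ge0 `|O x|; split.
- by rewrite -[X in X <= _]ger0_norm// -sqrtr_sqr ler_wsqrtr// lerDl.
- by rewrite -[X in X <= _]ger0_norm// -sqrtr_sqr ler_wsqrtr// lerDr.
- rewrite -[X in _ <= X]ger0_norm ?addr_ge0// -sqrtr_sqr ler_wsqrtr//.
  by rewrite sqrrD lerD2r lerDl mulrn_wge0// mulr_ge0.
Qed.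

Lemma graph_norm_cvg0P (F : set_system R) {FF : Filter F} O (f : R -> H) :
  graph_norm O (f s) @[s --> F] --> (0 : R) <->
  f s @[s --> F] --> 0 /\ O (f s) @[s --> F] --> 0.
Proof.
split=> [/cvgrPdist_le h|[h1 h2]].
  split; apply/cvgrPdist_le => e /h; apply: filterS => s /=.
    have [h1 _ _] := graph_norm_bounds O (f s); rewrite !sub0r !normrN => h2.
    exact: (le_trans h1 (le_trans (ler_norm _) h2)).
  have [_ h1 _] := graph_norm_bounds O (f s); rewrite !sub0r !normrN => h2.
  exact: (le_trans h1 (le_trans (ler_norm _) h2)).
apply/cvgrPdist_le => e e0; have e2 : 0 < e / 2 by rewrite divr_gt0.
move: h1 h2 => /cvgrPdist_le/(_ _ e2) h1 /cvgrPdist_le/(_ _ e2) h2.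
near=> s; rewrite sub0r normrN ger0_norm ?sqrtr_ge0//.
have [_ _ h] := graph_norm_bounds O (f s); apply: (le_trans h).
have i1 : `|f s| <= e / 2 by rewrite -normrN -sub0r; near: s.
have i2 : `|O (f s)| <= e / 2 by rewrite -normrN -sub0r; near: s.
by lra.
Unshelve. all: by end_near. Qed.

Lemma C0_domP O (u : R -> H) : op_linear O -> C0_dom O u <->
  forall t, 0 <= t -> [/\ dom O (u t), u s @[s --> within half_line (nbhs t)] --> u t &
    O (u s) @[s --> within half_line (nbhs t)] --> O (u t)].
Proof.
move=> lO.
have nd (Q : set R) t : (forall s, 0 <= s -> Q s) -> \forall s \near within half_line (nbhs t), Q s.
  by move=> hQ; apply/near_half_line; exists 1 => // s s0 _; exact: hQ.
have E t : (forall s, 0 <= s -> dom O (u s)) -> 0 <= t ->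
    graph_norm O (u s - u t) @[s --> within half_line (nbhs t)] --> (0 : R) <->
    u s @[s --> within half_line (nbhs t)] --> u t /\
    O (u s) @[s --> within half_line (nbhs t)] --> O (u t).
  move=> du t0.
  have e s : 0 <= s -> O (u s - u t) = O (u s) - O (u t).
    by move=> s0; have [] := op_linearB lO (du _ s0) (du _ t0).
  rewrite graph_norm_cvg0P; split=> -[/subr_cvg0 h1 h2]; split => //.
    apply/subr_cvg0; apply: cvg_trans h2; apply: near_eq_cvg.
    by apply: nd => s s0; rewrite e.
  move/subr_cvg0 : h2; apply: cvg_trans; apply: near_eq_cvg.
  by apply: nd => s s0; rewrite e.
split=> h t t0.
  have du s (s0 : 0 <= s) := (h s s0).1.
  by have [h1 h2] := iffLR (E t du t0) (h t t0).2; split=> //; exact: du.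
have du s : 0 <= s -> dom O (u s) by move=> s0; have [] := h s s0.
have [h0 h1 h2] := h t t0; split=> //; exact/(E t du t0).
Qed.

Lemma C1_domP O (u v : R -> H) : op_linear O -> C0_dom O u -> C0_dom O v ->
  forall t, 0 <= t ->
  graph_norm O (diff_quotient u t s - v t) @[s --> within half_line (dnbhs t)] --> (0 : R) <->
  diff_quotient u t s @[s --> within half_line (dnbhs t)] --> v t /\
  diff_quotient (fun r => O (u r)) t s @[s --> within half_line (dnbhs t)] --> O (v t).
Proof.
move=> lO du dv t t0.
have E s : 0 <= s -> O (diff_quotient u t s - v t) = diff_quotient (fun r => O (u r)) t s - O (v t).
  move=> s0; have [d1 e1] := op_linearB lO (du _ s0).1 (du _ t0).1.
  have [d2 e2] := op_linearZ (s - t)^-1 lO d1.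
  by have [_ ->] := op_linearB lO d2 (dv _ t0).1; rewrite e2 e1.
have nd (Q : set R) : (forall s, 0 <= s -> Q s) ->
    \forall s \near within half_line (dnbhs t), Q s.
  by move=> hQ; apply/near_half_line_punctured; exists 1 => // s s0 _ _; exact: hQ.
rewrite graph_norm_cvg0P; split=> -[/subr_cvg0 h1 h2]; split => //.
  apply/subr_cvg0; apply: cvg_trans h2; apply: near_eq_cvg.
  by apply: nd => s s0; rewrite E.
move/subr_cvg0 : h2; apply: cvg_trans; apply: near_eq_cvg.
by apply: nd => s s0; rewrite E.
Qed.

Variables (A : @operator R H) (P : nat -> H -> H).
Local Notation B := (op_pow ip A 2^-1).
Hypothesis cut : cutoffs ip A B P.
Variables (m mt : R -> R) (eps : R) (u0 u1 : H).
Hypothesis mtE : forall s, 0 <= s -> mt s = m s.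

Lemma strong_sol_of_kirchhoff (u : R -> H) : kirchhoff_solution ip A m u0 u1 eps u ->
  strong_sol A B mt eps (fun t => u (rho t)) (fun t => derive_hl u (rho t))
    (fun t => derive_hl (derive_hl u) (rho t)).
Proof.
move=> [[[Cu Cu'] [Bu [v [Bv uv]]] Au] [eq _ _]].
have lA := cut_linA cut; have lB := cut_linB cut.
have dq t (t0 : 0 <= t) := iffLR (C1_domP lB Bu Bv t0) (uv t t0).
(* [C1_dom] provides the derivative in the graph norm existentially; since that norm dominates the
   norm of [H], uniqueness of limits identifies it. *)
have vE t : 0 <= t -> derive_hl u t = v t.
  by move=> t0; have [h _] := dq t t0; have [] := derive_hlP t0 h.
have Av := iffLR (C0_domP u lA) Au.
have Bv' := iffLR (C0_domP v lB) Bv.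
have B_v : (fun t => B (derive_hl u (rho t))) = fun t => B (v (rho t)).
  by apply/funext => t; rewrite vE// rho_ge0.
split.
- exact: C1on_of_C1_hl.
- exact: C1on_of_C1_hl.
- by move=> t; have [] := Av _ (rho_ge0 t).
- by move=> t; rewrite vE ?rho_ge0//; have [] := Bv' _ (rho_ge0 t).
- rewrite B_v; apply: (C1on_of_hl (f := fun t => B (u t)) (g := fun t => B (v t))).
    by move=> t t0; have [] := dq t t0.
  by move=> t t0; have [] := Bv' t t0.
- apply: (continuous_rho_hl (f := fun t => A (u t))) => t t0.
  by have [] := Av t t0.
- by move=> t /ltW t0; rewrite !(rho_id t0) mtE ?sqr_ge0//; exact: eq.
Qed.

Lemma kirchhoff_of_strong_sol (u v w : R -> H) (m1 : R -> R) :
  (forall s, -1 < s -> is_derive s 1 mt (m1 s)) ->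
  strong_sol A B mt eps u v w -> u 0 = u0 -> v 0 = u1 ->
  kirchhoff_solution ip A m u0 u1 eps u /\ (forall t, 0 <= t -> derive_hl u t = v t).
Proof.
move=> dmt [Cu Cv dA dB CB cA eq] hu0 hu1.
have lA := cut_linA cut; have lB := cut_linB cut.
have [cu cv _] := Cu; have [_ cw _] := Cv; have [cBu cBv _] := CB.
have [Cu' duE dqu] := C1_hl_of_C1on Cu (fun _ _ => erefl).
have [Cv' ddu _] := C1_hl_of_C1on Cv duE.
have [_ _ dqB] := C1_hl_of_C1on CB (fun _ _ => erefl).
have hl (f : R -> H) : continuous f ->
    forall t, 0 <= t -> f s @[s --> within half_line (nbhs t)] --> f t.
  by move=> cf; exact: (continuous_hl_of cf).
have Bu : C0_dom B u.
  apply/(C0_domP _ lB) => t t0; split; [exact: (cut_domAB cut (dA t))|exact: hl|].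
  exact: (hl (fun t => B (u t))).
have Bv : C0_dom B v.
  apply/(C0_domP _ lB) => t t0; split; [exact: dB|exact: hl|].
  exact: (hl (fun t => B (v t))).
split=> //; split; split => //.
- split=> //; exists v; split=> // t t0; apply/(C1_domP lB Bu Bv t0).
  by split; [exact: dqu|exact: dqB].
- apply/(C0_domP _ lA) => t t0; split; [exact: dA|exact: hl|].
  exact: (hl (fun t => A (u t))).
- move=> t t0; rewrite ddu// duE// -mtE ?sqr_ge0//.
  have [tp|] := ltP 0 t; first exact: eq.
  rewrite le_eqVlt ltNge t0 orbF => /eqP ->.
  (* At time 0 the equation is the limit of the equations at times 1/(n+1); [rho] keeps the friction
     continuous at negative arguments. *)
  pose F s := eps *: w s + (1 + rho s)^-1 *: v s + mt (`|B (u s)| ^+ 2) *: A (u s).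
  have cF : continuous F.
    move=> s; apply: cvgD; [apply: cvgD|]; [exact: cvgZl_tmp (cw s)| |].
      apply: cvgZ (cv s); apply: cvgV; first by rewrite gt_eqF// ltr_wpDr// rho_ge0.
      by apply: cvgD; [exact: cvg_cst|exact: rho_continuous].
    apply: cvgZ (cA s); exact: (mt_continuous_norm dmt cBu).
  have h : F n.+1%:R^-1 @[n --> \oo] --> F 0.
    apply: (@cvg_comp _ _ _ _ F _ (nbhs (0 : R))); last exact: cF.
    exact: cvg_harmonic.
  have := cvgn_unique h; rewrite /F rho_id//; apply.
  apply: cvg_near_cst; apply: nearW => n.
  by rewrite rho_id ?invr_ge0//; apply: eq; rewrite invr_gt0.
- by rewrite duE.
Qed.

(** The solutions are arbitrary, so none of the decay estimates is available: the constants of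
    [stability] come from compactness of the interval up to [t]. The initial energy is zero, which
    equates the velocities first and then the positions. *)
Lemma strong_sol_unique (m1 : R -> R) (nu : R) (u v w u' v' w' : R -> H) :
  (forall s, -1 < s -> is_derive s 1 mt (m1 s)) -> continuous m1 -> 0 < eps -> 0 < nu ->
  (forall s, 0 <= s -> nu <= mt s) ->
  strong_sol A B mt eps u v w -> strong_sol A B mt eps u' v' w' ->
  u 0 = u' 0 -> v 0 = v' 0 -> forall t, 0 <= t -> u t = u' t /\ v t = v' t.
Proof.
move=> dmt cm1 eps0 nu0 mtnu su su' uu vv.
have vE t : 0 <= t -> v t = v' t.
  move=> t0; have [cB cB' _] := sol_B su; have [cBu' _ _] := sol_B su'.
  have [_ cv _] := sol_C1 su.
  have [N1 N10 hN1] := bounded_segment t cB; have [N2 N20 hN2] := bounded_segment t cBu'.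
  have [a a0 ha] := bounded_segment t (sol_A su').
  pose N := Num.max N1 N2; have N0 : 0 <= N by rewrite le_max N10.
  have [L L0 hL] := bounded_segment (N ^+ 2) cm1.
  have cG : continuous (fun s => m1 (`|B (u s)| ^+ 2) * (2 * ip (A (u s)) (v s))).
    move=> s; apply: cvgM.
      apply: (@continuous_comp _ _ _ (fun s => `|B (u s)| ^+ 2) m1); last exact: cm1.
      by apply: cvg_normsq; exact: cB.
    by apply: cvgMr; apply: (ip_cvg hip); [exact: (sol_A su)|exact: cv].
  have [G G0 hG] := bounded_segment t cG.
  have tt : 0 <= t <= t by rewrite t0 lexx.
  have := stability hip cut dmt eps0 su su' nu0 mtnu L0 (lipschitz_of_derive dmt hL) N0 a0 G0
    _ _ ha _ tt; cbv beta zeta.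
  rewrite uu vv !subrr !normr0 expr0n !mulr0 addr0 mul0r => h.
  have : eps * `|v t - v' t| ^+ 2 <= 0.
    apply: le_trans (h _ _ _); first 1 last.
    - by move=> s sT; rewrite le_max hN1.
    - by move=> s sT; rewrite le_max hN2// orbT.
    - by move=> s /andP[s0 sT]; rewrite hG// !ltW.
    - rewrite lerDl mulr_ge0 ?sqr_ge0//.
      by rewrite (le_trans (ltW nu0))// mtnu// sqr_ge0.
  rewrite pmulr_rle0// => {}h; apply/eqP; rewrite -subr_eq0 -normr_eq0 -sqrf_eq0.
  by rewrite eq_le h sqr_ge0.
move=> t t0; split; last exact: vE.
have C := C1onD (sol_C1 su) (C1on_linear (L := -%R) (a := 1) _ _ (sol_C1 su')).
have := C1_increment hip (v := 0) (M := 0) (C _ _) (lexx 0) t0.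
rewrite uu subrr subr0 scaler0 subr0 mul0r => h; apply/eqP.
rewrite -subr_eq0 -normr_le0; apply: h.
- by move=> b x y; rewrite opprD scalerN.
- by move=> x; rewrite normrN mul1r.
- by move=> r /andP[/ltW r0 _]; rewrite vE// subrr subr0 normr0.
Qed.

End HalfLineSolutions.

(** * Existence for small eps and the integral estimates *)

Lemma strong_solution_exists {R : realType} {H : completeNormedModType R}
    {ip : {dot H for idfun}} (A B : @operator R H) (P : nat -> H -> H)
    (mt m1 : R -> R) (nu mu L eps : R) (u0 u1 : H) :
  induces_norm ip -> cutoffs ip A B P ->
  (forall s : R, -1 < s -> is_derive s 1 mt (m1 s)) ->
  0 < nu -> (forall s, 0 <= s -> nu <= mt s) -> 1 <= mu ->
  (forall s, 0 <= s <= enrg_radius B nu u0 u1 ^+ 2 -> mt s <= mu) -> 0 <= L ->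
  (forall s, 0 <= s <= enrg_radius B nu u0 u1 ^+ 2 -> `|m1 s| <= L) ->
  dom A u0 -> dom B u1 -> 0 < eps -> eps <= 8^-1 -> eps * (12 * mu) <= nu ->
  eps * (8 * L * (lyap_bound A B nu u0 u1 + vel_bound A B nu mu u0 u1)) <= nu ->
  exists U V W, [/\ strong_sol A B mt eps U V W,
  U 0 = u0 /\ V 0 = u1,
  forall t, 0 <= t -> (1 + t) ^+ 4 * (eps * `|B (V t)| ^+ 2 / (2 * mu) + `|A (U t)| ^+ 2) +
    (1 + t) ^+ 2 * `|B (U t)| ^+ 2 + 3 / nu * (`|U t| ^+ 2 / 4) <= lyap_bound A B nu u0 u1,
  forall t, 0 <= t -> (1 + t) ^+ 2 * `|V t| ^+ 2 <= vel_bound A B nu mu u0 u1 &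
  (\int[lebesgue_measure]_(s in half_line) (rate A B U V id s)%:E <=
    (2 * mu * lyap_bound A B nu u0 u1)%:E)%E].
Proof.
move=> hip cut dmt nu0 mtnu mu1 mtmu L0 m1L du0 du1 eps0 eps8 epsnu epsL.
have N0 : 0 < enrg_radius B nu u0 u1.
  rewrite /enrg_radius mulr_gt0// ltr_wpDl// addr_ge0 ?sqr_ge0//.
  by rewrite divr_ge0 ?sqr_ge0// ltW.
have ex n := galerkin_exists hip cut dmt nu0 mtnu mu1 mtmu L0 m1L N0 eps0 u0 u1 n.
have [u /choice[v /choice[v1 h]]] := choice ex.
apply: (@galerkin_limit R H ip hip A B P cut mt m1 nu mu L u0 u1 dmt nu0 mtnu mu1 mtmu L0 m1L
  du0 du1 eps eps0 eps8 epsnu epsL u v v1).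
- by move=> n; have [] := h n.
- by move=> n; have [] := h n.
- by move=> n t; have [_ _ []] := h n.
- by move=> n t; have [_ _ []] := h n.
- by move=> n; have [_ _ _ []] := h n.
- by move=> n; have [_ _ _ []] := h n.
- by move=> n t t0; have [_ _ _ _ ] := h n; apply.
Qed.

Lemma rate_integral_parts {R : realType} {H : completeNormedModType R}
    (A B : @operator R H) (mt : R -> R) (eps K : R)
    (U V W : R -> H) : strong_sol A B mt eps U V W ->
  (\int[lebesgue_measure]_(s in half_line) (rate A B U V id s)%:E <= K%:E)%E ->
  (\int[lebesgue_measure]_(s in half_line)
     ((1 + s) * (`|V s| ^+ 2 + `|B (U s)| ^+ 2))%:E <= K%:E)%E /\
  (\int[lebesgue_measure]_(s in half_line)
     ((1 + s) ^+ 3 * (`|B (V s)| ^+ 2 + `|A (U s)| ^+ 2))%:E <= K%:E)%E.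
Proof.
move=> sU hK.
have [_ cV _] := sol_C1 sU; have [cBU cBV _] := sol_B sU; have cAU := sol_A sU.
have cw : continuous (fun s : R => 1 + s).
  by move=> s; apply: cvgD; [exact: cvg_cst|exact: cvg_id].
have cn (f : R -> H) : continuous f -> continuous (fun s => `|f s| ^+ 2).
  by move=> cf s; apply: cvg_normsq; exact: cf.
have ms (f : R -> R) : continuous f ->
    measurable_fun (half_line : set (measurableTypeR R)) (fun s => (f s)%:E).
  move=> cf; apply/measurable_EFinP; apply: measurable_funTS.
  exact: continuous_measurable_fun.
have c1 : continuous (fun s : R => (1 + s) * (`|V s| ^+ 2 + `|B (U s)| ^+ 2)).
  by move=> s; apply: cvgM; [exact: cw|apply: cvgD; [exact: cn cV s|exact: cn cBU s]].
have c3 : continuous (fun s : R => (1 + s) ^+ 3 * (`|B (V s)| ^+ 2 + `|A (U s)| ^+ 2)).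
  move=> s; apply: cvgM.
    apply: (@continuous_comp _ _ _ (fun s : R => 1 + s) (fun r => r ^+ 3)); first exact: cw.
    exact: exprn_continuous.
  by apply: cvgD; [exact: cn cBV s|exact: cn cAU s].
have cr : continuous (rate A B U V id) by move=> s; apply: cvgD; [exact: c3|exact: c1].
have mh : measurable (half_line : set (measurableTypeR R)).
  by rewrite /half_line; exact: measurable_itv.
split; apply: le_trans hK; apply: ge0_le_integral => //; try exact: ms.
- move=> s /mem_half_line s0.
  by rewrite lee_fin mulr_ge0 ?addr_ge0 ?sqr_ge0.
- move=> s /mem_half_line s0; rewrite lee_fin /rate lerDr.
  by rewrite mulr_ge0 ?exprn_ge0 ?addr_ge0 ?sqr_ge0.
- move=> s /mem_half_line s0.
  by rewrite lee_fin mulr_ge0 ?exprn_ge0 ?addr_ge0 ?sqr_ge0.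
- move=> s /mem_half_line s0; rewrite lee_fin /rate lerDl.
  by rewrite mulr_ge0 ?addr_ge0 ?sqr_ge0.
Qed.

Theorem theorem2p1 (R : realType) (H : completeNormedModType R)
    (ip : {dot H for idfun}) (A : @operator R H) (m : R -> R) (u0 u1 : H)
    (hip : induces_norm ip)
    (hA : self_adjoint ip A) (hA0 : nonnegative ip A)
    (hm_pos : forall x : R, 0 <= x -> 0 < m x)
    (hm_C1 : C1_hl m)
    (hm_inf : 0 < inf (m @` half_line))
    (hu0 : dom A u0) (hu1 : dom (op_pow ip A 2^-1) u1) :
  let B := op_pow ip A 2^-1 in
  exists eps0 : R, 0 < eps0 /\
    (forall eps : R, 0 < eps < eps0 ->
      exists u : R -> H, kirchhoff_solution ip A m u0 u1 eps u /\
        forall v : R -> H, kirchhoff_solution ip A m u0 u1 eps v ->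
          forall t, 0 <= t -> v t = u t) /\
    exists C : R, forall (eps : R) (u : R -> H), 0 < eps < eps0 ->
      kirchhoff_solution ip A m u0 u1 eps u ->
      let u' := derive_hl u in
      (forall t, 0 <= t -> `|u t| ^+ 2 <= C) /\
      (forall t, 0 <= t -> `|B (u t)| ^+ 2 <= C / (1 + t) ^+ 2) /\
      (forall t, 0 <= t -> `|u' t| ^+ 2 <= C / (1 + t) ^+ 2) /\
      (\int[lebesgue_measure]_(s in half_line)
         ((1 + s) * (`|u' s| ^+ 2 + `|B (u s)| ^+ 2))%:E <= C%:E)%E /\
      (forall t, 0 <= t ->
         eps * `|B (u' t)| ^+ 2 + `|A (u t)| ^+ 2 <= C / (1 + t) ^+ 4) /\
      (\int[lebesgue_measure]_(s in half_line)
         ((1 + s) ^+ 3 * (`|B (u' s)| ^+ 2 + `|A (u s)| ^+ 2))%:E <= C%:E)%E.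
Proof.
move=> B.
(* Membership of [u1] in the domain of A^(1/2) provides a spectral resolution of [A]. *)
have [y [E [hE _]]] := hu1.
have [P cut] := cutoffs_exist hip hA0 hE.
have Cm := C1on_of_C1_hl hm_C1; have [cmr cm1 _] := Cm.
have [mt [dmt mtr]] := C1on_extension Cm.
pose m1 s := derive_hl m (rho s).
have mtE s : 0 <= s -> mt s = m s by move=> s0; rewrite mtr// rho_id.
pose nu := inf (m @` half_line).
have mtnu s : 0 <= s -> nu <= mt s.
  move=> s0; rewrite mtE//; apply: ge_inf; last by exists s => //; exact/mem_half_line.
  by exists 0 => _ [r /mem_half_line r0 <-]; exact/ltW/hm_pos.
pose N := enrg_radius B nu u0 u1.
have [M M0 hM] := bounded_segment (N ^+ 2) cmr.
pose mu := Num.max 1 M.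
have mu1 : 1 <= mu by rewrite le_max lexx.
have mu0 : 0 < mu by exact: lt_le_trans mu1.
have mtmu s : 0 <= s <= N ^+ 2 -> mt s <= mu.
  move=> sN; have /andP[s0 _] := sN.
  by rewrite mtr// (le_trans (ler_norm _))// le_max hM// orbT.
have [L L0 m1L] := bounded_segment (N ^+ 2) cm1.
pose LB := lyap_bound A B nu u0 u1; pose VB := vel_bound A B nu mu u0 u1.
(* The three smallness conditions of the construction; the added 1 avoids a zero denominator, for
   instance when [L = 0]. *)
pose eps0 := Num.min 8^-1 (Num.min (nu / (12 * mu)) (nu / (8 * L * `|LB + VB| + 1))).
have LV0 : 0 < 8 * L * `|LB + VB| + 1 by rewrite ltr_wpDl// mulr_ge0// mulr_ge0.
have eps00 : 0 < eps0 by rewrite !lt_min invr_gt0 ltr0n !divr_gt0// mulr_gt0.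
(* A sum of absolute values dominates each constant without discussing signs; 4 nu / 3 inverts the
   factor of |u|^2 in the Lyapunov bound. *)
pose C := `|4 * nu / 3 * LB| + `|LB| + `|VB| + `|2 * mu * LB|.
have C1 : 4 * nu / 3 * LB <= C.
  by have := ler_norm (4 * nu / 3 * LB); rewrite /C; move: (normr_ge0 LB) (normr_ge0 VB)
    (normr_ge0 (2 * mu * LB)); lra.
have C2 : LB <= C.
  by have := ler_norm LB; rewrite /C; move: (normr_ge0 (4 * nu / 3 * LB)) (normr_ge0 VB)
    (normr_ge0 (2 * mu * LB)); lra.
have C3 : VB <= C.
  by have := ler_norm VB; rewrite /C; move: (normr_ge0 (4 * nu / 3 * LB)) (normr_ge0 LB)
    (normr_ge0 (2 * mu * LB)); lra.
have C4 : 2 * mu * LB <= C.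
  by have := ler_norm (2 * mu * LB); rewrite /C; move: (normr_ge0 (4 * nu / 3 * LB))
    (normr_ge0 LB) (normr_ge0 VB); lra.
have exU eps : 0 < eps < eps0 -> exists U V W, [/\ strong_sol A B mt eps U V W,
    U 0 = u0 /\ V 0 = u1,
    forall t, 0 <= t -> (1 + t) ^+ 4 * (eps * `|B (V t)| ^+ 2 / (2 * mu) + `|A (U t)| ^+ 2) +
      (1 + t) ^+ 2 * `|B (U t)| ^+ 2 + 3 / nu * (`|U t| ^+ 2 / 4) <= LB,
    forall t, 0 <= t -> (1 + t) ^+ 2 * `|V t| ^+ 2 <= VB &
    (\int[lebesgue_measure]_(s in half_line) (rate A B U V id s)%:E <= (2 * mu * LB)%:E)%E].
  move=> /andP[e0]; rewrite !lt_min => /and3P[/ltW e8 /ltW e12 /ltW e3].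
  apply: (strong_solution_exists hip cut dmt hm_inf mtnu mu1 mtmu L0 m1L) => //.
    by rewrite -ler_pdivlMr// mulr_gt0.
  move: e3; rewrite ler_pdivlMr// => e3; apply: le_trans e3.
  rewrite ler_pM2l//; apply: (@le_trans _ _ (8 * L * `|LB + VB|)); last by rewrite lerDl.
  by rewrite ler_wpM2l ?mulr_ge0// ler_norm.
(* The estimates are known for the constructed solution only; uniqueness transfers them to every
   solution. *)
have uniq eps u U V W : 0 < eps < eps0 -> kirchhoff_solution ip A m u0 u1 eps u ->
    strong_sol A B mt eps U V W -> U 0 = u0 -> V 0 = u1 ->
    forall t, 0 <= t -> u t = U t /\ derive_hl u t = V t.
  move=> /andP[e0 _] ku sU hU hV t t0.
  have su := strong_sol_of_kirchhoff cut mtE ku.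
  have [_ [_ hu0' hu1']] := ku.
  have := strong_sol_unique hip cut dmt cm1 e0 hm_inf mtnu su sU _ _ t0.
  by rewrite !(rho_id (lexx 0)) !(rho_id t0) hu0' hu1' hU hV; apply.
exists eps0; split=> //; split.
  move=> eps he; have [U [V [W [sU [hU hV] _ _ _]]]] := exU eps he.
  have [kU _] := kirchhoff_of_strong_sol hip cut mtE dmt sU hU hV.
  by exists U; split=> // v kv t t0; have [] := uniq eps v U V W he kv sU hU hV t t0.
exists C => eps u he ku u'.
have [U [V [W [sU [hU hV] h1 h2 h3]]]] := exU eps he.
have uE t : 0 <= t -> u t = U t /\ u' t = V t := uniq eps u U V W he ku sU hU hV t.
have e0 : 0 < eps by have /andP[] := he.
have w0 (t : R) : 0 <= t -> 0 < 1 + t by move=> t0; rewrite ltr_pwDl.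
have [i1 i2] := rate_integral_parts sU h3.
have parts t : 0 <= t -> [/\ (1 + t) ^+ 4 * (eps * `|B (V t)| ^+ 2 / (2 * mu) + `|A (U t)| ^+ 2) <= LB,
    (1 + t) ^+ 2 * `|B (U t)| ^+ 2 <= LB & 3 / nu * (`|U t| ^+ 2 / 4) <= LB].
  move=> t0; have := h1 t t0; set X := _ * (_ + _); set Y := _ ^+ 2 * _; set Z := 3 / nu * _ => h.
  have X0 : 0 <= X.
    apply: mulr_ge0; first by rewrite exprn_ge0// ltW// w0.
    by rewrite addr_ge0 ?sqr_ge0// divr_ge0 ?mulr_ge0 ?sqr_ge0// ltW.
  have Y0 : 0 <= Y by apply: mulr_ge0; exact: sqr_ge0.
  have Z0 : 0 <= Z.
    by apply: mulr_ge0; apply: divr_ge0 => //; exact: ltW.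
  by split; lra.
split; [|split; [|split; [|split; [|split]]]].
- move=> t t0; have [-> _] := uE t t0; have [_ _ h] := parts t t0.
  apply: le_trans C1; move: h; have -> : 3 / nu * (`|U t| ^+ 2 / 4) = `|U t| ^+ 2 / (4 * nu / 3).
    by field; rewrite gt_eqF.
  by rewrite ler_pdivrMr ?divr_gt0 ?mulr_gt0// mulrC.
- move=> t t0; have [-> _] := uE t t0; have [_ h _] := parts t t0.
  by rewrite ler_pdivlMr ?exprn_gt0 ?w0// mulrC (le_trans h).
- move=> t t0; have [_ ->] := uE t t0.
  by rewrite ler_pdivlMr ?exprn_gt0 ?w0// mulrC (le_trans (h2 t t0)).
- apply: le_trans (_ : (2 * mu * LB)%:E <= _)%E; last by rewrite lee_fin.
  apply: le_trans i1; rewrite le_eqVlt; apply/orP; left; apply/eqP; apply: eq_integral.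
  by move=> s; rewrite inE => /mem_half_line s0; have [-> ->] := uE s s0.
- move=> t t0; have [-> ->] := uE t t0; have [h _ _] := parts t t0.
  have W4 : 0 < (1 + t) ^+ 4 by rewrite exprn_gt0 ?w0.
  rewrite ler_pdivlMr// mulrC; apply: le_trans C4.
  (* Multiplying by 2 mu clears the denominator of the kinetic term and, as 2 mu is at least 1, only
     enlarges |A u|^2. *)
  apply: (@le_trans _ _ (2 * mu * ((1 + t) ^+ 4 *
    (eps * `|B (V t)| ^+ 2 / (2 * mu) + `|A (U t)| ^+ 2)))); last first.
    by rewrite ler_pM2l// mulr_gt0.
  rewrite [2 * mu * _]mulrCA; apply: ler_wpM2l; first exact: ltW.
  rewrite mulrDr [2 * mu * (_ / _)]mulrC divfK; last by rewrite gt_eqF// mulr_gt0.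
  rewrite lerD2l; apply: ler_peMl; first exact: sqr_ge0.
  by move: mu1; lra.
- apply: le_trans (_ : (2 * mu * LB)%:E <= _)%E; last by rewrite lee_fin.
  apply: le_trans i2; rewrite le_eqVlt; apply/orP; left; apply/eqP; apply: eq_integral.
  by move=> s; rewrite inE => /mem_half_line s0; have [-> ->] := uE s s0.
Qed.
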